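(* Let $X=\{X_n\}$ be a stationary ergodic process with marginal distribution $P_1=P$ on $A$, and let $Q$ be an arbitrary probability distribution on $\hat A$. (a) (Arbitrary i.i.d. codebooks) For any distortion level $D\in(D_{\rm min},D_{\rm av})$, the codes based on almost any realization of the Shannon random codebooks according to the measures $\{Q^n\}$ have codelengths $\ell_n(X_1^n)$ satisfying $$\lim_{n\to\infty}\frac1n\ell_n(X_1^n)=(\log_2e)\,R_1(P,Q,D)\quad\text{bits per symbol, with probability one.}$$ (b) (I.i.d. Gaussian codebooks) Suppose $\rho(x,y)=(x-y)^2$ and $X$ is a real-valued process with finite variance $\sigma^2=\mathrm{Var}(X_1)$. Let $Q$ be the $N(0,\tau^2)$ distribution on $\mathbb R$. Then for any distortion level $D\in(0,\sigma^2+\tau^2)$, the codes based on almost any realization of the Gaussian codebooks according to the measures $\{Q^n\}$ have codelengths $\ell_n(X_1^n)$ satisfying $$\lim_{n\to\infty}\frac1n\ell_n(X_1^n)=\frac12\log_2\left(\frac vD\right)-(\log_2e)\frac{(v-D)(v-\sigma^2)}{2v\tau^2}\quad\text{bits per symbol, with probability one,}$$ where $v=\frac12\left[\tau^2+\sqrt{\tau^4+4D\sigma^2}\right]$.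
   Context: $A,\hat A$ are complete separable metric spaces with their Borel $\sigma$-fields; $\rho:A\times\hat A\to[0,\infty)$ is measurable; $\rho_n(x_1^n,y_1^n)=\frac1n\sum_{i=1}^n\rho(x_i,y_i)$. $Q^n$ is the $n$-fold product of $Q$. $D_{\rm min}=E_P[\operatorname{ess\,inf}_{Y\sim Q}\rho(X,Y)]$ and $D_{\rm av}=E_{P\times Q}[\rho(X,Y)]$; it is assumed that $D_{\rm min}<D_{\rm av}$. $R_1(P,Q,D)=\inf_WH(W\|P\times Q)$, the infimum over all joint distributions $W$ on $A\times\hat A$ with first marginal $P$ and $E_W[\rho(X,Y)]\le D$; $H(W\|V)=E_W[\log\frac{dW}{dV}]$ (natural logarithm) if the density exists, $\infty$ otherwise. In (b), $A=\hat A=\mathbb R$ and $\tau^2>0$. Shannon random codebooks according to $\{Q^n\}$ and the associated codes: for each $n$, the codebook is an infinite sequence $Y_1^n(i)$, $i\ge1$, of i.i.d. random vectors with distribution $Q^n$ on $\hat A^n$, all codebooks being independent of $X$. Let $i_n=\inf\{i\ge1:\rho_n(X_1^n,Y_1^n(i))\le D\}$ ($\inf\emptyset=+\infty$). If $i_n<\infty$, the string $X_1^n$ is described by encoding $i_n$ with Elias' code for the positive integers, whose codeword for $i$ has length $\lfloor\log_2i\rfloor+2\lfloor\log_2(\lfloor\log_2i\rfloor+1)\rfloor+1$ bits, which is at most $\log_2i+2\log_2\log_2i+\mathrm{Const}$ for large $i$. If $i_n=\infty$, $X_1^n$ is described with distortion $D$ or less by some other default scheme. $\ell_n(X_1^n)$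 is the resulting description length in bits. ''Almost any realization of the codebooks ... with probability one'' means almost surely with respect to the joint law of the codebooks and $X$.
   Formalization: In part (b) the formal statement additionally assumes that the source is centred, E[X_1] = 0; for a nonzero mean the stated limit is false, since the true rate depends on E[X_1^2] rather than on Var(X_1). *)

(* Defs.v *)
From HB Require Import structures.
From mathcomp Require Import all_boot all_order all_algebra.
From mathcomp Require Import all_classical all_reals all_analysis.
From mathcomp Require Import ess_sup_inf.

Set Implicit Arguments.
Unset Strict Implicit.
Unset Printing Implicit Defensive.

Import Order.TTheory GRing.Theory Num.Theory.
Import numFieldNormedType.Exports.

Local Open Scope classical_set_scope.
Local Open Scope ring_scope.

#[short(type="completeMetricMeasurableType")]
HB.structure Definition CompleteMetricMeasurable d (K : numDomainType) :=
  { T of Measurable d T & Metric K T & Complete T }.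

Definition borel_separable d (K : numDomainType)
    (A : completeMetricMeasurableType d K) : Prop :=
  (exists2 S : set A, countable S & dense S) /\
  (measurable : set (set A)) = <<s [set U : set A | open U] >>.

Definition log2 (R : realType) (x : R) : R := ln x / ln 2.

(* Processes are indexed from 0: X i is the (i+1)-st variable of the process,
   and block X n w is the string formed by its first n variables. *)
Definition trajectory d0 (Omega : measurableType d0) d (A : measurableType d)
  (X : nat -> {mfun Omega >-> A}) (w : Omega) : nat -> A := fun i => X i w.

Definition block d0 (Omega : measurableType d0) d (A : measurableType d)
  (X : nat -> {mfun Omega >-> A}) (n : nat) (w : Omega) : n.-tuple A :=
  [tuple X i w | i < n].

Definition shift (A : Type) (x : nat -> A) : nat -> A := fun i => x i.+1.

(* The product sigma-algebra on A^nat. *)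
Definition seq_measurable d (A : measurableType d) : set (set (nat -> A)) :=
  <<s [set E | exists i : nat, exists2 B : set A,
        measurable B & E = [set x | B (x i)] ] >>.

Definition stationary (R : realType) d0 (Omega : measurableType d0)
    (Pr : probability Omega R) d (A : measurableType d)
    (X : nat -> {mfun Omega >-> A}) : Prop :=
  forall E : set (nat -> A), seq_measurable E ->
    Pr [set w | E (shift (trajectory X w))] = Pr [set w | E (trajectory X w)].

Definition ergodic (R : realType) d0 (Omega : measurableType d0)
    (Pr : probability Omega R) d (A : measurableType d)
    (X : nat -> {mfun Omega >-> A}) : Prop :=
  forall E : set (nat -> A), seq_measurable E -> @shift A @^-1` E = E ->
    Pr [set w | E (trajectory X w)] = 0%E \/ Pr [set w | E (trajectory X w)] = 1%E.

Definition distortion (R : realType) (A Ahat : Type) (rho : A -> Ahat -> R)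
    (n : nat) (x : n.-tuple A) (y : n.-tuple Ahat) : R :=
  n%:R^-1 * \sum_(i < n) rho (tnth x i) (tnth y i).

Definition squared_error (R : realType) (x y : measurableTypeR R) : R :=
  ((x : R) - (y : R)) ^+ 2.

Definition D_min (R : realType) d (A : measurableType d)
    d' (Ahat : measurableType d') (P : probability A R)
    (Q : probability Ahat R) (rho : A -> Ahat -> R) : \bar R :=
  (\int[P]_x ess_inf Q (fun y => (rho x y)%:E))%E.

Definition D_av (R : realType) d (A : measurableType d)
    d' (Ahat : measurableType d') (P : probability A R)
    (Q : probability Ahat R) (rho : A -> Ahat -> R) : \bar R :=
  (\int[P \x Q]_z (rho z.1 z.2)%:E)%E.

Definition rel_entropy (R : realType) d (T : measurableType d)
    (W V : probability T R) : \bar R :=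
  if pselect (W `<< V)
  then (\int[W]_z lne (Radon_Nikodym (charge_of_finite_measure W) V z))%E
  else +oo%E.

(* The infimum of the empty set is +oo. *)
Definition R_1 (R : realType) d (A : measurableType d)
    d' (Ahat : measurableType d') (rho : A -> Ahat -> R)
    (P : probability A R) (Q : probability Ahat R) (D : R) : \bar R :=
  ereal_inf [set rel_entropy W (P \x Q)%E | W in
    [set W : probability (A * Ahat)%type R |
      (forall B : set A, measurable B -> W (B `*` setT) = P B) /\
      (\int[W]_z (rho z.1 z.2)%:E <= D%:E)%E ] ].

(* Y n j is the codeword number j+1 of the codebook of block length n.  No
   relation is imposed between the codebooks of different block lengths. *)
Record shannon_codebooks (R : realType) d0 (Omega : measurableType d0)
    (Pr : probability Omega R) d (A : measurableType d)
    d' (Ahat : measurableType d') (X : nat -> {mfun Omega >-> A})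
    (Q : probability Ahat R)
    (Y : forall n : nat, nat -> {mfun Omega >-> n.-tuple Ahat}) : Prop := {
  (* Y n j has law Q^n, the measure determined by its values on rectangles *)
  codeword_law : forall (n j : nat) (B : 'I_n -> set Ahat),
    (forall k, measurable (B k)) ->
    Pr [set w | forall k, B k (tnth (Y n j w) k)] = (\prod_(k < n) Q (B k))%E;
  codewords_independent : forall (n : nat) (s : seq nat)
      (B : nat -> set (n.-tuple Ahat)),
    uniq s -> (forall j, measurable (B j)) ->
    Pr [set w | forall j, j \in s -> B j (Y n j w)] =
    (\prod_(j <- s) Pr (Y n j @^-1` B j))%E;
  codebooks_independent_source : forall (E : set (nat -> A)) (F : set Omega),
    seq_measurable E ->
    <<s [set G | exists (n j : nat), exists2 B : set (n.-tuple Ahat),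
          measurable B & G = Y n j @^-1` B] >> F ->
    Pr ([set w | E (trajectory X w)] `&` F) = (Pr [set w | E (trajectory X w)] * Pr F)%E
}.

(* Some i, with i >= 1, if the i-th codeword is the first one within
   distortion D of x; None if there is no such codeword. *)
Definition first_match (R : realType) (A Ahat : Type) (rho : A -> Ahat -> R)
    (D : R) (n : nat) (x : n.-tuple A) (c : nat -> n.-tuple Ahat)
    : option nat :=
  match pselect (exists j, distortion rho x (c j) <= D) with
  | left h => Some (ex_minn h).+1
  | right _ => None
  end.

(* trunc_log 2 i is the integer part of log_2 i for i >= 1. *)
Definition elias_length (i : nat) : nat :=
  (trunc_log 2 i + 2 * trunc_log 2 (trunc_log 2 i).+1 + 1)%N.

(* dflt n w is the length in bits of the description by the default scheme;
   it may depend on the whole outcome, and nothing is assumed about it. *)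
Definition code_length (R : realType) d0 (Omega : measurableType d0)
    d (A : measurableType d) d' (Ahat : measurableType d')
    (rho : A -> Ahat -> R) (D : R) (X : nat -> {mfun Omega >-> A})
    (Y : forall n : nat, nat -> {mfun Omega >-> n.-tuple Ahat})
    (dflt : nat -> Omega -> nat) (n : nat) (w : Omega) : nat :=
  if first_match rho D (block X n w) (fun j => Y n j w) is Some i
  then elias_length i else dflt n w.

(* Main.v *)
Require Import Defs.
From HB Require Import structures.
From mathcomp Require Import all_boot all_order all_algebra.
From mathcomp Require Import ring lra.
From mathcomp Require Import all_classical all_reals all_analysis.
From mathcomp Require Import measurable_realfun ess_sup_inf.
Set Implicit Arguments.
Unset Strict Implicit.
Unset Printing Implicit Defensive.
Import Order.TTheory GRing.Theory Num.Theory.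
Import numFieldNormedType.Exports.
Local Open Scope classical_set_scope.
Local Open Scope ring_scope.

(** Fix a source realization and let [q n] be the probability that a codeword
    drawn from [Q ^ n] lies within distortion [D] of the source block of length
    [n].  The index of the first match in the codebook is geometric with
    parameter [q n], so it is [exp (o(n)) / q n] by Borel-Cantelli, and Elias'
    code spends [log2] of the index plus a logarithmic correction.  The
    codelength per symbol is therefore the limit of [- log2 (q n) / n]
    ([code_length_cvg]).

    Given the block [x], [n] times the distortion of a codeword is a sum of
    independent variables, and its log-moment generating function is [n] times
    the empirical mean of [log_mgf l (x i)].  The ergodic theorem ([birkhoff_ge0], proved from
    the maximal lemma) turns this empirical mean into a constant [Lambda l],
    the mean of [log_mgf l] under the marginal [P].  Chernoff's bound with a
    tilt [l < 0] gives [q n <= exp (- n (l D - Lambda l))].  In the other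
    direction ([chernoff_lower], [near_match_prob_ge]), at a tilt where
    [Lambda] has slope close to [D], the tilted law puts almost all its mass on
    codewords of distortion slightly below [D], so that the upper bound is
    sharp to first exponential order.  Convexity of [Lambda] enters only
    through a continuous selection of subgradients; the condition
    [D_min < D < D_av] says that the slope [D] is taken at some [ls < 0].  So
    the exponent of [q n] is [ls * D - Lambda ls] ([code_length_legendre]).

    This value is [R_1]: the Gibbs inequality, tested on the exponent
    [l * rho - log_mgf l], gives [R_1 >= l * D - Lambda l] for every [l < 0],
    and the law with density [exp (ls * rho - log_mgf ls)] with respect to
    [P \x Q] attains equality ([R_1E]).  If [log_mgf] has mean [-oo], Chernoff's
    upper bound on [q n] and the Gibbs lower bound on [R_1] show that the
    codelength per symbol and [R_1] are both infinite; a match still exists for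
    every large [n], because [D_min < D].

    For the squared error and a Gaussian codebook, completing the square gives
    [log_mgf] in closed form, and the tilt of slope [D] solves a quadratic
    equation whose positive root is [v]; the ergodic theorem is then needed for
    [X i ^+ 2] only ([gaussian_codelength_rate]). *)

(** * Running maxima of partial sums along a sequence *)

Section sequence_space.
Context d (A : measurableType d).

Definition cylinder_base : set (set (nat -> A)) :=
  [set E | exists i : nat, exists2 B : set A,
        measurable B & E = [set x | B (x i)] ].

Definition seq_space := g_sigma_algebraType cylinder_base.

Lemma measurable_coordinate (i : nat) :
  measurable_fun [set: seq_space] (fun x : seq_space => x i).
Proof.
move=> _ B mB; rewrite setTI; apply: sub_sigma_algebra.
by exists i, B.
Qed.

Lemma measurable_to_seq_space d' (T : measurableType d') (f : T -> seq_space) :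
  (forall i, measurable_fun setT (fun t => f t i)) -> measurable_fun setT f.
Proof.
move=> mf; apply: (@measurability _ _ _ _ _ f cylinder_base) => //.
move=> _ [_ [i [B mB ->]] <-].
exact: (mf i _ B mB).
Qed.

Lemma measurable_shift :
  measurable_fun [set: seq_space] (@Defs.shift A : seq_space -> seq_space).
Proof.
apply: measurable_to_seq_space => i.
exact: (measurable_coordinate i.+1).
Qed.

(** The maximum of the first [n] partial sums and 0, computed from the front:
    this form exhibits the relation to the shift on which the maximal lemma
    rests. *)
Fixpoint max_partial_sum (R : realType) (g : A -> R) (n : nat)
    (x : seq_space) : R :=
  if n is m.+1
  then Num.max 0 (g (x 0%N) + max_partial_sum g m (Defs.shift x)) else 0.

Section max_partial_sum.
Context (R : realType) (g : A -> R).
Local Notation M := (max_partial_sum g).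

Lemma max_partial_sum_ge0 n x : 0 <= M n x.
Proof. by case: n => //= n; rewrite le_max lexx. Qed.

Lemma max_partial_sumS n x : M n x <= M n.+1 x.
Proof.
elim: n x => [|n ih] x; first by rewrite [leLHS]/= max_partial_sum_ge0.
rewrite [leLHS]/= [leRHS]/= ge_max le_max lexx/= le_max.
by apply/orP; right; rewrite lerD2l ih.
Qed.

Lemma le_max_partial_sum x m n : (m <= n)%N -> M m x <= M n x.
Proof.
move=> /subnK <-; elim: (n - m)%N => // k ih.
by rewrite addSn; apply: le_trans ih (max_partial_sumS _ _).
Qed.

Lemma partial_sum_le_max n (x : seq_space) : \sum_(i < n) g (x i) <= M n x.
Proof.
elim: n x => [|n ih] x; first by rewrite big_ord0.
rewrite big_ord_recl/= le_max; apply/orP; right.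
by rewrite lerD2l (ih (Defs.shift x)).
Qed.

Lemma measurable_max_partial_sum n :
  measurable_fun setT g -> measurable_fun setT (M n).
Proof.
move=> mg; elim: n => [|n ih]; first exact: measurable_cst.
rewrite (_ : M n.+1 =
  cst 0 \max (fun x : seq_space => g (x 0%N) + M n (Defs.shift x))); last by [].
apply: measurable_maxr; first exact: measurable_cst.
apply: measurable_funD.
  exact: measurableT_comp mg (measurable_coordinate 0).
exact: measurableT_comp ih measurable_shift.
Qed.

Definition unbounded_sums : set seq_space :=
  [set x | forall k : nat, exists n, k%:R < M n x].

(** Dropping the first term changes all later partial sums by the same amount,
    so that unboundedness is invariant under the shift. *)
Lemma unbounded_sums_shift : @Defs.shift A @^-1` unbounded_sums = unbounded_sums.
Proof.
apply/seteqP; split => x /= h k.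
- have [n hn] := h (k + Num.Def.truncn (`|g (x 0%N)|)).+1.
  exists n.+1 => /=; rewrite lt_max; apply/orP; right.
  have g1 : `|g (x 0%N)| < (Num.Def.truncn `|g (x 0%N)|).+1%:R.
    by have /andP[] := truncn_itv (normr_ge0 (g (x 0%N))).
  have g2 : - `|g (x 0%N)| <= g (x 0%N) by exact: lerNnormlW.
  move: hn; rewrite -addnS natrD => hn.
  by lra.
- have [n hn] := h (k + Num.Def.truncn (`|g (x 0%N)|)).+1.
  exists n.
  have g1 : `|g (x 0%N)| < (Num.Def.truncn `|g (x 0%N)|).+1%:R.
    by have /andP[] := truncn_itv (normr_ge0 (g (x 0%N))).
  have g2 : g (x 0%N) <= `|g (x 0%N)| by exact: ler_norm.
  move: hn; rewrite -addnS natrD => hn.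
  have := lt_le_trans hn (max_partial_sumS n x).
  rewrite [X in _ < X]/= lt_max => /orP[|].
    have : (0 : R) <= k%:R by [].
    have : (0 : R) <= `|g (x 0%N)| by [].
    by lra.
  by lra.
Qed.

Lemma measurable_unbounded_sums :
  measurable_fun setT g -> measurable unbounded_sums.
Proof.
move=> mg.
have -> : unbounded_sums = \bigcap_k \bigcup_n [set x | k%:R < M n x].
  apply/seteqP; split => x /=.
    by move=> h k _; have [n hn] := h k; exists n.
  by move=> h k; have [n _ hn] := h k I; exists n.
apply: bigcap_measurable => // k _; apply: bigcup_measurable => n _.
rewrite (_ : [set _ | _] = [set: seq_space] `&` M n @^-1` `]k%:R, +oo[); last first.
  by apply/seteqP; split => x /=; rewrite in_itv/= andbT; tauto.
exact: measurable_max_partial_sum.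
Qed.

End max_partial_sum.
End sequence_space.

(** * The pointwise ergodic theorem *)

Section ergodic_theorem.
Context (R : realType) d0 (Omega : measurableType d0) (Pr : probability Omega R).
Context d (A : measurableType d) (X : nat -> {mfun Omega >-> A}).
Local Notation path := (trajectory X : Omega -> seq_space A).
Local Notation M := max_partial_sum.

Lemma measurable_trajectory : measurable_fun setT path.
Proof. exact: measurable_to_seq_space. Qed.

Lemma stationary_integral (F : seq_space A -> \bar R) :
  stationary Pr X -> measurable_fun setT F -> (forall x, (0 <= F x)%E) ->
  (\int[Pr]_w F (Defs.shift (path w)) = \int[Pr]_w F (path w))%E.
Proof.
move=> stX mF F0.
have mpath := measurable_trajectory.
have mshift : measurable_fun setT (fun w => Defs.shift (path w) : seq_space A).
  exact: measurableT_comp (@measurable_shift _ A) mpath.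
rewrite -[LHS](@ge0_integral_pushforward _ _ _ _ _ _ mshift Pr setT F)//.
rewrite -[RHS](@ge0_integral_pushforward _ _ _ _ _ _ mpath Pr setT F)//.
by apply: eq_measure_integral => B mB _; exact: stX.
Qed.

Section maximal.
Context (g : A -> R).
Hypothesis stX : stationary Pr X.
Hypothesis mg : measurable_fun setT g.
Hypothesis ig : Pr.-integrable setT (fun w => (g (X 0%N w))%:E).

Let mM n : measurable_fun setT (fun w => M g n (path w)).
Proof.
exact: measurableT_comp (measurable_max_partial_sum n mg) measurable_trajectory.
Qed.

Let mMshift n : measurable_fun setT (fun w => M g n (Defs.shift (path w))).
Proof.
apply: (measurableT_comp (measurable_max_partial_sum n mg)).
exact: measurableT_comp (@measurable_shift _ A) measurable_trajectory.
Qed.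

Lemma integral_max_partial_sum_shift n :
  (\int[Pr]_w (M g n (Defs.shift (path w)))%:E =
   \int[Pr]_w (M g n (path w))%:E)%E.
Proof.
apply: (stationary_integral (F := fun x => (M g n x)%:E)) => //.
  by apply/measurable_EFinP; exact: measurable_max_partial_sum.
by move=> x; rewrite lee_fin max_partial_sum_ge0.
Qed.

Let mpos n : measurable [set w | (0 < M g n (path w))%R].
Proof.
rewrite (_ : [set _ | _] = setT `&` (fun w => M g n (path w)) @^-1` `]0, +oo[).
  exact: mM.
by apply/seteqP; split => x /=; rewrite in_itv/= andbT; tauto.
Qed.

Let integrable_shift n : Pr.-integrable setT (fun w => (M g n (path w))%:E) ->
  Pr.-integrable setT (fun w => (M g n (Defs.shift (path w)))%:E).
Proof.
move=> iM; apply/integrableP; split; first exact/measurable_EFinP.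
move/integrableP : iM => [_].
under eq_integral do rewrite gee0_abs ?lee_fin ?max_partial_sum_ge0//.
under [X in _ -> (X < _)%E]eq_integral do
  rewrite gee0_abs ?lee_fin ?max_partial_sum_ge0//.
by rewrite integral_max_partial_sum_shift.
Qed.

Lemma integrable_max_partial_sum n :
  Pr.-integrable setT (fun w => (M g n (path w))%:E).
Proof.
elim: n => [|n ih]; first exact: integrable0.
have isum := integrableD measurableT ig (integrable_shift ih).
apply: le_integrable isum => //; first exact/measurable_EFinP.
move=> w _ /=; rewrite lee_fin.
rewrite (ger0_norm (_ : 0 <= Num.max _ _)); last by rewrite le_max lexx.
by rewrite ge_max normr_ge0 ler_norm.
Qed.

(** Garsia's form of the maximal ergodic lemma: on the event that the running
    maximum is positive, it is at most [g] plus its value after one shift, and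
    these two have the same mean by stationarity. *)
Lemma maximal_ergodic n :
  (0 <= \int[Pr]_w (g (X 0%N w) * \1_[set w | (0 < M g n (path w))%R] w)%:E)%E.
Proof.
have iM := integrable_max_partial_sum n.
have iMs := integrable_shift iM.
have : (\int[Pr]_w ((M g n (path w))%:E - (M g n (Defs.shift (path w)))%:E)
        = 0)%E.
  rewrite (@integralB _ _ _ Pr _ measurableT _ _ iM iMs).
  rewrite integral_max_partial_sum_shift subee//.
  exact: integrable_fin_num iM.
move=> <-; apply: le_integral => //.
- exact: integrableB.
- apply: le_integrable ig => //.
    apply/measurable_EFinP; apply: measurable_funM.
      exact: measurableT_comp mg _.
    exact: measurable_indic.
  move=> w _ /=; rewrite lee_fin normrM ler_piMr// indicE.
  by case: (_ \in _); rewrite ?normr1 ?normr0.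
move=> w _ /=; rewrite -EFinB lee_fin indicE.
case: (boolP (_ \in _)) => [|]; rewrite ?inE ?notin_setE/= => hM.
  rewrite mulr1 lerBlDr.
  have := max_partial_sumS g n (path w).
  by rewrite [X in _ <= X -> _]/= le_max leNgt hM.
rewrite mulr0 (_ : M g n (path w) = 0); first by rewrite sub0r oppr_le0 max_partial_sum_ge0.
by apply/eqP; rewrite eq_le max_partial_sum_ge0 andbT leNgt; exact/negP.
Qed.

(** Unboundedness is shift-invariant, hence of probability 0 or 1.  In the
    second case the events of the maximal lemma would increase to an almost
    sure event, and the mean of [g] would be nonnegative. *)
Lemma partial_sums_bounded : ergodic Pr X ->
  (\int[Pr]_w (g (X 0%N w))%:E < 0)%E ->
  {ae Pr, forall w, exists k : nat, forall n, \sum_(i < n) g (X i w) <= k%:R}.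
Proof.
move=> ergX g0.
have mE := measurable_unbounded_sums mg.
have mpE : measurable [set w | unbounded_sums g (path w)].
  by rewrite -[X in measurable X]setTI; exact: measurable_trajectory.
have [E0|E1] := ergX _ mE (unbounded_sums_shift g).
  exists [set w | unbounded_sums g (path w)]; split => // w /= nb k.
  apply: contrapT => nk; apply: nb; exists k => n.
  rewrite leNgt; apply/negP => hn.
  apply: nk; exists n; apply: lt_le_trans hn _.
  exact: (partial_sum_le_max g n (path w)).
exfalso.
have aeE : {ae Pr, forall w, unbounded_sums g (path w)}.
  exists (~` [set w | unbounded_sums g (path w)]); split => //.
    exact: measurableC.
  by rewrite probability_setC// E1 subee.
have mg0 : measurable_fun setT (fun w => g (X 0%N w)) by exact: measurableT_comp.
have [] := @dominated_convergence _ _ _ Pr setT measurableT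
  (fun n w => (g (X 0%N w) * \1_[set w | (0 < M g n (path w))%R] w)%:E)
  (fun w => (g (X 0%N w))%:E) (fun w => `|(g (X 0%N w))%:E|)%E.
- move=> n; apply/measurable_EFinP; apply: measurable_funM; first exact: mg0.
  exact/measurable_indic/mpos.
- exact/measurable_EFinP.
- apply: filterS aeE => w h _.
  have [n0 hn0] := h 0%N.
  apply: cvg_near_cst; exists n0 => // n /= n0n.
  rewrite indicE mem_set/= ?mulr1//.
  exact: lt_le_trans hn0 (le_max_partial_sum _ _ n0n).
- exact: integrable_abse.
- apply: aeW => w n _ /=; rewrite lee_fin normrM ler_piMr// indicE.
  by case: (_ \in _); rewrite ?normr1 ?normr0.
move=> _ _ hlim.
have : (0 <= \int[Pr]_w (g (X 0%N w))%:E)%E.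
  rewrite -(cvg_lim _ hlim)//; apply: lime_ge.
    by apply/cvg_ex; eexists; exact: hlim.
  by apply: nearW => n; exact: maximal_ergodic.
by rewrite leNgt g0.
Qed.
End maximal.
End ergodic_theorem.

Section empirical_mean.
Context (R : realType).

Definition mean_upto (u : nat -> R) (n : nat) : R := n%:R^-1 * \sum_(i < n) u i.

Lemma near_mean_le (u : nat -> R) (m : R) :
  (forall k : nat, exists c : nat, forall n,
      \sum_(i < n) (u i - (m + k.+1%:R^-1)) <= c%:R) ->
  forall e : R, 0 < e -> \forall n \near \oo, mean_upto u n <= m + e.
Proof.
move=> hu e e0.
have e20 : 0 < e / 2 by rewrite divr_gt0.
have [k _ hk] := near_infty_natSinv_lt (PosNum e20).
have [c hc] := hu k.
near=> n.
have n0 : (0 : R) < n%:R by near: n; exact: nbhs_infty_gtr.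
have cn : 2 * c%:R / e < n%:R by near: n; exact: nbhs_infty_gtr.
rewrite /mean_upto ler_pdivrMl//.
move: (hc n); rewrite big_split/= sumr_const card_ord -[_ *+ n]mulr_natl => hcn.
have := hk k (leqnn _); rewrite /= => hk'.
move: cn; rewrite ltr_pdivrMr// => cn.
have : n%:R * k.+1%:R^-1 <= n%:R * (e / 2) by rewrite ler_pM2l// ltW.
move: hcn cn; move: (\sum_(i < n) u i) (n%:R : R) (k.+1%:R^-1 : R) (c%:R : R) => S a b C hcn cn hab.
nra.
Unshelve. all: by end_near. Qed.

Lemma cvg_mean (u : nat -> R) (m : R) :
  (forall k : nat, exists c : nat, forall n,
      \sum_(i < n) (u i - (m + k.+1%:R^-1)) <= c%:R) ->
  (forall k : nat, exists c : nat, forall n,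
      \sum_(i < n) (- u i - (- m + k.+1%:R^-1)) <= c%:R) ->
  mean_upto u @ \oo --> m.
Proof.
move=> h1 h2; apply/cvgrPdist_le => e e0.
have := near_mean_le (u := fun i => - u i) h2 e0; have := near_mean_le h1 e0.
apply: filterS2 => n /= hn1.
rewrite /mean_upto sumrN mulrN => hn2.
by rewrite ler_norml; apply/andP; split; rewrite /mean_upto in hn1 *; lra.
Qed.

End empirical_mean.

Section birkhoff.
Context (R : realType) d0 (Omega : measurableType d0) (Pr : probability Omega R).
Context d (A : measurableType d) (X : nat -> {mfun Omega >-> A}).
Hypothesis stX : stationary Pr X.
Hypothesis ergX : ergodic Pr X.

(** Subtracting from [f] a constant larger than its mean leaves a function of
    negative mean, whose partial sums are bounded above.  Used for [f] and for
    [- f], this bounds the empirical means on both sides. *)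
Lemma birkhoff_one_sided (f : A -> R) (m : R) :
  measurable_fun setT f -> Pr.-integrable setT (fun w => (f (X 0%N w))%:E) ->
  (\int[Pr]_w (f (X 0%N w))%:E = m%:E)%E ->
  {ae Pr, forall w, forall k : nat, exists c : nat, forall n,
      \sum_(i < n) (f (X i w) - (m + k.+1%:R^-1)) <= c%:R}.
Proof.
move=> mf intf fm; apply: ae_foralln => k.
have icst : Pr.-integrable setT (fun=> (m + k.+1%:R^-1)%:E).
  exact: finite_measure_integrable_cst.
apply: (@partial_sums_bounded _ _ _ Pr _ _ X
  (fun x => f x - (m + k.+1%:R^-1))) => //.
- by apply: measurable_funB.
- by rewrite [X in integrable _ _ X](_ : _ = ((fun w => (f (X 0%N w))%:E) \-
    (fun=> (m + k.+1%:R^-1)%:E))%E); [exact: integrableB|apply/funext => w/=].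
- under eq_integral do rewrite EFinB.
  rewrite integralB// fm integral_cst// [X in (_ * X)%E]probability_setT mule1.
  by rewrite -EFinB lte_fin; rewrite opprD addrA subrr sub0r oppr_lt0 invr_gt0.
Qed.

Lemma birkhoff_integrable (f : A -> R) (m : R) :
  measurable_fun setT f -> Pr.-integrable setT (fun w => (f (X 0%N w))%:E) ->
  (\int[Pr]_w (f (X 0%N w))%:E = m%:E)%E ->
  {ae Pr, forall w, mean_upto (fun i => f (X i w)) @ \oo --> m}.
Proof.
move=> mf intf fm.
have h1 := birkhoff_one_sided mf intf fm.
have h2 : {ae Pr, forall w, forall k : nat, exists c : nat, forall n,
      \sum_(i < n) (- f (X i w) - (- m + k.+1%:R^-1)) <= c%:R}.
  apply: (@birkhoff_one_sided (fun x => - f x)).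
  - exact: measurableT_comp.
  - exact: integrableN intf.
  - by under eq_integral do rewrite EFinN; rewrite integralN ?fm//= integrable_add_def.
by apply: filterS2 h1 h2 => w; exact: cvg_mean.
Qed.

(** For a nonnegative function of infinite mean, the truncations
    [min f K] already have empirical means tending to arbitrarily large limits. *)
Theorem birkhoff_ge0 (f : A -> R) :
  measurable_fun setT f -> (forall x, 0 <= f x) ->
  {ae Pr, forall w, (fun n => (mean_upto (fun i => f (X i w)) n)%:E) @ \oo -->
    (\int[Pr]_w (f (X 0%N w))%:E)%E}.
Proof.
move=> mf f0.
have mfX : measurable_fun setT (fun w => (f (X 0%N w))%:E).
  by apply/measurable_EFinP; exact: measurableT_comp.
have [foo|] := ltP (\int[Pr]_w (f (X 0%N w))%:E)%E +oo%E.
  have intf : Pr.-integrable setT (fun w => (f (X 0%N w))%:E).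
    apply/integrableP; split => //.
    by under eq_integral do rewrite gee0_abs ?lee_fin//.
  have /fineK fE := integrable_fin_num measurableT intf.
  apply: filterS (birkhoff_integrable mf intf (esym fE)) => w hw.
  by rewrite -fE; apply: cvg_EFin => //; exact: nearW.
rewrite leye_eq => /eqP foo.
pose fK (k : nat) x := Num.min (f x) k%:R.
have mfK k : measurable_fun setT (fK k) by exact: measurable_minr.
have fK0 k x : 0 <= fK k x by rewrite le_min f0 ler0n.
have ifK k : Pr.-integrable setT (fun w => (fK k (X 0%N w))%:E).
  apply: (@le_integrable _ _ _ Pr _ measurableT _ (fun=> k%:R%:E)).
  - by apply/measurable_EFinP; exact: measurableT_comp.
  - move=> w _ /=; rewrite lee_fin !ger0_norm//.
    by rewrite ge_min lexx orbT.
  - exact: finite_measure_integrable_cst.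
have lim_fK : (\int[Pr]_w (fK k (X 0%N w))%:E @[k --> \oo] --> +oo)%E.
  rewrite -foo.
  have -> : (\int[Pr]_w (f (X 0%N w))%:E =
      \int[Pr]_w (limn (fun k => (fK k (X 0%N w))%:E)))%E.
    apply: eq_integral => w _; apply/esym/cvg_lim => //.
    apply: cvg_near_cst; near=> k; congr EFin; apply/min_idPl.
    by near: k; exact: nbhs_infty_ger.
  apply: (@cvg_monotone_convergence _ _ _ Pr _ measurableT
    (fun k w => (fK k (X 0%N w))%:E)) => //.
  - by move=> k; apply/measurable_EFinP; exact: measurableT_comp.
  - by move=> k w _; rewrite lee_fin.
  - move=> w _ m n mn; rewrite lee_fin le_min ge_min lexx/= ge_min.
    by rewrite ler_nat mn orbT.
have ae_fK : {ae Pr, forall w, forall k,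
    mean_upto (fun i => fK k (X i w)) @ \oo -->
      fine (\int[Pr]_w (fK k (X 0%N w))%:E)%E}.
  apply: ae_foralln => k; apply: birkhoff_integrable => //.
  by rewrite fineK//; exact: integrable_fin_num.
apply: filterS ae_fK => w hw; rewrite foo.
apply/cvgeyPge => a.
have /cvgeyPge/(_ (a + 1)) [k _ hk] := lim_fK.
have {}hk := hk k (leqnn _).
have : a + 1 <= fine (\int[Pr]_w (fK k (X 0%N w))%:E)%E.
  by rewrite -lee_fin fineK//; exact: integrable_fin_num.
move=> {}hk; near=> n; rewrite lee_fin.
apply: (@le_trans _ _ (mean_upto (fun i => fK k (X i w)) n)).
  apply: (@le_trans _ _ (fine (\int[Pr]_w (fK k (X 0%N w))%:E)%E - 1)).
    by rewrite lerBrDr.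
  rewrite lerBlDl -lerBlDr; apply: le_trans (ler_norm _) _.
  near: n; move/cvgrPdist_le: (hw k) => /(_ 1 ltr01); exact.
rewrite /mean_upto ler_wpM2l// ?invr_ge0//.
by apply: ler_sum => i _; rewrite ge_min lexx.
Unshelve. all: by end_near. Qed.

End birkhoff.

(** * Laws of i.i.d. blocks *)

Section tuple_rectangles.
Context d (T : measurableType d) (n : nat).

Definition rectangle (B : 'I_n -> set T) : set (n.-tuple T) :=
  [set y | forall k, B k (tnth y k)].

Lemma measurable_rectangle (B : 'I_n -> set T) :
  (forall k, measurable (B k)) -> measurable (rectangle B).
Proof.
move=> mB.
have -> : rectangle B = \bigcap_(k in setT) ((fun y => tnth y k) @^-1` B k).
  by apply/seteqP; split => y /= h k; [move=> _|]; exact: h.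
apply: fin_bigcap_measurable => [|k _]; first exact: finite_finset.
by rewrite -[X in measurable X]setTI; exact: measurable_tnth.
Qed.

Lemma measurable_tupleE : (measurable : set (set (n.-tuple T))) =
  <<s [set rectangle B | B in [set B | forall k, measurable (B k)]] >>.
Proof.
apply/seteqP; split; last first.
  apply: smallest_sub; first exact: sigma_algebra_measurable.
  by move=> _ [B mB <-]; exact: measurable_rectangle.
apply: smallest_sub; first exact: smallest_sigma_algebra.
move=> E; rewrite -bigcup_seq => -[i _ [C mC <-]].
apply: sub_sigma_algebra.
exists (fun k => if k == i then C else setT).
  by move=> k; case: ifP.
rewrite setTI; apply/seteqP; split => y /=.
  by move=> /(_ i); rewrite eqxx.
by move=> Cy k; case: eqP => // ->.
Qed.

Lemma rectangle_measure_unique (R : realType)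
    (m1 m2 : {measure set (n.-tuple T) -> \bar R}) :
  (m1 setT < +oo)%E ->
  (forall B, (forall k, measurable (B k)) ->
     m1 (rectangle B) = m2 (rectangle B)) ->
  forall E, measurable E -> m1 E = m2 E.
Proof.
move=> m1oo m12; apply: (measure_unique _ (fun=> setT) measurable_tupleE).
- move=> _ _ [B mB <-] [C mC <-]; exists (fun k => B k `&` C k).
    by move=> k; exact: measurableI.
  by apply/seteqP; split => y /= => [h|[h1 h2] k]; [split => k; case: (h k)|].
- by move=> _; exists (fun=> setT) => //; apply/seteqP; split.
- by rewrite bigcup_const.
- by move=> _ [B mB <-]; exact: m12.
- by [].
Qed.
End tuple_rectangles.

Section iid_law.
Context (R : realType) d (T : measurableType d) (Q : probability T R).

Definition iid_law n (mu : set (n.-tuple T) -> \bar R) :=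
  forall B, (forall k, measurable (B k)) ->
    mu (rectangle B) = (\prod_(k < n) Q (B k))%E.

Lemma iid_law_setT n (mu : {measure set (n.-tuple T) -> \bar R}) :
  iid_law mu -> mu setT = 1%E.
Proof.
move=> lmu; rewrite (_ : setT = rectangle (fun=> setT)).
  by rewrite lmu// big1// => i _; rewrite probability_setT.
by apply/seteqP; split.
Qed.

Lemma measurable_fun_prod_tnth n (f : 'I_n -> T -> \bar R) :
  (forall k, measurable_fun setT (f k)) ->
  measurable_fun setT (fun y : n.-tuple T => \prod_(k < n) f k (tnth y k))%E.
Proof.
move=> mf.
suff h (s : seq 'I_n) : measurable_fun setT
  (fun y : n.-tuple T => \prod_(k <- s) f k (tnth y k))%E by exact: h.
elim: s => [|k s ih].
  by under eq_fun do rewrite big_nil; exact: measurable_cst.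
under eq_fun do rewrite big_cons.
apply: emeasurable_funM ih.
exact: measurableT_comp (mf k) (measurable_tnth k).
Qed.

Lemma tnth_tail n (y : n.+1.-tuple T) (j : 'I_n) :
  tnth [tuple of behead y] j = tnth y (lift ord0 j).
Proof. by case/tupleP: y => x y; rewrite tnthS; congr tnth; apply/val_inj. Qed.

(** By uniqueness on rectangles, an i.i.d. law on [n.+1]-tuples is the image of
    the product of [Q] and the i.i.d. law of the tail; Tonelli does the rest. *)
Lemma iid_integral_prod n (mu : probability (n.-tuple T) R)
    (f : 'I_n -> T -> \bar R) : iid_law mu ->
  (forall k, measurable_fun setT (f k)) -> (forall k y, (0 <= f k y)%E) ->
  (\int[mu]_y \prod_(k < n) f k (tnth y k) = \prod_(k < n) \int[Q]_y f k y)%E.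
Proof.
elim: n mu f => [|n ih] mu f lmu mf f0.
  rewrite big_ord0; under eq_integral do rewrite big_ord0.
  by rewrite integral_cst// mul1e; exact: iid_law_setT.
pose tl := fun y : n.+1.-tuple T => [tuple of behead y] : n.-tuple T.
have mtl : measurable_fun setT tl by exact: measurable_behead.
pose tlm : {mfun n.+1.-tuple T >-> n.-tuple T} :=
  HB.pack tl (isMeasurableFun.Build _ _ _ _ tl mtl).
pose mu' : probability (n.-tuple T) R := distribution mu tlm.
have lmu' : iid_law mu'.
  move=> B mB; rewrite (_ : mu' (rectangle B) = mu (tl @^-1` rectangle B))//.
  pose B' := fun k : 'I_n.+1 => if unlift ord0 k is Some j then B j else setT.
  have -> : tl @^-1` rectangle B = rectangle B'.
    apply/seteqP; split => y /= h k.
      rewrite /B'; case: unliftP => [j ->|//].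
      by rewrite -tnth_tail; exact: h.
    by have := h (lift ord0 k); rewrite /B' liftK -tnth_tail.
  rewrite lmu; last by move=> k; rewrite /B'; case: unlift.
  rewrite big_ord_recl /B' unlift_none/= probability_setT mul1e.
  by apply: eq_bigr => i _; rewrite liftK.
pose cs := fun z : T * n.-tuple T => [tuple of z.1 :: z.2] : n.+1.-tuple T.
have mcs : measurable_fun setT cs by exact: measurable_cons.
pose nu : {measure set (T * n.-tuple T) -> \bar R} := (Q \x mu')%E.
have muE E : measurable E -> mu E = pushforward nu cs E.
  apply: (@rectangle_measure_unique _ _ _ _ mu
    (measure_function_pushforward__canonical__measure_function_Measure nu mcs)) => //.
    exact: le_lt_trans (probability_le1 mu measurableT) (ltry 1).
  move=> B mB; rewrite [LHS]lmu// big_ord_recl/= /pushforward.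
  have -> : cs @^-1` rectangle B =
      B ord0 `*` rectangle (fun k => B (lift ord0 k)).
    apply/seteqP; split => -[a y] /= h.
      by split; [exact: (h ord0)|move=> k; have := h (lift ord0 k); rewrite tnthS].
    move=> k; case: h => /= h1 h2.
    by case: (unliftP ord0 k) => [j ->|->]; rewrite ?tnthS//; exact: h2.
  rewrite /nu product_measure1E//; last exact: measurable_rectangle.
  by congr (_ * _)%E; apply: esym; apply: lmu' => k; exact: mB.
pose F := (fun y : n.+1.-tuple T => \prod_(k < n.+1) f k (tnth y k))%E.
have mF : measurable_fun setT F by exact: measurable_fun_prod_tnth.
have F0 y : (0 <= F y)%E by apply: prode_ge0 => i _.
rewrite (eq_measure_integral (pushforward nu cs)); last by move=> E mE _; exact: muE.
transitivity (\int[nu]_z (F \o cs) z)%E.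
  exact: (@ge0_integral_pushforward _ _ _ _ _ _ mcs nu setT F).
have mFcs : measurable_fun setT (F \o cs) by exact: measurableT_comp mF mcs.
have Fcs0 z : (0 <= (F \o cs) z)%E by exact: F0.
transitivity (\int[Q]_a fubini_F mu' (F \o cs) a)%E.
  exact: fubini_tonelli1.
rewrite /fubini_F big_ord_recl/=.
rewrite -(ih mu' (fun k => f (lift ord0 k)))//.
rewrite -ge0_integralZr//; last by apply: integral_ge0 => y _; exact: prode_ge0.
apply: eq_integral => a _; rewrite -ge0_integralZl//; last first.
- by move=> y _; exact: prode_ge0.
- by apply: (@measurable_fun_prod_tnth n (fun k => f (lift ord0 k))).
apply: eq_integral => y _; rewrite /F big_ord_recl/= (_ : tnth _ ord0 = a)//.
by congr (_ * _)%E; apply: eq_bigr => k _; rewrite tnthS.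
Qed.
End iid_law.

(** * Matching probabilities and waiting times *)

Section independence.
Context (R : realType) d0 (Omega : measurableType d0) (Pr : probability Omega R).

Lemma borel_cantelli_geometric (F : nat -> set Omega) (c : R) :
  (forall n, measurable (F n)) -> 0 < c < 1 ->
  (forall n, (Pr (F n) <= (c ^+ n)%:E)%E) ->
  {ae Pr, forall w, \forall n \near \oo, ~ F n w}.
Proof.
move=> mF /andP[c0 c1] hF.
exists (lim_sup_set F); split.
- apply: bigcap_measurable => // n _; apply: bigcup_measurable => j _; exact: mF.
- apply: lim_sup_set_cvg0 => //.
  apply: (@le_lt_trans _ _ (1 / (1 - c))%:E); last exact: ltry.
  apply: lime_le; first exact: is_cvg_nneseries.
  apply: nearW => n.
  apply: (@le_trans _ _ (\sum_(0 <= i < n) (c ^+ i)%:E)%E).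
    by apply: lee_sum => i _; exact: hF.
  rewrite sumEFin lee_fin.
  have := @geometric_le_lim R n 1 c ler01 c0.
  rewrite (ger0_norm (ltW c0)) => /(_ c1); rewrite /series/=.
  apply: le_trans; apply: ler_sum => i _.
  by rewrite /geometric/= mul1r.
- move=> w /= nw n _; apply: contrapT => h; apply: nw.
  exists n => // j /= nj Fj; apply: h; exists j => //.
Qed.

Lemma indep_pair_law d1 d2 (T1 : measurableType d1) (T2 : measurableType d2)
    (f : {mfun Omega >-> T1}) (g : {mfun Omega >-> T2}) :
  (forall A B, measurable A -> measurable B ->
     Pr (f @^-1` A `&` g @^-1` B) = (Pr (f @^-1` A) * Pr (g @^-1` B))%E) ->
  forall C : set (T1 * T2), measurable C ->
    (Pr [set w | C (f w, g w)] =
     \int[distribution Pr f]_x distribution Pr g (xsection C x))%E.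
Proof.
move=> fg C mC.
have mfg : measurable_fun setT (fun w => (f w, g w)).
  by apply/measurable_fun_pairP; split; exact: measurable_funPT.
pose m' := measure_function_pushforward__canonical__measure_function_Measure Pr mfg.
have := @product_measure_unique _ _ _ _ _ (distribution Pr f) (distribution Pr g) m'.
by move=> /(_ fg C mC) h; exact: (esym h).
Qed.

(** By independence the probability is an average, over the values of [f], of
    probabilities in which the first component is frozen. *)
Lemma indep_pair_le d1 d2 (T1 : measurableType d1) (T2 : measurableType d2)
    (f : {mfun Omega >-> T1}) (g : {mfun Omega >-> T2}) (S : set T1)
    (C : set (T1 * T2)) (p : R) :
  (forall A B, measurable A -> measurable B ->
     Pr (f @^-1` A `&` g @^-1` B) = (Pr (f @^-1` A) * Pr (g @^-1` B))%E) ->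
  measurable S -> measurable C -> 0 <= p ->
  (forall x, S x -> (Pr [set w | C (x, g w)] <= p%:E)%E) ->
  (Pr [set w | S (f w) /\ C (f w, g w)] <= p%:E)%E.
Proof.
move=> fg mS mC p0 hp.
have mSC : measurable ((S `*` setT) `&` C).
  by apply: measurableI => //; exact: measurableX.
rewrite (_ : [set _ | _] = [set w | ((S `*` setT) `&` C) (f w, g w)]); last first.
  by apply/seteqP; split => w /=; tauto.
rewrite (indep_pair_law fg mSC).
apply: (@le_trans _ _ (\int[distribution Pr f]_x (cst p%:E x))%E).
  apply: ge0_le_integral => //.
  - exact: measurable_fun_xsection.
  - move=> x _; have [Sx|nSx] := pselect (S x).
      apply: le_trans (hp x Sx); rewrite /distribution /pushforward.
      rewrite (_ : g @^-1` _ = [set w | C (x, g w)])//.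
      by apply/seteqP; split => w /=; rewrite /xsection/= inE/=; tauto.
    rewrite (_ : xsection _ x = set0) ?measure0 ?lee_fin//.
    by apply/seteqP; split => y //=; rewrite /xsection/= inE/= => -[[]].
by rewrite integral_cst// [X in (_ * X)%E]probability_setT mule1.
Qed.

End independence.

Section codebooks.
Context (R : realType) d0 (Omega : measurableType d0) (Pr : probability Omega R).
Context d (A : measurableType d) d' (Ahat : measurableType d').
Context (X : nat -> {mfun Omega >-> A}) (Q : probability Ahat R).
Context (Y : forall n : nat, nat -> {mfun Omega >-> n.-tuple Ahat}).
Context (rho : A -> Ahat -> R) (D : R).
Hypothesis mrho : measurable_fun setT (fun z : A * Ahat => rho z.1 z.2).
Hypothesis cb : shannon_codebooks Pr X Q Y.

Definition match_set n : set (n.-tuple A * n.-tuple Ahat) :=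
  [set z | distortion rho z.1 z.2 <= D].

Arguments match_set : clear implicits.

(** All codewords of length [n] have the same law, see [match_probE]; index 0
    is a representative. *)
Definition match_prob n (x : n.-tuple A) : \bar R :=
  distribution Pr (Y n 0%N) [set y | distortion rho x y <= D].

Lemma measurable_distortion n :
  measurable_fun setT
    (fun z : n.-tuple A * n.-tuple Ahat => distortion rho z.1 z.2).
Proof.
apply: measurable_funM; first exact: measurable_cst.
suff h (s : seq 'I_n) : measurable_fun setT
    (fun z : n.-tuple A * n.-tuple Ahat =>
      \sum_(i <- s) rho (tnth z.1 i) (tnth z.2 i)) by exact: h.
elim: s => [|k s ih].
  by under eq_fun do rewrite big_nil; exact: measurable_cst.
under eq_fun do rewrite big_cons.
apply: measurable_funD ih.
apply: (measurableT_comp mrho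
  (g := fun z : n.-tuple A * n.-tuple Ahat => (tnth z.1 k, tnth z.2 k))).
apply/measurable_fun_pairP; split.
  exact: measurableT_comp (measurable_tnth k) measurable_fst.
exact: measurableT_comp (measurable_tnth k) measurable_snd.
Qed.

Lemma measurable_match_set n : measurable (match_set n).
Proof.
rewrite (_ : match_set n = setT `&`
  (fun z : n.-tuple A * n.-tuple Ahat => distortion rho z.1 z.2) @^-1` `]-oo, D]).
  exact: measurable_distortion.
by apply/seteqP; split => x /=; rewrite in_itv/=; tauto.
Qed.

Lemma measurable_ball n (x : n.-tuple A) :
  measurable [set y | distortion rho x y <= D].
Proof.
have := measurable_xsection x (@measurable_match_set n).
congr measurable; apply/seteqP; split => y /=; rewrite /xsection/= inE//.
Qed.

Lemma measurable_match_prob n : measurable_fun setT (@match_prob n).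
Proof.
have := measurable_fun_xsection (distribution Pr (Y n 0%N)) (@measurable_match_set n).
congr measurable_fun; apply/funext => x /=; congr distribution.
by apply/seteqP; split => y /=; rewrite /xsection/= inE.
Qed.

Lemma codeword_iid n j : iid_law Q (distribution Pr (Y n j)).
Proof. by move=> B mB; exact: codeword_law cb n j B mB. Qed.

Lemma codeword_law_unique n j (E : set (n.-tuple Ahat)) : measurable E ->
  Pr (Y n j @^-1` E) = distribution Pr (Y n 0%N) E.
Proof.
move=> mE; apply: (rectangle_measure_unique
  (m1 := distribution Pr (Y n j)) (m2 := distribution Pr (Y n 0%N))) => //.
  exact: le_lt_trans (probability_le1 _ measurableT) (ltry 1).
by move=> B mB; transitivity (\prod_(k < n) Q (B k))%E;
  [exact: codeword_iid|apply: esym; exact: codeword_iid].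
Qed.

Lemma match_probE n j (x : n.-tuple A) :
  match_prob x = Pr [set w | distortion rho x (Y n j w) <= D].
Proof. by apply/esym; exact: (codeword_law_unique j (measurable_ball x)). Qed.

Lemma measurable_block n : measurable_fun setT (block X n).
Proof.
apply/measurable_fun_tnthP => i.
rewrite (_ : _ \o _ = X i); first exact: measurable_funPT.
by apply/funext => w /=; rewrite tnth_mktuple.
Qed.

Definition block_mfun n : {mfun Omega >-> n.-tuple A} :=
  HB.pack (block X n) (isMeasurableFun.Build _ _ _ _ _ (@measurable_block n)).

Definition codebook_prefix n k (w : Omega) : k.-tuple (n.-tuple Ahat) :=
  [tuple Y n j w | j < k].

Lemma measurable_codebook_prefix n k :
  measurable_fun setT (codebook_prefix n k).
Proof.
apply/measurable_fun_tnthP => i.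
rewrite (_ : _ \o _ = Y n i); first exact: measurable_funPT.
by apply/funext => w /=; rewrite tnth_mktuple.
Qed.

Definition codebook_prefix_mfun n k :
    {mfun Omega >-> k.-tuple (n.-tuple Ahat)} :=
  HB.pack (codebook_prefix n k)
    (isMeasurableFun.Build _ _ _ _ _ (@measurable_codebook_prefix n k)).

Let codebook_base : set (set Omega) :=
  [set G | exists (n j : nat), exists2 B : set (n.-tuple Ahat),
          measurable B & G = Y n j @^-1` B].

Lemma indep_block_codebook n k (B : set (n.-tuple A))
    (C : set (k.-tuple (n.-tuple Ahat))) : measurable B -> measurable C ->
  Pr (block_mfun n @^-1` B `&` codebook_prefix_mfun n k @^-1` C) =
  (Pr (block_mfun n @^-1` B) * Pr (codebook_prefix_mfun n k @^-1` C))%E.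
Proof.
move=> mB mC.
pose first_n := fun x : seq_space A => [tuple x i | i < n].
have mfirst : measurable_fun setT first_n.
  apply/measurable_fun_tnthP => i.
  apply: (eq_measurable_fun (fun x : seq_space A => x i)).
    by move=> x _ /=; rewrite tnth_mktuple.
  exact: measurable_coordinate.
have hE : seq_measurable (first_n @^-1` B).
  by have := mfirst measurableT B mB; rewrite setTI.
have hF : <<s codebook_base >> (codebook_prefix n k @^-1` C).
  pose OmegaY := g_sigma_algebraType codebook_base.
  have mcp : measurable_fun setT
      (codebook_prefix n k : OmegaY -> k.-tuple (n.-tuple Ahat)).
    apply/measurable_fun_tnthP => i.
    rewrite (_ : _ \o _ = Y n i); last first.
      by apply/funext => w /=; rewrite tnth_mktuple.
    move=> _ E mE; rewrite setTI; apply: sub_sigma_algebra.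
    by exists n, i, E.
  by have := mcp measurableT C mC; rewrite setTI.
exact: codebooks_independent_source cb _ _ hE hF.
Qed.

Lemma measurable_no_match n k : measurable
  [set z : n.-tuple A * k.-tuple (n.-tuple Ahat) |
    forall j : 'I_k, D < distortion rho z.1 (tnth z.2 j)].
Proof.
have -> : [set z : n.-tuple A * k.-tuple (n.-tuple Ahat) |
    forall j : 'I_k, D < distortion rho z.1 (tnth z.2 j)] =
  \bigcap_(j in [set: 'I_k]) [set z | D < distortion rho z.1 (tnth z.2 j)].
  by apply/seteqP; split => z /= h j; [move=> _|]; exact: h.
apply: fin_bigcap_measurable => [|j _]; first exact: finite_finset.
have mj : measurable_fun setT (fun z : n.-tuple A * k.-tuple (n.-tuple Ahat) =>
    distortion rho z.1 (tnth z.2 j)).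
  apply: (measurableT_comp (@measurable_distortion n)
    (g := fun z : n.-tuple A * k.-tuple (n.-tuple Ahat) => (z.1, tnth z.2 j))).
  apply/measurable_fun_pairP; split; first exact: measurable_fst.
  exact: measurableT_comp (measurable_tnth j) measurable_snd.
rewrite (_ : [set _ | _] = setT `&`
  (fun z : n.-tuple A * k.-tuple (n.-tuple Ahat) =>
    distortion rho z.1 (tnth z.2 j)) @^-1` `]D, +oo[).
  exact: mj.
by apply/seteqP; split => x /=; rewrite in_itv/= andbT; tauto.
Qed.

(** The [k] codewords miss independently, and [(1 - p) ^ k <= exp (- k p)]. *)
Lemma prob_no_match_fixed n k (x : n.-tuple A) (p : R) :
  (p%:E <= match_prob x)%E ->
  (Pr [set w | forall j : 'I_k, (D < distortion rho x (Y n j w))%R]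
    <= (expR (- (k%:R * p)))%:E)%E.
Proof.
move=> px.
have mcompl : measurable (~` [set y | distortion rho x y <= D]).
  by apply: measurableC; exact: measurable_ball.
have := codewords_independent cb (iota_uniq 0 k) (fun=> mcompl).
rewrite (_ : [set w | _] =
    [set w | forall j : 'I_k, (D < distortion rho x (Y n j w))%R]); last first.
  apply/seteqP; split => w /= h j.
    by have := h j; rewrite mem_iota add0n /= ltn_ord => /(_ isT)/negP; rewrite -ltNge.
  by rewrite mem_iota /= add0n => jk; apply/negP; rewrite -ltNge; exact: (h (Ordinal jk)).
move=> ->.
have qfin : match_prob x \is a fin_num by exact: fin_num_measure (measurable_ball x).
move: px; rewrite -(fineK qfin) lee_fin; set q := fine _ => px.
have q1 : q <= 1.
  by rewrite -lee_fin fineK//; apply: probability_le1; exact: measurable_ball.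
have E j : Pr (Y n j @^-1` (~` [set y | distortion rho x y <= D])) = (1 - q)%:E.
  rewrite preimage_setC probability_setC; last first.
    rewrite -[X in measurable X]setTI.
    exact: (@measurable_funPT _ _ _ _ (Y n j) measurableT _ (measurable_ball x)).
  by rewrite EFinB fineK// (match_probE j).
under eq_bigr do rewrite E.
rewrite prodEFin big_const_seq count_predT size_iota iter_mulr_1 lee_fin.
apply: (@le_trans _ _ (expR (- q) ^+ k)).
  rewrite lerXn2r ?nnegrE ?subr_ge0 ?expR_ge0//.
  exact: expR_ge1Dx.
rewrite -expRM_natl ler_expR mulrN lerN2.
by rewrite ler_wpM2l.
Qed.

Lemma prob_no_match n k (S : set (n.-tuple A)) (p : R) : measurable S ->
  (forall x, S x -> (p%:E <= match_prob x)%E) ->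
  (Pr [set w | S (block X n w) /\
        forall j : 'I_k, (D < distortion rho (block X n w) (Y n j w))%R]
    <= (expR (- (k%:R * p)))%:E)%E.
Proof.
move=> mS hS.
have := @indep_pair_le _ _ _ Pr _ _ _ _ (block_mfun n) (codebook_prefix_mfun n k) S
  _ (expR (- (k%:R * p))) (@indep_block_codebook n k) mS (@measurable_no_match n k) (expR_ge0 _).
move=> h.
rewrite (_ : [set _ | _] = [set w | S (block_mfun n w) /\
  [set z : n.-tuple A * k.-tuple (n.-tuple Ahat) |
    forall j : 'I_k, (D < distortion rho z.1 (tnth z.2 j))%R]
  (block_mfun n w, codebook_prefix_mfun n k w)]); last first.
  by apply/seteqP; split => w /= [Sw h']; split => // j;
    have := h' j; rewrite tnth_mktuple.
apply: h => x Sx.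
rewrite (_ : [set _ | _] =
    [set w | forall j : 'I_k, (D < distortion rho x (Y n j w))%R]).
  exact/prob_no_match_fixed/hS.
by apply/seteqP; split => w /= h' j; have := h' j; rewrite tnth_mktuple.
Qed.

Lemma measurable_match_event n j :
  measurable [set w | distortion rho (block X n w) (Y n j w) <= D].
Proof.
have mf : measurable_fun setT (fun w => (block X n w, Y n j w)).
  by apply/measurable_fun_pairP; split; [exact: measurable_block|exact: measurable_funPT].
by have := mf measurableT _ (@measurable_match_set n); rewrite setTI.
Qed.

Lemma measurable_block_event n (S : set (n.-tuple A)) : measurable S ->
  measurable [set w | S (block X n w)].
Proof. by move=> mS; have := @measurable_block n measurableT S mS; rewrite setTI. Qed.

(** A union bound over the first [k] codewords. *)
Lemma prob_match n k (S : set (n.-tuple A)) (p : R) : measurable S -> 0 <= p ->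
  (forall x, S x -> (match_prob x <= p%:E)%E) ->
  (Pr [set w | S (block X n w) /\
        exists j : 'I_k, (distortion rho (block X n w) (Y n j w) <= D)%R]
    <= (k%:R * p)%:E)%E.
Proof.
move=> mS p0 hS.
pose G (j : nat) := [set w | S (block X n w)] `&`
     [set w | (distortion rho (block X n w) (Y n j w) <= D)%R].
have -> : [set w | S (block X n w) /\
        exists j : 'I_k, (distortion rho (block X n w) (Y n j w) <= D)%R] =
   \big[setU/set0]_(j < k) G j.
  rewrite -bigcup_mkord; apply/seteqP; split => w /=.
    by move=> [Sw [j hj]]; exists j => //=.
  by move=> [j /= jk [Sw hj]]; split => //; exists (Ordinal jk).
have mj j : measurable (G j).
  by apply: measurableI; [exact: measurable_block_event|exact: measurable_match_event].
apply: (@le_trans _ _ (\sum_(j < k) p%:E)%E); last first.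
  by rewrite sumEFin sumr_const card_ord mulr_natl.
apply: le_trans (content_subadditive Pr (fun j _ => mj j) _ (@subset_refl _ _)) _.
  exact: bigsetU_measurable.
apply: lee_sum => j _.
have ind B C : measurable B -> measurable C ->
    Pr (block_mfun n @^-1` B `&` Y n j @^-1` C) =
    (Pr (block_mfun n @^-1` B) * Pr (Y n j @^-1` C))%E.
  move=> mB mC.
  have := @indep_block_codebook n j.+1 B [set z | C (tnth z ord_max)] mB.
  have -> : codebook_prefix_mfun n j.+1 @^-1` [set z | C (tnth z ord_max)] =
      Y n j @^-1` C.
    by apply/seteqP; split => w /=; rewrite tnth_mktuple.
  apply; rewrite -[X in measurable X]setTI.
  exact: measurable_tnth.
have := indep_pair_le ind mS (@measurable_match_set n) p0.
by apply => x Sx; rewrite -(match_probE j); exact: hS.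
Qed.

End codebooks.

Section waiting_time.
Context (R : realType) d0 (Omega : measurableType d0) (Pr : probability Omega R).
Context d (A : measurableType d) d' (Ahat : measurableType d').
Context (X : nat -> {mfun Omega >-> A}) (Q : probability Ahat R).
Context (Y : forall n : nat, nat -> {mfun Omega >-> n.-tuple Ahat}).
Context (rho : A -> Ahat -> R) (D : R).
Hypothesis mrho : measurable_fun setT (fun z : A * Ahat => rho z.1 z.2).
Hypothesis cb : shannon_codebooks Pr X Q Y.
Local Notation q := (match_prob Pr Y rho D).

Let mge n (p : R) : measurable [set x : n.-tuple A | (p%:E <= q x)%E].
Proof.
rewrite (_ : [set _ | _] = setT `&` [set x : n.-tuple A | (p%:E <= q x)%E]).
  apply: emeasurable_fun_c_infty; first exact: measurableT.
  exact: measurable_match_prob.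
by rewrite setTI.
Qed.

Let mle n (p : R) : measurable [set x : n.-tuple A | (q x <= p%:E)%E].
Proof.
rewrite (_ : [set _ | _] = setT `&` [set x : n.-tuple A | (q x <= p%:E)%E]).
  apply: emeasurable_fun_infty_c; first exact: measurableT.
  exact: measurable_match_prob.
by rewrite setTI.
Qed.

Let mno n k (S : set (n.-tuple A)) : measurable S ->
  measurable [set w | S (block X n w) /\
        forall j : 'I_k, (D < distortion rho (block X n w) (Y n j w))%R].
Proof.
move=> mS.
have -> : [set w | S (block X n w) /\
        forall j : 'I_k, (D < distortion rho (block X n w) (Y n j w))%R] =
   [set w | S (block X n w)] `&` \bigcap_(j in [set: 'I_k])
     (~` [set w | (distortion rho (block X n w) (Y n j w) <= D)%R]).
  apply/seteqP; split => w /= [Sw h]; split => // j.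
    by move=> _; apply/negP; rewrite -ltNge; exact: h.
  by rewrite ltNge; apply/negP; exact: h.
apply: measurableI; first exact: measurable_block_event.
apply: fin_bigcap_measurable => [|j _]; first exact: finite_finset.
by apply: measurableC; exact: measurable_match_event.
Qed.

Let myes n k (S : set (n.-tuple A)) : measurable S ->
  measurable [set w | S (block X n w) /\
        exists j : 'I_k, (distortion rho (block X n w) (Y n j w) <= D)%R].
Proof.
move=> mS.
have -> : [set w | S (block X n w) /\
        exists j : 'I_k, (distortion rho (block X n w) (Y n j w) <= D)%R] =
   [set w | S (block X n w)] `&` ~` [set w | setT (block X n w) /\
        forall j : 'I_k, (D < distortion rho (block X n w) (Y n j w))%R].
  apply/seteqP; split => w /= [Sw h]; split => //.
    by case: h => j hj [_ /(_ j)]; rewrite ltNge hj.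
  apply: contrapT => nj; apply: h; split => // j.
  by rewrite ltNge; apply/negP => hj; apply: nj; exists j.
apply: measurableI; first exact: measurable_block_event.
by apply: measurableC; exact: mno.
Qed.

(** Among about [exp (n r')] codewords, each matching with probability at least
    [exp (- n r)], none matches with probability at most
    [exp (- exp (n (r' - r)) + 1)], which is summable. *)
Lemma eventually_match (r r' : R) : 0 <= r -> r < r' ->
  {ae Pr, forall w, \forall n \near \oo,
     ((expR (- (n%:R * r)))%:E <= q (block X n w))%E} ->
  {ae Pr, forall w, \forall n \near \oo, exists j : nat,
     j.+1%:R <= expR (n%:R * r') /\ distortion rho (block X n w) (Y n j w) <= D}.
Proof.
move=> r0 rr' hq.
pose k n := Num.Def.truncn (expR (n%:R * r')).
pose S n := [set x : n.-tuple A | ((expR (- (n%:R * r)))%:E <= q x)%E].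
pose F n := [set w | S n (block X n w) /\
        forall j : 'I_(k n), (D < distortion rho (block X n w) (Y n j w))%R].
have mF n : measurable (F n) by apply: mno; exact: mge.
have hF n : (Pr (F n) <= (expR (- (r' - r)) ^+ n)%:E)%E.
  apply: le_trans (@prob_no_match _ _ _ Pr _ _ _ _ X Q Y rho D mrho cb n (k n)
    (S n) (expR (- (n%:R * r))) (@mge n _) (fun x Sx => Sx)) _.
  rewrite lee_fin -expRM_natl ler_expR mulrN lerN2.
  (* the truncation costs a term at most 1, which the 1 in [exp z >= 1 + z]
     absorbs: the resulting bound is exactly geometric *)
  have /andP[_] := truncn_itv (expR_ge0 (n%:R * r')); rewrite -/(k n) => hk.
  have hk1 : expR (n%:R * r') - 1 <= (k n)%:R.
    by move: hk; rewrite -natr1; lra.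
  apply: (@le_trans _ _ ((expR (n%:R * r') - 1) * expR (- (n%:R * r)))); last first.
    by rewrite ler_pM2r ?expR_gt0.
  rewrite mulrBl mul1r -expRD -mulrN -mulrDr.
  have h1 : expR (n%:R * - r) <= 1.
    by rewrite -expR0 ler_expR mulrN oppr_le0 mulr_ge0.
  have h2 := expR_ge1Dx (n%:R * (r' - r)).
  by lra.
have c01 : 0 < expR (- (r' - r)) < 1.
  by rewrite expR_gt0 -expR0 ltr_expR oppr_lt0 subr_gt0.
have bc := borel_cantelli_geometric mF c01 hF.
move: hq bc; apply: filterS2 => w; apply: filterS2 => n hqn.
apply: contra_notP => nj; split => // j.
rewrite ltNge; apply/negP => hj; apply: nj; exists j; split => //.
have /andP[hk _] := truncn_itv (expR_ge0 (n%:R * r')).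
by apply: le_trans hk; rewrite ler_nat.
Qed.

(** The first [exp (n r')] codewords, each matching with probability at most
    [exp (- n r)], contain a match with probability at most
    [exp (- n (r - r'))]. *)
Lemma eventually_no_match (r r' : R) : r' < r ->
  {ae Pr, forall w, \forall n \near \oo,
     (q (block X n w) <= (expR (- (n%:R * r)))%:E)%E} ->
  {ae Pr, forall w, \forall n \near \oo, forall j : nat,
     j.+1%:R <= expR (n%:R * r') -> D < distortion rho (block X n w) (Y n j w)}.
Proof.
move=> rr' hq.
pose k n := Num.Def.truncn (expR (n%:R * r')).
pose S n := [set x : n.-tuple A | (q x <= (expR (- (n%:R * r)))%:E)%E].
pose F n := [set w | S n (block X n w) /\
        exists j : 'I_(k n), (distortion rho (block X n w) (Y n j w) <= D)%R].
have mF n : measurable (F n) by apply: myes; exact: mle.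
have hF n : (Pr (F n) <= (expR (- (r - r')) ^+ n)%:E)%E.
  apply: le_trans (@prob_match _ _ _ Pr _ _ _ _ X Q Y rho D mrho cb n (k n)
    (S n) (expR (- (n%:R * r))) (@mle n _) (expR_ge0 _) (fun x Sx => Sx)) _.
  rewrite lee_fin -expRM_natl.
  have /andP[hk _] := truncn_itv (expR_ge0 (n%:R * r')).
  apply: (@le_trans _ _ (expR (n%:R * r') * expR (- (n%:R * r)))).
    by rewrite ler_pM2r ?expR_gt0.
  by rewrite -expRD ler_expR; lra.
have c01 : 0 < expR (- (r - r')) < 1.
  by rewrite expR_gt0 -expR0 ltr_expR oppr_lt0 subr_gt0.
have bc := borel_cantelli_geometric mF c01 hF.
move: hq bc; apply: filterS2 => w; apply: filterS2 => n hqn nF j jk.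
rewrite ltNge; apply/negP => hj; apply: nF; split => //.
have jk' : (j < k n)%N.
  rewrite /k -ltnS -(ltr_nat R).
  have /andP[_ hk] := truncn_itv (expR_ge0 (n%:R * r')).
  exact: le_lt_trans jk hk.
by exists (Ordinal jk').
Qed.

(** When the exponent is infinite no codebook of exponential size is
    sufficient, but an infinite codebook still contains a match, which rules
    out the default scheme. *)
Lemma match_of_positive_prob :
  {ae Pr, forall w, forall n, (0 < q (block X n w))%E ->
     exists j, distortion rho (block X n w) (Y n j w) <= D}.
Proof.
have h : {ae Pr, forall w, forall n (m : nat),
    ((m.+1%:R^-1)%:E <= q (block X n w))%E ->
     exists j, distortion rho (block X n w) (Y n j w) <= D}.
  apply: ae_foralln => n; apply: ae_foralln => m.
  pose S := [set x : n.-tuple A | ((m.+1%:R^-1)%:E <= q x)%E].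
  pose F k := [set w | S (block X n w) /\
        forall j : 'I_k, (D < distortion rho (block X n w) (Y n j w))%R].
  have mF k : measurable (F k) by apply: mno; exact: mge.
  exists (\bigcap_k F k); split; first exact: bigcap_measurable.
  - apply/eqP; rewrite eq_le measure_ge0 andbT.
    apply/lee_addgt0Pr => e e0; rewrite add0e.
    have m0 : (0 : R) < m.+1%:R^-1 by rewrite invr_gt0.
    pose k := (Num.Def.truncn (m.+1%:R / e)).+1.
    have hk : m.+1%:R / e < k%:R.
      by have /andP[] := truncn_itv (divr_ge0 (ler0n R m.+1) (ltW e0)).
    apply: (@le_trans _ _ (Pr (F k))).
      apply: le_measure; rewrite ?inE//; first exact: bigcap_measurable.
      by move=> w; apply.
    apply: le_trans (@prob_no_match _ _ _ Pr _ _ _ _ X Q Y rho D mrho cb n k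
      S (m.+1%:R^-1) (@mge n _) (fun x Sx => Sx)) _.
    rewrite lee_fin expRN invf_ple ?posrE ?expR_gt0//.
    apply: le_trans (expR_ge1Dx _).
    have ek : e^-1 < k%:R / m.+1%:R by rewrite ltr_pdivlMr// mulrC.
    by apply: le_trans (ltW ek) _; rewrite lerDr.
  - move=> w /= nw k _; apply: contrapT => nF; apply: nw => hq.
    apply: contrapT => nj; apply: nF; split => // j.
    by rewrite ltNge; apply/negP => hj; apply: nj; exists j.
apply: filterS h => w h n q0.
have qfin : q (block X n w) \is a fin_num.
  exact: fin_num_measure (measurable_ball D mrho (block X n w)).
move: q0; rewrite -(fineK qfin) lte_fin => q0.
have [m _ hm] := near_infty_natSinv_lt (PosNum q0).
apply: (h n m); rewrite -(fineK qfin) lee_fin.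
exact: ltW (hm m (leqnn m)).
Qed.
End waiting_time.

(** * Elias' code and codelengths *)

Section elias.
Context (R : realType).

Let ln2_gt0 : 0 < ln 2 :> R.
Proof. by rewrite ln_gt0// ltr1n. Qed.

Lemma ln_le_affine (a z : R) : 0 < a -> 0 < z -> ln z <= a * z - ln a.
Proof.
move=> a0 z0; rewrite lerBrDl -lnM ?posrE//.
by apply/ltW/ln_sublinear/mulr_gt0.
Qed.

Lemma ln_nat_le_elias (i : nat) : (0 < i)%N ->
  ln i%:R <= (elias_length i)%:R * ln 2 :> R.
Proof.
move=> i0.
apply: (@le_trans _ _ ((trunc_log 2 i).+1%:R * ln 2)).
  rewrite mulr_natl -lnXn// ler_ln ?posrE ?ltr0n// -?natrX ?ltr0n ?expn_gt0//.
  by rewrite ler_nat ltnW// trunc_log_ltn.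
rewrite ler_wpM2r ?(ltW ln2_gt0)// ler_nat /elias_length.
by rewrite addn1 ltnS leq_addr.
Qed.

Lemma trunc_log_le_ln (i : nat) : (0 < i)%N ->
  (trunc_log 2 i)%:R * ln 2 <= ln i%:R :> R.
Proof.
move=> i0; rewrite mulr_natl -lnXn// ler_ln ?posrE ?ltr0n// -?natrX ?ltr0n ?expn_gt0//.
by rewrite ler_nat trunc_logP.
Qed.

(** The correction term in Elias' code is logarithmic in the number of bits of
    the index: [ln z <= a * z - ln a] with a small slope [a] absorbs it in
    [delta * n]. *)
Lemma near_elias_le (r delta : R) : 0 <= r -> 0 < delta ->
  \forall n \near \oo, forall i : nat, (0 < i)%N -> ln i%:R <= n%:R * r ->
    (elias_length i)%:R <= n%:R * (r / ln 2 + delta).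
Proof.
move=> r0 d0.
pose s := r / ln 2.
have s0 : 0 <= s by rewrite divr_ge0// ltW.
pose a := delta * ln 2 / (4 * (s + 1)).
have a0 : 0 < a by rewrite divr_gt0 ?mulr_gt0// ltr_wpDl.
(* [a] makes the linear part of the correction half of [delta * n], and [c],
   which collects the constants, is at most the other half for large [n] *)
pose c := 2 / ln 2 * (a - ln a) + 1.
near=> n => i i0 hi.
have n0 : (0 : R) < n%:R by near: n; exact: nbhs_infty_gtr.
have cn : 2 * c / delta < n%:R by near: n; exact: nbhs_infty_gtr.
set t := trunc_log 2 i; set u := trunc_log 2 t.+1.
have ht : t%:R <= n%:R * s.
  rewrite mulrA ler_pdivlMr//; apply: le_trans hi; exact: trunc_log_le_ln.
have hu : u%:R <= (a * (t%:R + 1) - ln a) / ln 2.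
  rewrite ler_pdivlMr// natr1; apply: le_trans (ln_le_affine a0 (ltr0Sn _ _)).
  exact: trunc_log_le_ln.
have -> : (elias_length i)%:R = t%:R + 2 * u%:R + 1 :> R.
  by rewrite /elias_length -/t -/u natrD [(t + _)%:R]natrD natrM.
have cn' : c < n%:R * (delta / 2).
  by move: cn; rewrite ltr_pdivrMr//; lra.
have ha : 2 / ln 2 * (a * t%:R) <= n%:R * (delta / 2).
  apply: (@le_trans _ _ (2 / ln 2 * (a * (n%:R * (s + 1))))).
    rewrite ler_pM2l ?divr_gt0// ler_pM2l//.
    by rewrite mulrDr mulr1 -[t%:R]addr0 lerD// ltW.
  have s1 : s + 1 != 0 by rewrite gt_eqF// ltr_wpDl.
  rewrite le_eqVlt; apply/orP; left; apply/eqP; rewrite /a.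
  by field; rewrite s1 gt_eqF.
have -> : n%:R * (r / ln 2 + delta) =
  n%:R * s + n%:R * (delta / 2) + n%:R * (delta / 2) by rewrite /s; field; rewrite gt_eqF.
have : 2 * u%:R <= 2 / ln 2 * (a * t%:R) + (c - 1).
  rewrite /c addrK -mulrDr [X in _ <= X * _]mulrC.
  apply: (@le_trans _ _ (2 * ((a * (t%:R + 1) - ln a) / ln 2))).
    by rewrite ler_pM2l.
  by rewrite le_eqVlt; apply/orP; left; apply/eqP; field; rewrite gt_eqF.
lra.
Unshelve. all: by end_near. Qed.

End elias.

Section code_length.
Context (R : realType) d0 (Omega : measurableType d0).
Context d (A : measurableType d) d' (Ahat : measurableType d').
Context (X : nat -> {mfun Omega >-> A}).
Context (Y : forall n : nat, nat -> {mfun Omega >-> n.-tuple Ahat}).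
Context (rho : A -> Ahat -> R) (D : R) (dflt : nat -> Omega -> nat).
Local Notation len := (code_length rho D X Y dflt).

Let ln2_gt0 : 0 < ln 2 :> R.
Proof. by rewrite ln_gt0// ltr1n. Qed.

Lemma code_length_match n w j : distortion rho (block X n w) (Y n j w) <= D ->
  exists i, [/\ distortion rho (block X n w) (Y n i w) <= D, (i <= j)%N &
    len n w = elias_length i.+1].
Proof.
move=> hj; rewrite /code_length /first_match.
case: pselect => [h|]; last by case; exists j.
by case: ex_minnP => i hi mini; exists i; split => //; exact: mini.
Qed.

Lemma code_length_ge n w (r : R) :
  (exists j, distortion rho (block X n w) (Y n j w) <= D) ->
  (forall j : nat, j.+1%:R <= expR (n%:R * r) ->
     D < distortion rho (block X n w) (Y n j w)) ->
  n%:R * (r / ln 2) <= (len n w)%:R.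
Proof.
move=> [j /code_length_match[i [hi _ ->]]] nomatch.
rewrite mulrA ler_pdivrMr//; apply: le_trans (ln_nat_le_elias _ (ltn0Sn i)).
rewrite -[leLHS]expRK ler_ln ?posrE ?expR_gt0 ?ltr0n// leNgt.
by apply/negP => /ltW/nomatch; rewrite ltNge hi.
Qed.

Lemma near_code_length_le w (r delta : R) : 0 <= r -> 0 < delta ->
  (\forall n \near \oo, exists j : nat, j.+1%:R <= expR (n%:R * r) /\
      distortion rho (block X n w) (Y n j w) <= D) ->
  \forall n \near \oo, (len n w)%:R <= n%:R * (r / ln 2 + delta).
Proof.
move=> r0 delta0; move: (near_elias_le r0 delta0); apply: filterS2 => n hn [j [hj1 hj2]].
have [i [_ ij ->]] := code_length_match hj2.
apply: hn => //; rewrite -[leRHS]expRK ler_ln ?posrE ?expR_gt0 ?ltr0n//.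
by apply: le_trans hj1; rewrite ler_nat.
Qed.

End code_length.

Section codelength_limit.
Context (R : realType) d0 (Omega : measurableType d0) (Pr : probability Omega R).
Context d (A : measurableType d) d' (Ahat : measurableType d').
Context (X : nat -> {mfun Omega >-> A}) (Q : probability Ahat R).
Context (Y : forall n : nat, nat -> {mfun Omega >-> n.-tuple Ahat}).
Context (rho : A -> Ahat -> R) (D : R) (dflt : nat -> Omega -> nat).
Hypothesis mrho : measurable_fun setT (fun z : A * Ahat => rho z.1 z.2).
Hypothesis cb : shannon_codebooks Pr X Q Y.
Local Notation q := (match_prob Pr Y rho D).
Local Notation len := (code_length rho D X Y dflt).

Let ln2_gt0 : 0 < ln 2 :> R.
Proof. by rewrite ln_gt0// ltr1n. Qed.

(** The index of the first match lies between [exp (n (L - 2 e))] and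
    [exp (n (L + 2 e))]: one margin [e] separates [L] from the exponent of [q],
    the other one makes the Borel-Cantelli series converge. *)
Theorem code_length_cvg (L : R) : 0 <= L ->
  (forall r, L < r -> {ae Pr, forall w, \forall n \near \oo,
     ((expR (- (n%:R * r)))%:E <= q (block X n w))%E}) ->
  (forall r, r < L -> {ae Pr, forall w, \forall n \near \oo,
     (q (block X n w) <= (expR (- (n%:R * r)))%:E)%E}) ->
  {ae Pr, forall w, (fun n => (len n w)%:R / n%:R : R) @ \oo -->
     log2 (expR 1) * L}.
Proof.
move=> L0 hge hle.
pose e (k : nat) : R := k.+1%:R^-1.
have e0 k : 0 < e k by rewrite invr_gt0.
have up : {ae Pr, forall w, forall k, \forall n \near \oo, exists j : nat,
     j.+1%:R <= expR (n%:R * (L + e k + e k)) /\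
     distortion rho (block X n w) (Y n j w) <= D}.
  apply: ae_foralln => k; apply: (@eventually_match _ _ _ Pr _ _ _ _ X Q Y rho D mrho cb (L + e k)).
  - by rewrite addr_ge0// ltW.
  - by rewrite ltrDl.
  - by apply: hge; rewrite ltrDl.
have low : {ae Pr, forall w, forall k, \forall n \near \oo, forall j : nat,
     j.+1%:R <= expR (n%:R * (L - e k - e k)) ->
     D < distortion rho (block X n w) (Y n j w)}.
  apply: ae_foralln => k.
  apply: (@eventually_no_match _ _ _ Pr _ _ _ _ X Q Y rho D mrho cb (L - e k)).
  - by rewrite ltrBlDr ltrDl.
  - by apply: hle; rewrite ltrBlDr ltrDl.
move: up low; apply: filterS2 => w up low.
rewrite /log2 expRK mul1r mulrC.
apply/cvgrPdist_le => eps eps0.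
have eps' : 0 < eps / 4 * ln 2 by rewrite mulr_gt0// divr_gt0.
have [k _ /(_ k (leqnn k))/= hk] := near_infty_natSinv_lt (PosNum eps').
have Lk0 : 0 <= L + e k + e k by rewrite !addr_ge0// ltW.
have e20 : 0 < eps / 2 by rewrite divr_gt0.
have upn := near_code_length_le dflt Lk0 e20 (up k).
have lown := filterI (low k) (up k).
near=> n.
have n0 : (0 : R) < n%:R by near: n; exact: nbhs_infty_gtr.
have hub : (len n w)%:R <= n%:R * ((L + e k + e k) / ln 2 + eps / 2).
  by near: n; exact: upn.
have [nomatch [j [_ hj]]] : (forall j : nat,
      j.+1%:R <= expR (n%:R * (L - e k - e k)) ->
      D < distortion rho (block X n w) (Y n j w)) /\
    (exists j : nat, j.+1%:R <= expR (n%:R * (L + e k + e k)) /\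
      distortion rho (block X n w) (Y n j w) <= D).
  by near: n; exact: lown.
have hlb := code_length_ge dflt (ex_intro _ j hj) nomatch.
have ek : (e k + e k) / ln 2 <= eps / 2.
  rewrite ler_pdivrMr//; move: hk; rewrite -/(e k) => hk; lra.
rewrite ler_norml; apply/andP; split.
  rewrite lerBrDl -lerBrDr opprK ler_pdivrMr// mulrC; apply: le_trans hub _.
  by rewrite ler_pM2l// -addrA mulrDl; lra.
rewrite lerBlDl -lerBlDr ler_pdivlMr// mulrC; apply: le_trans hlb.
by rewrite ler_pM2l// -addrA -opprD mulrBl; lra.
Unshelve. all: by end_near. Qed.

(** The lower bound on the first matching index bounds the codelength only if
    there is a match; otherwise the length is that of the default scheme. *)
Theorem code_length_cvgy :
  {ae Pr, forall w, \forall n \near \oo, (0 < q (block X n w))%E} ->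
  (forall r, {ae Pr, forall w, \forall n \near \oo,
     (q (block X n w) <= (expR (- (n%:R * r)))%:E)%E}) ->
  {ae Pr, forall w,
     (fun n => ((len n w)%:R / n%:R : R)%:E) @ \oo --> +oo%E}.
Proof.
move=> qpos hle.
have low : {ae Pr, forall w, forall k : nat, \forall n \near \oo, forall j : nat,
     j.+1%:R <= expR (n%:R * (k%:R * ln 2)) :> R ->
     D < distortion rho (block X n w) (Y n j w)}.
  apply: ae_foralln => k; apply: (@eventually_no_match _ _ _ Pr _ _ _ _ X Q Y rho D mrho cb
    (k%:R * ln 2 + 1)) => //.
  by rewrite ltrDl.
have hm := @match_of_positive_prob _ _ _ Pr _ _ _ _ X Q Y rho D mrho cb.
move: hm qpos low; apply: filterS3 => w hm qpos low.
apply/cvgeyPge => a.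
pose k := (Num.Def.truncn `|a|).+1.
have ak : a <= k%:R.
  have /andP[_] := truncn_itv (normr_ge0 a); rewrite -/k => ak.
  exact: le_trans (ler_norm a) (ltW ak).
have := low k; have := nbhs_infty_gtr (0 : R); move: qpos.
apply: filterS3 => n q0 n0 nomatch.
have := code_length_ge dflt (hm n q0) nomatch.
rewrite mulfK ?gt_eqF// => h; rewrite lee_fin ler_pdivlMr// mulrC.
by apply: le_trans h; rewrite ler_pM2l.
Qed.

End codelength_limit.

(** * Exponential bounds for the matching probability *)

Section log_moment_generating_function.
Context (R : realType) d (A : measurableType d) d' (Ahat : measurableType d').
Context (Q : probability Ahat R) (rho : A -> Ahat -> R).

(** For [l <= 0] the integral is finite, the integrand being at most 1. *)
Definition mgf (l : R) (x : A) : R :=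
  fine (\int[Q]_y (expR (l * rho x y))%:E)%E.

Definition log_mgf (l : R) (x : A) : R := ln (mgf l x).

Hypothesis rho0 : forall x y, 0 <= rho x y.
Hypothesis mrho : measurable_fun setT (fun z : A * Ahat => rho z.1 z.2).

Lemma measurable_rho x : measurable_fun setT (rho x).
Proof. exact: (measurableT_comp mrho (measurable_pair1 x)). Qed.

Lemma measurable_expR_rho l x : measurable_fun setT (fun y => expR (l * rho x y)).
Proof.
apply: measurableT_comp; first exact: measurable_expR.
by apply: measurable_funM; [exact: measurable_cst|exact: measurable_rho].
Qed.

Lemma expR_rho_le1 l x y : l <= 0 -> expR (l * rho x y) <= 1.
Proof. by move=> l0; rewrite -expR0 ler_expR mulr_le0_ge0. Qed.

Lemma mgfE l x : l <= 0 -> (mgf l x)%:E = (\int[Q]_y (expR (l * rho x y))%:E)%E.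
Proof.
move=> l0; rewrite /mgf fineK//; apply: integrable_fin_num => //.
apply: (@le_integrable _ _ _ Q _ measurableT _ (cst 1%:E)) => //.
- by apply/measurable_EFinP; exact: measurable_expR_rho.
- move=> y _ /=; rewrite lee_fin normr1 ger0_norm ?expR_ge0//.
  exact: expR_rho_le1.
- exact: finite_measure_integrable_cst.
Qed.

Lemma mgf_le1 l x : l <= 0 -> mgf l x <= 1.
Proof.
move=> l0; rewrite -lee_fin mgfE//.
apply: (@le_trans _ _ (\int[Q]_y cst 1%:E y)%E).
  apply: ge0_le_integral => //.
  - by apply/measurable_EFinP; exact: measurable_expR_rho.
  - by move=> y _; rewrite lee_fin; exact: expR_rho_le1.
by rewrite integral_cst// [X in (_ * X)%E]probability_setT mule1.
Qed.

Lemma integral_gt0 (f : Ahat -> R) : measurable_fun setT f ->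
  (forall y, 0 < f y) -> (0 < \int[Q]_y (f y)%:E)%E.
Proof.
move=> mf f0; rewrite lt_neqAle integral_ge0 ?andbT; last first.
  by move=> y _; rewrite lee_fin ltW.
apply/eqP => f00.
have : (\int[Q]_y `|(f y)%:E| = 0)%E.
  by rewrite [RHS]f00; apply: eq_integral => y _; rewrite gee0_abs// lee_fin ltW.
have mfE : measurable_fun setT (fun y => (f y)%:E) by exact/measurable_EFinP.
move=> /(ae_eq_integral_abs Q measurableT mfE) [N [mN N0 hN]].
have : Q setT = 0%E.
  apply/eqP; rewrite eq_le measure_ge0 andbT -N0; apply: le_measure; rewrite ?inE//.
  by move=> y _; apply: hN => /= /(_ I) [] /eqP; rewrite gt_eqF.
by rewrite probability_setT => /eqP; rewrite onee_eq0.
Qed.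

Lemma mgf_gt0 l x : l <= 0 -> 0 < mgf l x.
Proof.
move=> l0; rewrite -lte_fin mgfE//.
by apply: integral_gt0; [exact: measurable_expR_rho|move=> y; rewrite expR_gt0].
Qed.

Lemma expR_log_mgf l x : l <= 0 -> expR (log_mgf l x) = mgf l x.
Proof. by move=> l0; rewrite lnK// posrE mgf_gt0. Qed.

Lemma log_mgf_le0 l x : l <= 0 -> log_mgf l x <= 0.
Proof. by move=> l0; apply: ln_le0; exact: mgf_le1. Qed.

Lemma measurable_mgf l : l <= 0 -> measurable_fun setT (mgf l).
Proof.
move=> l0; apply/measurable_EFinP.
apply: (eq_measurable_fun (fun x => \int[Q]_y (expR (l * rho x y))%:E)%E).
  by move=> x _; rewrite /= mgfE.
apply: (@measurable_fun_fubini_tonelli_F _ _ _ _ _ Q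
  (fun z : A * Ahat => (expR (l * rho z.1 z.2))%:E)) => [|z]; last first.
  by rewrite lee_fin expR_ge0.
apply/measurable_EFinP; apply: measurableT_comp; first exact: measurable_expR.
by apply: measurable_funM => //; exact: measurable_cst.
Qed.

Lemma measurable_log_mgf l : l <= 0 -> measurable_fun setT (log_mgf l).
Proof.
by move=> l0; apply: measurableT_comp (measurable_mgf l0); exact: measurable_ln.
Qed.

Section iid.
Context n (mu : probability (n.-tuple Ahat) R).
Hypothesis lmu : iid_law Q mu.
Implicit Types (x : n.-tuple A) (l : R).

Lemma distortionE x (y : n.-tuple Ahat) :
  n%:R * distortion rho x y = \sum_(i < n) rho (tnth x i) (tnth y i).
Proof.
rewrite /distortion; case: n x y => [|m] x y; first by rewrite big_ord0 mul0r.
by rewrite mulrA mulfV ?mul1r.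
Qed.

Definition sum_log_mgf l x : R := \sum_(k < n) log_mgf l (tnth x k).

Lemma iid_mgf l x : l <= 0 ->
  (\int[mu]_y (expR (l * (n%:R * distortion rho x y)))%:E =
   (expR (sum_log_mgf l x))%:E)%E.
Proof.
move=> l0.
transitivity (\int[mu]_y \prod_(k < n) (expR (l * rho (tnth x k) (tnth y k)))%:E)%E.
  apply: eq_integral => y _.
  by rewrite prodEFin distortionE mulr_sumr expR_sum.
rewrite (iid_integral_prod (f := fun k y => (expR (l * rho (tnth x k) y))%:E) lmu).
- rewrite expR_sum -prodEFin; apply: eq_bigr => k _.
  by rewrite expR_log_mgf// mgfE.
- by move=> k; apply/measurable_EFinP; exact: measurable_expR_rho.
- by move=> k y; rewrite lee_fin expR_ge0.
Qed.

Let mdist x : measurable_fun setT (fun y : n.-tuple Ahat => distortion rho x y).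
Proof.
exact: (measurableT_comp (@measurable_distortion _ _ _ _ _ rho mrho n)
  (measurable_pair1 x)).
Qed.

Let mexp l (c : R) x : measurable_fun setT (fun y : n.-tuple Ahat =>
  (expR (l * (n%:R * distortion rho x y)) * c)%:E).
Proof.
apply/measurable_EFinP; apply: measurable_funM; last exact: measurable_cst.
apply: measurableT_comp; first exact: measurable_expR.
apply: measurable_funM; first exact: measurable_cst.
by apply: measurable_funM => //; exact: measurable_cst.
Qed.

Let mball (D : R) x : measurable [set y : n.-tuple Ahat | distortion rho x y <= D].
Proof. exact: measurable_ball. Qed.

Let int_exp l (c : R) x : l <= 0 -> 0 <= c ->
  (\int[mu]_y (expR (l * (n%:R * distortion rho x y)) * c)%:E =
   (expR (sum_log_mgf l x) * c)%:E)%E.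
Proof.
move=> l0 c0; under eq_integral do rewrite EFinM.
rewrite ge0_integralZr ?lee_fin//; first by rewrite iid_mgf.
by have := mexp l 1 x; under eq_fun do rewrite mulr1.
Qed.

(** Markov's inequality for [exp (l s)], [s] the total distortion. *)
Lemma chernoff_upper (D : R) l x : l <= 0 ->
  (mu [set y | (distortion rho x y <= D)%R] <=
   (expR (sum_log_mgf l x - n%:R * (l * D)))%:E)%E.
Proof.
move=> l0.
rewrite -[X in (mu X <= _)%E]setIT -integral_indic//.
rewrite expRD -int_exp ?expR_ge0//; apply: ge0_le_integral => //.
- by apply/measurable_EFinP; exact: measurable_indic.
- move=> y _; rewrite lee_fin indicE; case: (boolP (_ \in _)) => [|_]; last first.
    by rewrite mulr_ge0 ?expR_ge0.
  rewrite inE/= => hy; rewrite -expRD -[leLHS]expR0 ler_expR.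
  have -> : l * (n%:R * distortion rho x y) - n%:R * (l * D) =
    (- l) * (n%:R * (D - distortion rho x y)) by ring.
  by rewrite mulr_ge0 ?oppr_ge0// mulr_ge0// subr_ge0.
Qed.

(** With [s] the total distortion, [exp (l s)] is at most
    [exp (l s + t (s - n D))] where [s > n D], at most
    [exp (l s + t (n c - s))] where [s < n c], and at most [exp (l n c)] on the
    rest of the ball.  The last two terms are negligible against the left-hand
    side if the log-moment generating function has slope between [c] and [D]
    at [l]. *)
Lemma chernoff_lower (D l t c : R) x : l + t <= 0 -> 0 <= t ->
  ((expR (sum_log_mgf l x))%:E <=
    mu [set y | (distortion rho x y <= D)%R] * (expR (n%:R * (l * c)))%:E +
    (expR (sum_log_mgf (l + t) x - n%:R * (t * D)))%:E +
    (expR (sum_log_mgf (l - t) x + n%:R * (t * c)))%:E)%E.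
Proof.
move=> lt0 t0.
have l0 : l <= 0 by apply: le_trans lt0; rewrite lerDl.
have l't0 : l - t <= 0 by rewrite lerBlDr add0r (le_trans l0).
have e1 : 0 <= expR (n%:R * (l * c)) by exact: expR_ge0.
rewrite -[X in mu X]setIT -integral_indic//.
rewrite -ge0_integralZr ?lee_fin//; last first.
  by apply/measurable_EFinP; exact: measurable_indic.
rewrite !expRD -(int_exp _ lt0) ?expR_ge0// -(int_exp _ l't0) ?expR_ge0//.
rewrite -[X in (X%:E <= _)%E]mulr1 -(int_exp x l0 ler01).
pose f1 y := ((\1_[set y : n.-tuple Ahat |
    (distortion rho x y <= D)%R] y)%:E * (expR (n%:R * (l * c)))%:E)%E.
pose f2 (y : n.-tuple Ahat) :=
  (expR ((l + t) * (n%:R * distortion rho x y)) * expR (- (n%:R * (t * D))))%:E.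
pose f3 (y : n.-tuple Ahat) :=
  (expR ((l - t) * (n%:R * distortion rho x y)) * expR (n%:R * (t * c)))%:E.
have mf1 : measurable_fun setT f1.
  apply: emeasurable_funM; last exact: measurable_cst.
  by apply/measurable_EFinP; exact: measurable_indic.
have mf2 : measurable_fun setT f2 by exact: mexp.
have mf3 : measurable_fun setT f3 by exact: mexp.
have mf12 : measurable_fun setT (fun y => f1 y + f2 y)%E by exact: emeasurable_funD.
have f1_ge0 y : (0 <= f1 y)%E by rewrite /f1 -EFinM lee_fin mulr_ge0.
have f2_ge0 y : (0 <= f2 y)%E by rewrite lee_fin mulr_ge0 ?expR_ge0.
have f3_ge0 y : (0 <= f3 y)%E by rewrite lee_fin mulr_ge0 ?expR_ge0.
have f12_ge0 y : (0 <= f1 y + f2 y)%E by rewrite adde_ge0.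
rewrite -(@ge0_integralD _ _ _ mu _ measurableT f1 f2)//.
rewrite -(@ge0_integralD _ _ _ mu _ measurableT (fun y => f1 y + f2 y)%E f3)//.
apply: ge0_le_integral => //.
- exact: emeasurable_funD.
- move=> y _; rewrite /f1 /f2 /f3 -EFinM -!EFinD lee_fin mulr1.
rewrite -!expRD; set s := n%:R * distortion rho x y.
rewrite indicE; case: (boolP (_ \in _)); rewrite ?inE ?notin_setE/= => hD.
  rewrite mul1r; have [hc|hc] := leP (n%:R * c) s.
    apply: (@le_trans _ _ (expR (n%:R * (l * c)))).
      rewrite ler_expR -subr_ge0.
      have -> : n%:R * (l * c) - l * s = - l * (s - n%:R * c) by ring.
      by rewrite mulr_ge0 ?oppr_ge0 ?subr_ge0.
    by rewrite -addrA lerDl addr_ge0 ?expR_ge0.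
  apply: (@le_trans _ _ (expR ((l - t) * s + n%:R * (t * c)))).
    rewrite ler_expR -subr_ge0.
    have -> : (l - t) * s + n%:R * (t * c) - l * s = t * (n%:R * c - s) by ring.
    by rewrite mulr_ge0// subr_ge0 ltW.
  by rewrite lerDr addr_ge0 ?expR_ge0.
have {}hD : n%:R * D <= s.
  by rewrite ler_wpM2l// ltW// ltNge; exact/negP.
rewrite mul0r add0r.
apply: (@le_trans _ _ (expR ((l + t) * s - n%:R * (t * D)))).
  rewrite ler_expR -subr_ge0.
  have -> : (l + t) * s - n%:R * (t * D) - l * s = t * (s - n%:R * D) by ring.
  by rewrite mulr_ge0// subr_ge0.
by rewrite lerDl expR_ge0.
Qed.

End iid.
End log_moment_generating_function.

(** * The matching exponent as a Legendre transform *)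

(** An exponential with the largest rate survives the subtraction of two
    exponentials with strictly smaller rates. *)
Lemma near_exp_gap (R : realType) (u v z p : nat -> R)
    (a b La Lb Lc k r : R) :
  u @ \oo --> La -> v @ \oo --> Lb -> z @ \oo --> Lc ->
  Lb - a < La -> Lc + b < La -> k - La < r ->
  (forall n : nat, expR (n%:R * u n) <= p n * expR (n%:R * k) +
     expR (n%:R * v n - n%:R * a) + expR (n%:R * z n + n%:R * b)) ->
  \forall n \near \oo, expR (- (n%:R * r)) <= p n.
Proof.
move=> cvgu cvgv cvgz hb hc hr main.
(* [g] is a quarter of the smallest of the three gaps: one [g] is lost in each
   convergence, the others pay for the constant factors *)
have [g [g0 gb gc gr]] : exists g, [/\ 0 < g, Lb - a + 4 * g <= La,
    Lc + b + 4 * g <= La & k - La + 4 * g <= r].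
  exists (Num.min (La - (Lb - a)) (Num.min (La - (Lc + b)) (r - (k - La))) / 4).
  set x := La - (Lb - _); set y := La - (Lc + _); set w := r - _.
  have h : 4 * (Num.min x (Num.min y w) / 4) = Num.min x (Num.min y w) by field.
  split.
  - by rewrite divr_gt0// !lt_min !subr_gt0 hb hc hr.
  - by rewrite h -lerBrDl ge_min lexx.
  - by rewrite h -lerBrDl !ge_min lexx orbT.
  - by rewrite h -lerBrDl !ge_min lexx !orbT.
move/cvgrPdist_le: cvgu => /(_ g g0) nu.
move/cvgrPdist_le: cvgv => /(_ g g0) nv.
move/cvgrPdist_le: cvgz => /(_ g g0) nz.
near=> n.
have hu : `|La - u n| <= g by near: n; exact: nu.
have hv : `|Lb - v n| <= g by near: n; exact: nv.
have hz : `|Lc - z n| <= g by near: n; exact: nz.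
have ng : 3 <= n%:R * g by rewrite -ler_pdivrMr//; near: n; exact: nbhs_infty_ger.
move: (main n) => {main}.
have {hu} : La - g <= u n by move: hu; rewrite ler_norml => /andP[]; lra.
have {hv} : v n <= Lb + g by move: hv; rewrite ler_norml => /andP[]; lra.
have {hz} : z n <= Lc + g by move: hz; rewrite ler_norml => /andP[]; lra.
move: (u n) (v n) (z n) (p n) => un vn zn pn hz hv hu main.
have e4 : expR (- (n%:R * g)) <= 4^-1.
  rewrite expRN lef_pV2 ?posrE ?expR_gt0//.
  by apply: le_trans (expR_ge1Dx _); lra.
have n0 : (0 : R) <= n%:R by [].
pose E := expR (n%:R * (La - g)).
have E0 : 0 < E by exact: expR_gt0.
have E1 : E <= expR (n%:R * un) by rewrite ler_expR ler_wpM2l.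
have small : expR (n%:R * (La - 3 * g)) <= E / 4.
  have -> : n%:R * (La - 3 * g) =
    n%:R * (La - g) + - (n%:R * g) + - (n%:R * g) by ring.
  rewrite !expRD -/E -mulrA ler_pM2l//; apply: (le_trans _ e4).
  by rewrite ler_piMr ?expR_ge0//; apply: (le_trans e4); lra.
have E2 : expR (n%:R * vn - n%:R * a) <= E / 4.
  apply: le_trans small; rewrite ler_expR -mulrBr ler_wpM2l//; lra.
have E3 : expR (n%:R * zn + n%:R * b) <= E / 4.
  apply: le_trans small; rewrite ler_expR -mulrDr ler_wpM2l//; lra.
have E4 : E / 2 <= pn * expR (n%:R * k) by lra.
have E5 : expR (n%:R * (La - 2 * g)) <= E / 2.
  have -> : n%:R * (La - 2 * g) = n%:R * (La - g) + - (n%:R * g) by ring.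
  by rewrite expRD -/E ler_pM2l//; apply: (le_trans e4); lra.
rewrite -(ler_pM2r (expR_gt0 (n%:R * k))) -expRD.
apply: le_trans E4; apply: le_trans E5; rewrite ler_expR.
by rewrite -mulrN -mulrDr ler_wpM2l//; lra.
Unshelve. all: by end_near. Qed.

Section large_deviations.
Context (R : realType) d0 (Omega : measurableType d0) (Pr : probability Omega R).
Context d (A : measurableType d) d' (Ahat : measurableType d').
Context (X : nat -> {mfun Omega >-> A}) (Q : probability Ahat R).
Context (Y : forall n : nat, nat -> {mfun Omega >-> n.-tuple Ahat}).
Context (rho : A -> Ahat -> R) (D : R).
Hypothesis rho0 : forall x y, 0 <= rho x y.
Hypothesis mrho : measurable_fun setT (fun z : A * Ahat => rho z.1 z.2).
Hypothesis cb : shannon_codebooks Pr X Q Y.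
Local Notation q := (match_prob Pr Y rho D).
Local Notation mean_log_mgf l w :=
  (mean_upto (fun i => log_mgf Q rho l (X i w))).

Lemma sum_log_mgfE l n w :
  sum_log_mgf Q rho l (block X n w) = n%:R * mean_log_mgf l w n.
Proof.
rewrite /sum_log_mgf /mean_upto; under eq_bigr do rewrite tnth_mktuple.
by case: n => [|n]; rewrite ?big_ord0 ?mul0r// mulrA mulfV ?mul1r.
Qed.

Lemma near_match_prob_le w l a : l <= 0 ->
  (\forall n \near \oo, mean_log_mgf l w n <= a) ->
  \forall n \near \oo,
    (q (block X n w) <= (expR (- (n%:R * (l * D - a))))%:E)%E.
Proof.
move=> l0; apply: filterS => n hn.
have iid := @codeword_iid _ _ _ Pr _ _ _ _ X Q Y cb n 0%N.
have h := chernoff_upper rho0 mrho iid D (block X n w) l0.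
apply: (le_trans h).
rewrite lee_fin ler_expR sum_log_mgfE -mulrBr -[leRHS]mulrN opprB.
by rewrite ler_wpM2l// lerB.
Qed.

Lemma near_match_prob_ge w (l t c La Lb Lc r : R) : l + t <= 0 -> 0 <= t ->
  mean_log_mgf l w @ \oo --> La ->
  mean_log_mgf (l + t) w @ \oo --> Lb ->
  mean_log_mgf (l - t) w @ \oo --> Lc ->
  Lb - t * D < La -> Lc + t * c < La -> l * c - La < r ->
  \forall n \near \oo, ((expR (- (n%:R * r)))%:E <= q (block X n w))%E.
Proof.
move=> lt0 t0 cvga cvgb cvgc hb hc hr.
have qfin n : q (block X n w) \is a fin_num.
  exact: fin_num_measure (measurable_ball D mrho (block X n w)).
have := near_exp_gap (p := fun n => fine (q (block X n w))) cvga cvgb cvgc hb hc hr.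
move=> h; have {h} : \forall n \near \oo, expR (- (n%:R * r)) <= fine (q (block X n w)).
  apply: h => n.
  have iid := @codeword_iid _ _ _ Pr _ _ _ _ X Q Y cb n 0%N.
  have := chernoff_lower rho0 mrho iid D c (block X n w) lt0 t0.
  rewrite !sum_log_mgfE -[X in (X * _)%E]/(match_prob Pr Y rho D (block X n w)).
  by rewrite -[X in (X * _)%E](fineK (qfin n)) -EFinM -!EFinD lee_fin.
by apply: filterS => n; rewrite -lee_fin fineK.
Qed.

(** [L] and [G] play the roles of the limiting log-moment generating function
    and its derivative; the only link used between them is that [G] is a
    continuous selection of subgradients. *)
Section legendre.
Variables (L G : R -> R) (ls : R).
Hypothesis ls0 : ls < 0.
Hypothesis subgrad : forall l m, l < 0 -> m < 0 -> L l + (m - l) * G l <= L m.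
Hypothesis Gcont : forall l, l < 0 -> {for l, continuous G}.
Hypothesis Gls : G ls = D.
Hypothesis Glow : exists2 l, l < 0 & G l < D.

Lemma subgradient_nondecreasing l m : l < m -> m < 0 -> G l <= G m.
Proof.
move=> lm m0; have l0 := lt_trans lm m0.
have h1 := subgrad l0 m0; have h2 := subgrad m0 l0.
rewrite -(ler_pM2l (_ : 0 < m - l)) ?subr_gt0//; lra.
Qed.

Lemma subgradient_onto (c : R) : (exists2 l, l < 0 & G l < c) ->
  (exists2 l, l < 0 & c < G l) -> exists2 l, l < 0 & G l = c.
Proof.
move=> [a a0 ha] [b b0 hb].
have ab : a < b.
  rewrite ltNge le_eqVlt; apply/negP => /orP[/eqP e|ba].
    by move: (lt_trans ha hb); rewrite e ltxx.
  by have := subgradient_nondecreasing ba a0; rewrite leNgt (lt_trans ha hb).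
have [l] : exists2 l, l \in `[a, b] & G l = c.
  apply: IVT; first exact: ltW.
    apply: continuous_in_subspaceT => y; rewrite inE/= in_itv/= => /andP[_ yb].
    by apply: Gcont; exact: le_lt_trans b0.
  by apply/andP; split; [rewrite ge_min (ltW ha)|rewrite le_max (ltW hb) orbT].
rewrite in_itv/= => /andP[_ lb] <-; exists l => //.
exact: le_lt_trans b0.
Qed.

Lemma legendre_le l : l < 0 -> l * D - L l <= ls * D - L ls.
Proof. by move=> l0; have := subgrad ls0 l0; rewrite Gls; lra. Qed.

(** [chernoff_lower] needs strict inequalities on both sides of the tilt.
    Moving it from [ls] to a point [l] of slope slightly below [D] provides
    them, at the cost of [eps] in the exponent. *)
Lemma legendre_near eps : 0 < eps -> exists l t c,
  [/\ l + t < 0, 0 < t, L (l + t) - t * D < L l, L (l - t) + t * c < L l &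
      l * c - L l < ls * D - L ls + eps].
Proof.
move=> eps0; have [l2 l20 Gl2] := Glow.
have l2ls : l2 < ls.
  rewrite ltNge le_eqVlt; apply/negP => /orP[/eqP e|h].
    by move: Gl2; rewrite -e Gls ltxx.
  by have := subgradient_nondecreasing h l20; rewrite Gls leNgt Gl2.
have nl2 : 0 < - l2 by rewrite oppr_gt0.
(* the exponent rises by at most [- l] times the loss [D - c] in slope; this
   loss is at most [2 * kappa], and [- l <= - l2] *)
pose kappa := eps / (4 * - l2).
have kappa0 : 0 < kappa by rewrite divr_gt0 ?mulr_gt0.
have kappaE : - l2 * kappa = eps / 4 by rewrite /kappa; field; rewrite lt_eqF.
pose D' := Num.max ((G l2 + D) / 2) (D - kappa).
have D'D : D' < D by rewrite gt_max; apply/andP; split; lra.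
have D'k : D - kappa <= D' by rewrite le_max lexx orbT.
have D'2 : G l2 <= D' by rewrite le_max; apply/orP; left; lra.
have [l] : exists2 l, l \in `[l2, ls] & G l = D'.
  apply: IVT; first exact: ltW.
    apply: continuous_in_subspaceT => y; rewrite inE/= in_itv/= => /andP[_ y1].
    by apply: Gcont; apply: le_lt_trans ls0.
  by rewrite Gls; apply/andP; split;
    [rewrite ge_min D'2|rewrite le_max (ltW D'D) orbT].
rewrite in_itv/= => /andP[l2l lls] Gl.
have l0 : l < 0 by apply: le_lt_trans ls0.
have /cvgrPdist_lt := Gcont l0.
have gap : 0 < Num.min (D - D') kappa by rewrite lt_min subr_gt0 D'D.
move=> /(_ _ gap) [d1 /= d10 hd].
pose t := Num.min (d1 / 2) (- l / 2).
have t0 : 0 < t by rewrite lt_min divr_gt0// divr_gt0// oppr_gt0.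
have td : t < d1 by rewrite gt_min; apply/orP; left; lra.
have tl : l + t < 0.
  have : t <= - l / 2 by rewrite ge_min lexx orbT.
  by move=> h; lra.
have tl' : l - t < 0 by lra.
have Gp : G (l + t) < D.
  have := hd (l + t); rewrite /ball_/= opprD addrA subrr sub0r normrN gtr0_norm//.
  move=> /(_ td); rewrite Gl ltr_norml lt_min => /andP[+ _].
  have : Num.min (D - D') kappa <= D - D' by rewrite ge_min lexx.
  by move=> h1; rewrite ltrNl => h2; lra.
have Gm : D' - kappa < G (l - t).
  have := hd (l - t); rewrite /ball_/= opprB addrA addrAC subrr add0r gtr0_norm//.
  move=> /(_ td); rewrite Gl ltr_norml => /andP[_].
  have : Num.min (D - D') kappa <= kappa by rewrite ge_min lexx orbT.
  by move=> h1 h2; lra.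
exists l, t, (D' - kappa); split => //.
- have := subgrad tl l0.
  have : t * G (l + t) < t * D by rewrite ltr_pM2l.
  by move=> h1 h2; lra.
- have := subgrad tl' l0.
  have : t * (D' - kappa) < t * G (l - t) by rewrite ltr_pM2l.
  by move=> h1 h2; lra.
- have := legendre_le l0.
  have : - l * (D - (D' - kappa)) <= - l2 * (kappa + kappa).
    apply: ler_pM; [by rewrite oppr_ge0 ltW|lra|by rewrite lerN2|lra].
  by move=> h1 h2; lra.
Qed.

Hypothesis L_le0 : forall l, l < 0 -> L l <= 0.

(** By the subgradient inequality at [ls], [m * D <= ls * D - L ls] for every
    [m < 0]; let [m] tend to 0. *)
Lemma legendre_ge0 : 0 <= ls * D - L ls.
Proof.
rewrite leNgt; apply/negP; set h := ls * D - L ls => h0.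
have K0 : 0 < 1 + `|D| by rewrite ltr_pwDl.
have DK : D <= 1 + `|D| by rewrite (le_trans (ler_norm D))// lerDr.
pose m := h / (2 * (1 + `|D|)).
have m0 : m < 0 by rewrite pmulr_llt0// invr_gt0 mulr_gt0.
have mK : m * (1 + `|D|) = h / 2 by rewrite /m; field; rewrite gt_eqF.
have mD : m * (1 + `|D|) <= m * D by rewrite ler_nM2l.
have hm : m * D <= h.
  by have := le_trans (subgrad ls0 m0) (L_le0 m0); rewrite Gls /h; lra.
by move: (le_trans mD hm); rewrite mK; lra.
Qed.

Theorem code_length_legendre (dflt : nat -> Omega -> nat) :
  (forall l, l < 0 -> {ae Pr, forall w, mean_log_mgf l w @ \oo --> L l}) ->
  {ae Pr, forall w,
     (fun n => (code_length rho D X Y dflt n w)%:R / n%:R : R) @ \oo -->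
     log2 (expR 1) * (ls * D - L ls)}.
Proof.
move=> cvgL; apply: (code_length_cvg dflt mrho cb legendre_ge0) => r hr.
  have e0 : 0 < r - (ls * D - L ls) by rewrite subr_gt0.
  have [l [t [c [lt0 t0 h1 h2 h3]]]] := legendre_near e0.
  have l0 : l < 0 by apply: lt_trans lt0; rewrite ltrDl.
  have l't0 : l - t < 0 by rewrite ltrBlDr add0r (lt_trans l0).
  move: (cvgL _ l0) (cvgL _ lt0) (cvgL _ l't0); apply: filterS3 => w ca cb' cc.
  apply: (near_match_prob_ge (ltW lt0) (ltW t0) ca cb' cc h1 h2).
  by move: h3; rewrite [ltRHS]addrC subrK.
move: (cvgL _ ls0); apply: filterS => w cw.
have -> : r = ls * D - (ls * D - r) by ring.
apply: near_match_prob_le; first exact: ltW.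
have g0 : 0 < ls * D - r - L ls by lra.
move/cvgrPdist_le: cw => /(_ _ g0); apply: filterS => n.
by rewrite distrC => hn; have := le_trans (ler_norm _) hn; lra.
Qed.

End legendre.
End large_deviations.

(** * The tilted mean distortion *)

Section tilted_mean.
Context (R : realType) d (A : measurableType d) d' (Ahat : measurableType d').
Context (Q : probability Ahat R) (rho : A -> Ahat -> R).
Hypothesis rho0 : forall x y, 0 <= rho x y.
Hypothesis mrho : measurable_fun setT (fun z : A * Ahat => rho z.1 z.2).
Local Notation mgf := (mgf Q rho).
Local Notation log_mgf := (log_mgf Q rho).
Implicit Types (l m : R) (x : A).

(** The derivative of [mgf] in [l]. *)
Definition mgf1 l x : R := \int[Q]_y (rho x y * expR (l * rho x y)).

(** The mean of [rho x] under the law [expR (l * rho x y - log_mgf l x) Q(dy)],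
    which is the derivative of [log_mgf] in [l]. *)
Definition tilted_mean l x : R := mgf1 l x / mgf l x.

Lemma mul_expR_le (a s : R) : 0 < a -> 0 <= s -> s * expR (- a * s) <= a^-1.
Proof.
move=> a0 s0; rewrite mulNr expRN ler_pdivrMr ?expR_gt0//.
rewrite ler_pdivlMl//; apply: le_trans (expR_ge1Dx _).
by rewrite lerDr.
Qed.

Lemma rho_expR_le l x y : l < 0 -> rho x y * expR (l * rho x y) <= (- l)^-1.
Proof. by move=> l0; rewrite -[X in X * rho _ _]opprK mul_expR_le// oppr_gt0. Qed.

Lemma measurable_rho_expR l x :
  measurable_fun setT (fun y => rho x y * expR (l * rho x y)).
Proof.
apply: measurable_funM; first exact: measurable_rho.
exact: measurable_expR_rho.
Qed.

Lemma integrable_expR_rho l x : l <= 0 ->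
  Q.-integrable setT (fun y => (expR (l * rho x y))%:E).
Proof.
move=> l0; apply: (@le_integrable _ _ _ Q _ measurableT _ (cst 1%:E)) => //.
- by apply/measurable_EFinP; exact: measurable_expR_rho.
- move=> y _ /=; rewrite lee_fin normr1 ger0_norm ?expR_ge0//.
  exact: expR_rho_le1.
- exact: finite_measure_integrable_cst.
Qed.

Lemma integrable_rho_expR l x : l < 0 ->
  Q.-integrable setT (fun y => (rho x y * expR (l * rho x y))%:E).
Proof.
move=> l0; apply: (@le_integrable _ _ _ Q _ measurableT _ (cst (- l)^-1%:E)) => //.
- by apply/measurable_EFinP; exact: measurable_rho_expR.
- move=> y _ /=; rewrite lee_fin ger0_norm ?mulr_ge0 ?expR_ge0//.
  have l'0 : 0 <= (- l)^-1 by rewrite invr_ge0 oppr_ge0 ltW.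
  by rewrite ger0_norm//; exact: rho_expR_le.
- exact: finite_measure_integrable_cst.
Qed.

Lemma tilted_mean_ge0 l x : l <= 0 -> 0 <= tilted_mean l x.
Proof.
move=> l0; rewrite divr_ge0//; last exact/ltW/mgf_gt0.
by apply: Rintegral_ge0 => y _; rewrite mulr_ge0 ?expR_ge0.
Qed.

(** Jensen's inequality for the tilted law. *)
Lemma log_mgf_subgradient l m x : l < 0 -> m <= 0 ->
  log_mgf l x + (m - l) * tilted_mean l x <= log_mgf m x.
Proof.
move=> l0 m0; set u := (m - l) * tilted_mean l x.
have Ml0 := mgf_gt0 Q rho0 mrho x (ltW l0).
have Mm0 := mgf_gt0 Q rho0 mrho x m0.
suff h : expR u * mgf l x <= mgf m x.
  rewrite -[u]expRK -lnM ?posrE ?expR_gt0// mulrC ler_ln ?posrE//.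
  by rewrite mulr_gt0 ?expR_gt0.
have i1 := integrable_expR_rho x (ltW l0).
have i2 := integrable_rho_expR x l0.
have uE : mgf l x = (1 - u) * mgf l x + (m - l) * mgf1 l x.
  rewrite mulrBl mul1r -addrA [- _ + _]addrC.
  rewrite (_ : u * mgf l x = (m - l) * mgf1 l x) ?subrr ?addr0//.
  by rewrite /u -mulrA /tilted_mean divfK// gt_eqF.
rewrite uE.
have j1 : Q.-integrable setT (EFin \o (fun y => (1 - u) * expR (l * rho x y))).
  by apply: eq_integrable (integrableZl measurableT (1 - u) i1).
have j2 : Q.-integrable setT
    (EFin \o (fun y => (m - l) * (rho x y * expR (l * rho x y)))).
  by apply: eq_integrable (integrableZl measurableT (m - l) i2).
have j3 : Q.-integrable setT (EFin \o (fun y => (1 - u) * expR (l * rho x y) +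
    (m - l) * (rho x y * expR (l * rho x y)))).
  by apply: eq_integrable (integrableD measurableT j1 j2).
have -> : (1 - u) * mgf l x + (m - l) * mgf1 l x =
    \int[Q]_y ((1 - u) * expR (l * rho x y) +
      (m - l) * (rho x y * expR (l * rho x y))).
  by rewrite RintegralD// RintegralZl// RintegralZl.
rewrite -RintegralZl//; apply: le_Rintegral => //.
- by apply: eq_integrable (integrableZl measurableT (expR u) j3).
- exact: integrable_expR_rho.
move=> y _; set s := rho x y.
have -> : expR (m * s) = expR u * (expR (l * s) * expR ((m - l) * s - u)).
  by rewrite -!expRD; congr expR; ring.
rewrite ler_pM2l ?expR_gt0//.
have := expR_ge1Dx ((m - l) * s - u); have := expR_gt0 (l * s).
set a := expR (l * s); set b := expR (_ - u) => a0 hb.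
have : a * (1 + ((m - l) * s - u)) <= a * b by rewrite ler_pM2l.
by move=> h; lra.
Qed.

Lemma log_mgf0 x : log_mgf 0 x = 0.
Proof.
rewrite /log_mgf /mgf; under eq_integral do rewrite mul0r expR0.
by rewrite integral_cst// [X in (_ * X)%E]probability_setT mule1/= ln1.
Qed.

Lemma tilted_mean_le l x : l < 0 -> tilted_mean l x <= log_mgf l x / l.
Proof.
move=> l0; have := log_mgf_subgradient x l0 (lexx 0).
by rewrite log_mgf0 ler_ndivlMr//; lra.
Qed.

Lemma log_mgf_nondecreasing l m x : l < 0 -> l <= m -> m <= 0 ->
  log_mgf l x <= log_mgf m x.
Proof.
move=> l0 lm m0; have := log_mgf_subgradient x l0 m0.
have : 0 <= (m - l) * tilted_mean l x.
  by rewrite mulr_ge0 ?subr_ge0// tilted_mean_ge0// ltW.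
by move: (log_mgf l x) (log_mgf m x) (_ * _) => a b u; lra.
Qed.

(** A convex function vanishing at 0 has nondecreasing slopes [log_mgf l / l].
    One integrable tilt therefore makes all of them integrable, see
    [integrable_log_mgf]. *)
Lemma log_mgf_scale l m x : m <= l -> l < 0 ->
  m / l * log_mgf l x <= log_mgf m x.
Proof.
move=> ml l0; have m0 : m <= 0 by rewrite (le_trans ml)// ltW.
apply: le_trans (log_mgf_subgradient x l0 m0).
have : (m - l) * (log_mgf l x / l) <= (m - l) * tilted_mean l x.
  by rewrite ler_wnM2l ?subr_le0// tilted_mean_le.
have -> : (m - l) * (log_mgf l x / l) = m / l * log_mgf l x - log_mgf l x.
  by field; rewrite lt_eqF.
by lra.
Qed.

Lemma tilted_mean_nondecreasing l m x : l <= m -> m < 0 ->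
  tilted_mean l x <= tilted_mean m x.
Proof.
rewrite le_eqVlt => /predU1P[->//|lm] m0; have l0 := lt_trans lm m0.
have h1 := log_mgf_subgradient x l0 (ltW m0).
have h2 := log_mgf_subgradient x m0 (ltW l0).
move: (log_mgf l x) (log_mgf m x) (tilted_mean l x) (tilted_mean m x) h1 h2.
by move=> a b u v h1 h2; rewrite -(ler_pM2l (_ : 0 < m - l)) ?subr_gt0//; lra.
Qed.

Lemma measurable_mgf1 l : l < 0 -> measurable_fun setT (mgf1 l).
Proof.
move=> l0; apply/measurable_EFinP.
apply: (eq_measurable_fun (fun x => \int[Q]_y (rho x y * expR (l * rho x y))%:E)%E).
  move=> x _; rewrite /= /mgf1 /Rintegral fineK//.
  by apply: integrable_fin_num => //; exact: integrable_rho_expR.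
apply: (@measurable_fun_fubini_tonelli_F _ _ _ _ _ Q
  (fun z : A * Ahat => (rho z.1 z.2 * expR (l * rho z.1 z.2))%:E)) => [|z]; last first.
  by rewrite lee_fin mulr_ge0 ?expR_ge0.
apply/measurable_EFinP; apply: measurable_funM => //.
apply: measurableT_comp; first exact: measurable_expR.
by apply: measurable_funM => //; exact: measurable_cst.
Qed.

Lemma measurable_tilted_mean l : l < 0 -> measurable_fun setT (tilted_mean l).
Proof.
move=> l0; have l0' := ltW l0.
apply: (eq_measurable_fun (fun x => mgf1 l x * expR (- log_mgf l x))).
  by move=> x _; rewrite /tilted_mean expRN expR_log_mgf.
apply: measurable_funM; first exact: measurable_mgf1.
apply: measurableT_comp; first exact: measurable_expR.
by apply: measurableT_comp => //; exact: measurable_log_mgf.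
Qed.

Lemma continuous_expR_mull (s : R) : continuous (fun k : R => expR (k * s)).
Proof.
move=> k; apply: continuous_comp; last exact: continuous_expR.
by apply: continuousM; [exact: cvg_id|exact: cvg_cst].
Qed.

Lemma continuous_mgf x l : l < 0 -> {for l, continuous (mgf ^~ x)}.
Proof.
move=> l0.
have := @continuity_under_integral R _ _ Q (fun k y => expR (k * rho x y)) setT
  measurableT (l - 1) 0.
move=> /(_ _ _ (cst 1)) h; apply: h.
- move=> k; rewrite /= in_itv/= => /andP[_ k0].
  exact: integrable_expR_rho (ltW k0).
- by apply: aeW => y _ k _; exact: continuous_expR_mull.
- exact: finite_measure_integrable_cst.
- move=> k; rewrite /= in_itv/= => /andP[_ k0]; apply: aeW => y _.
  by rewrite ger0_norm ?expR_ge0// expR_rho_le1// ltW.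
- by rewrite inE/= in_itv/= l0 andbT ltrBlDr ltrDl.
Qed.

Lemma continuous_mgf1 x l : l < 0 -> {for l, continuous (mgf1 ^~ x)}.
Proof.
move=> l0; have l20 : l / 2 < 0 by lra.
have := @continuity_under_integral R _ _ Q
  (fun k y => rho x y * expR (k * rho x y)) setT measurableT (l - 1) (l / 2).
move=> /(_ _ _ (cst (- (l / 2))^-1)) h; apply: h.
- move=> k; rewrite /= in_itv/= => /andP[_ kl].
  by apply: integrable_rho_expR; exact: lt_trans kl _.
- apply: aeW => y _ k _.
  rewrite /continuous_at; apply: cvgM; first exact: cvg_cst.
  exact: continuous_expR_mull.
- exact: finite_measure_integrable_cst.
- move=> k; rewrite /= in_itv/= => /andP[_ kl]; apply: aeW => y _.
  rewrite ger0_norm ?mulr_ge0 ?expR_ge0//.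
  apply: le_trans (rho_expR_le x y l20).
  by rewrite ler_wpM2l// ler_expR ler_wpM2r// ltW.
- by rewrite inE/= in_itv/=; apply/andP; split; lra.
Qed.

Lemma continuous_tilted_mean x l : l < 0 ->
  {for l, continuous (tilted_mean ^~ x)}.
Proof.
move=> l0; apply: cvgM; first exact: continuous_mgf1.
apply: cvgV; first by rewrite gt_eqF// mgf_gt0// ltW.
exact: continuous_mgf.
Qed.

End tilted_mean.

(** * The range of the averaged tilted mean *)

Section essential_infimum_of_distortion.
Context (R : realType) d (A : measurableType d) d' (Ahat : measurableType d').
Context (Q : probability Ahat R) (rho : A -> Ahat -> R).
Hypothesis rho0 : forall x y, 0 <= rho x y.
Hypothesis mrho : measurable_fun setT (fun z : A * Ahat => rho z.1 z.2).
Local Notation mgf := (mgf Q rho).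
Local Notation log_mgf := (log_mgf Q rho).

Definition min_distortion (x : A) : R :=
  fine (ess_inf Q (fun y => (rho x y)%:E)).

Lemma min_distortionE x :
  (min_distortion x)%:E = ess_inf Q (fun y => (rho x y)%:E).
Proof.
rewrite /min_distortion fineK// ge0_fin_numE; last first.
  by apply/ess_infP; apply: aeW => y; rewrite lee_fin.
rewrite ltey; apply/negP => /eqP /ess_inf_eqyP [N [mN N0 hN]].
have : Q setT = 0%E.
  apply/eqP; rewrite eq_le measure_ge0 andbT -N0; apply: le_measure; rewrite ?inE//.
  by move=> y _; apply: hN.
by rewrite probability_setT => /eqP; rewrite onee_eq0.
Qed.

Lemma min_distortion_ge0 x : 0 <= min_distortion x.
Proof.
rewrite -lee_fin min_distortionE; apply/ess_infP; apply: aeW => y.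
by rewrite lee_fin.
Qed.

Lemma measurable_sublevel x (c : R) : measurable [set y | rho x y <= c].
Proof.
rewrite (_ : [set _ | _] = setT `&` rho x @^-1` `]-oo, c]).
  by apply: measurable_rho.
by apply/seteqP; split => y /=; rewrite in_itv/=; tauto.
Qed.

Lemma sublevel_gt0 x (c : R) : min_distortion x < c ->
  (0 < Q [set y | (rho x y <= c)%R])%E.
Proof.
move=> hc; rewrite lt_neqAle measure_ge0 andbT; apply/eqP => Q0.
have : (c%:E <= ess_inf Q (fun y => (rho x y)%:E))%E.
  apply/ess_infP; exists [set y | rho x y <= c]; split => //.
    exact: measurable_sublevel.
  by move=> y /= /negP; rewrite -ltNge lte_fin => /ltW.
by rewrite -min_distortionE lee_fin leNgt hc.
Qed.

Lemma log_mgf_le_min_distortion l x : l <= 0 ->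
  log_mgf l x <= l * min_distortion x.
Proof.
move=> l0; rewrite -[leRHS]expRK ler_ln ?posrE ?expR_gt0 ?mgf_gt0//.
rewrite -lee_fin mgfE//.
apply: (@le_trans _ _ (\int[Q]_y cst (expR (l * min_distortion x))%:E y)%E).
  apply: ae_ge0_le_integral => //.
  - by apply/measurable_EFinP; exact: measurable_expR_rho.
  - by move=> y _; rewrite lee_fin expR_ge0.
  - have := ess_inf_le Q (fun y => (rho x y)%:E).
    rewrite -min_distortionE => h; apply: filterS h => y; rewrite lee_fin => hy _.
    by rewrite lee_fin ler_expR ler_wnM2l.
by rewrite integral_cst// [X in (_ * X)%E]probability_setT mule1.
Qed.

Lemma log_mgf_ge_sublevel l x (c : R) : l <= 0 -> min_distortion x < c ->
  l * c + ln (fine (Q [set y | (rho x y <= c)%R])) <= log_mgf l x.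
Proof.
move=> l0 hc; have Qpos := sublevel_gt0 hc.
have Qfin : Q [set y | (rho x y <= c)%R] \is a fin_num.
  exact/fin_num_measure/measurable_sublevel.
have p0 : 0 < fine (Q [set y | (rho x y <= c)%R]) by rewrite -lte_fin fineK.
rewrite -[X in X + _]expRK -lnM ?posrE ?expR_gt0//.
rewrite ler_ln ?posrE ?mulr_gt0 ?expR_gt0 ?mgf_gt0//.
rewrite -lee_fin mgfE// EFinM fineK//.
rewrite -[X in (_ * Q X)%E]setIT -integral_indic//; last exact: measurable_sublevel.
rewrite -ge0_integralZl ?lee_fin ?expR_ge0//; last first.
  by apply/measurable_EFinP/measurable_indic/measurable_sublevel.
apply: ge0_le_integral => //.
- apply: emeasurable_funM; first exact: measurable_cst.
  by apply/measurable_EFinP/measurable_indic/measurable_sublevel.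
- by apply/measurable_EFinP; exact: measurable_expR_rho.
move=> y _; rewrite -EFinM lee_fin indicE.
case: (boolP (_ \in _)) => [|_]; last by rewrite mulr0 expR_ge0.
by rewrite inE/= mulr1 => hy; rewrite ler_expR ler_wnM2l.
Qed.

(** As [l] goes to minus infinity the exponential mean concentrates on the
    smallest essential value. *)
Lemma cvg_min_distortion x :
  (fun k : nat => log_mgf (- k.+1%:R) x / - k.+1%:R) @ \oo --> min_distortion x.
Proof.
apply/cvgrPdist_le => e e0.
have e20 : 0 < e / 2 by rewrite divr_gt0.
have hc : min_distortion x < min_distortion x + e / 2 by rewrite ltrDl.
pose lp := ln (fine (Q [set y | (rho x y <= min_distortion x + e / 2)%R])).
near=> k.
have k0 : (0 : R) < k.+1%:R by [].
have l0 : - k.+1%:R <= 0 :> R by rewrite oppr_le0.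
have h1 := log_mgf_le_min_distortion x l0.
have h2 := log_mgf_ge_sublevel l0 hc; rewrite -/lp in h2.
have h3 : - lp <= k.+1%:R * (e / 2).
  rewrite mulrC -ler_pdivrMl// mulrC.
  apply: (@le_trans _ _ k%:R); last by rewrite ler_nat.
  by near: k; exact: nbhs_infty_ger.
rewrite ler_norml; apply/andP; split.
  rewrite lerBrDr addrC -lerBrDr opprK invrN mulrN -mulNr ler_pdivrMr//.
  move: h2 h3; move: (k.+1%:R : R) (log_mgf _ _) (min_distortion x) => K L m h2 h3; lra.
rewrite lerBlDr invrN mulrN -mulNr addrC -lerBlDr ler_pdivlMr//.
apply: (@le_trans _ _ (k.+1%:R * min_distortion x)); last lra.
rewrite mulrC ler_pM2l// gerBl; lra.
Unshelve. all: by end_near. Qed.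

Lemma measurable_min_distortion : measurable_fun setT min_distortion.
Proof.
apply: (@measurable_fun_cvg _ _ _ setT
  (fun (k : nat) x => log_mgf (- k.+1%:R) x / - k.+1%:R)).
- move=> k; apply: measurable_funM; last exact: measurable_cst.
  by apply: measurable_log_mgf => //; rewrite oppr_le0.
- by move=> x _; exact: cvg_min_distortion.
Qed.

End essential_infimum_of_distortion.

Section mean_log_mgf.
Context (R : realType) d (A : measurableType d) d' (Ahat : measurableType d').
Context (P : probability A R) (Q : probability Ahat R) (rho : A -> Ahat -> R).
Hypothesis rho0 : forall x y, 0 <= rho x y.
Hypothesis mrho : measurable_fun setT (fun z : A * Ahat => rho z.1 z.2).
Local Notation mgf := (mgf Q rho).
Local Notation log_mgf := (log_mgf Q rho).
Local Notation tilted_mean := (tilted_mean Q rho).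

Definition Lambda (l : R) : R := \int[P]_x log_mgf l x.
Definition Lambda1 (l : R) : R := \int[P]_x tilted_mean l x.

Hypothesis fin : P.-integrable setT (fun x => (log_mgf (-1) x)%:E).

Lemma integrable_log_mgf l : l < 0 ->
  P.-integrable setT (fun x => (log_mgf l x)%:E).
Proof.
move=> l0.
have mL : measurable_fun setT (fun x => (log_mgf l x)%:E).
  by apply/measurable_EFinP; apply: measurable_log_mgf => //; exact: ltW.
have logl0 x : log_mgf l x <= 0 by apply: log_mgf_le0 => //; exact: ltW.
have logN1 x : log_mgf (-1) x <= 0 by apply: log_mgf_le0 => //; rewrite oppr_le0.
have [lN1|lN1] := leP l (-1).
  apply: (@le_integrable _ _ _ P _ measurableT _
    (fun x => (- l)%:E * (log_mgf (-1) x)%:E)%E mL _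
    (integrableZl measurableT (- l) fin)).
  move=> x _; rewrite -EFinM !abse_EFin lee_fin.
  rewrite (ler0_norm (logl0 x)) normrM (ler0_norm (logN1 x)).
  rewrite gtr0_norm ?oppr_gt0// mulrN lerN2.
  have := @log_mgf_scale _ _ _ _ _ Q rho rho0 mrho (-1) l x lN1.
  by rewrite invrN invr1 mulrN1; apply; rewrite oppr_lt0.
apply: (@le_integrable _ _ _ P _ measurableT _ (fun x => (log_mgf (-1) x)%:E)
  mL _ fin).
move=> x _; have := logN1 x; have := logl0 x.
have : log_mgf (-1) x <= log_mgf l x.
  by apply: log_mgf_nondecreasing => //; exact: ltW.
move: (log_mgf (-1) x) (log_mgf l x) => u v uv u0 v0.
by rewrite !abse_EFin lee_fin (ler0_norm u0) (ler0_norm v0) lerN2.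
Qed.

Lemma integrable_tilted_mean l : l < 0 ->
  P.-integrable setT (fun x => (tilted_mean l x)%:E).
Proof.
move=> l0.
apply: (@le_integrable _ _ _ P _ measurableT _
    (fun x => (l^-1)%:E * (log_mgf l x)%:E)%E).
- by apply/measurable_EFinP; exact: measurable_tilted_mean.
- move=> x _; rewrite -EFinM !abse_EFin lee_fin.
  rewrite ger0_norm; last by apply: tilted_mean_ge0 => //; exact: ltW.
  by apply: le_trans (ler_norm _); rewrite mulrC tilted_mean_le.
- exact: (integrableZl measurableT l^-1 (integrable_log_mgf l0)).
Qed.

Lemma Lambda_subgradient l m : l < 0 -> m < 0 ->
  Lambda l + (m - l) * Lambda1 l <= Lambda m.
Proof.
move=> l0 m0.
have i1 := integrable_log_mgf l0; have i2 := integrable_tilted_mean l0.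
have j2 : P.-integrable setT (EFin \o (fun x => (m - l) * tilted_mean l x)).
  by apply: eq_integrable (integrableZl measurableT (m - l) i2).
rewrite /Lambda1 -(RintegralZl (m - l) measurableT i2).
rewrite /Lambda -(RintegralD measurableT i1 j2).
apply: (le_Rintegral measurableT _ (integrable_log_mgf m0)).
  by apply: eq_integrable (integrableD measurableT i1 j2).
by move=> x _; exact (log_mgf_subgradient Q rho0 mrho x l0 (ltW m0)).
Qed.

Lemma Lambda_le0 l : l < 0 -> Lambda l <= 0.
Proof.
move=> l0; rewrite -oppr_ge0 -[X in 0 <= X]mulN1r.
rewrite /Lambda -(RintegralZl (-1) measurableT (integrable_log_mgf l0)).
apply: Rintegral_ge0 => x _; rewrite mulN1r oppr_ge0.
exact (log_mgf_le0 Q rho0 mrho x (ltW l0)).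
Qed.

Lemma Lambda1_continuous l : l < 0 -> {for l, continuous Lambda1}.
Proof.
move=> l0; have l20 : l / 2 < 0 by lra.
have := @continuity_under_integral R _ _ P tilted_mean setT measurableT
  (l - 1) (l / 2).
move=> /(_ _ _ (tilted_mean (l / 2))) h; apply: h.
- move=> k; rewrite /= in_itv/= => /andP[_ kl].
  by apply: integrable_tilted_mean; exact: lt_trans kl _.
- apply: aeW => x _ k; rewrite inE/= in_itv/= => /andP[_ kl].
  by apply: continuous_tilted_mean => //; exact: lt_trans kl _.
- exact: integrable_tilted_mean.
- move=> k; rewrite /= in_itv/= => /andP[_ kl]; apply: aeW => x _.
  rewrite ger0_norm; first by apply: tilted_mean_nondecreasing => //; exact: ltW.
  by apply: tilted_mean_ge0 => //; apply/ltW/(lt_trans kl).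
- by rewrite inE/= in_itv/=; apply/andP; split; lra.
Qed.

(** [tilted_mean l] is at most [log_mgf l / l], which decreases to the
    essential infimum as [l] tends to [-oo]. *)
Lemma Lambda1_low D : (D_min P Q rho < D%:E)%E -> exists2 l, l < 0 & Lambda1 l < D.
Proof.
rewrite /D_min; under eq_integral do rewrite -min_distortionE//.
move=> hD.
pose f (k : nat) x := log_mgf (- k.+1%:R) x / - k.+1%:R.
have lk (k : nat) : - k.+1%:R < 0 :> R by rewrite oppr_lt0.
have intf k : P.-integrable setT (fun x => (f k x)%:E).
  apply: eq_integrable (integrableZl measurableT (- k.+1%:R)^-1
    (integrable_log_mgf (lk k))) => //.
  by move=> x _; rewrite /f mulrC EFinM.
have [] := @dominated_convergence _ _ _ P setT measurableT (fun k x => (f k x)%:E)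
  (fun x => (min_distortion Q rho x)%:E) (fun x => (- log_mgf (-1) x)%:E).
- by move=> k; exact: measurable_int (intf k).
- by apply/measurable_EFinP; exact: measurable_min_distortion.
- apply: aeW => x _; apply: cvg_EFin; first exact: nearW.
  exact: cvg_min_distortion.
- by apply: eq_integrable (integrableN fin).
- apply: aeW => x k _; rewrite abse_EFin lee_fin /f ger0_norm; last first.
    by rewrite mulr_le0 ?invr_le0 ?(ltW (lk k))// log_mgf_le0// (ltW (lk k)).
  rewrite ler_ndivrMr//.
  have := @log_mgf_scale _ _ _ _ _ Q rho rho0 mrho (-1) (- k.+1%:R) x.
  rewrite (_ : - k.+1%:R / -1 = k.+1%:R); last by rewrite invrN invr1 mulrN1 opprK.
  move=> h.
  have -> : - log_mgf (-1) x * - k.+1%:R = k.+1%:R * log_mgf (-1) x by ring.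
  by apply: h; rewrite ?oppr_lt0// lerN2 ler1n.
move=> _ _ hlim.
apply: contrapT => nex.
have : (D%:E <= \int[P]_x (min_distortion Q rho x)%:E)%E.
  apply: (cvge_to_ge hlim); apply: nearW => k.
  apply: (@le_trans _ _ (Lambda1 (- k.+1%:R))%:E).
    by rewrite lee_fin leNgt; apply/negP => h; apply: nex; exists (- k.+1%:R).
  rewrite /Lambda1 /Rintegral fineK; last first.
    by apply: integrable_fin_num => //; exact: integrable_tilted_mean.
  apply: le_integral => //; first exact: integrable_tilted_mean.
  by move=> x _; rewrite lee_fin; exact: tilted_mean_le.
by rewrite leNgt hD.
Qed.

(** [tilted_mean l] is at least [mgf1 l], since [mgf l <= 1], and [mgf1 l]
    increases to the mean of [rho] as [l] tends to 0. *)
Lemma Lambda1_high D : (D%:E < D_av P Q rho)%E -> exists2 l, l < 0 & D < Lambda1 l.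
Proof.
rewrite /D_av => hD.
pose g (k : nat) (z : A * Ahat) : R := rho z.1 z.2 * expR (- k.+1%:R^-1 * rho z.1 z.2).
have lk (k : nat) : - k.+1%:R^-1 < 0 :> R by rewrite oppr_lt0 invr_gt0.
have mg k : measurable_fun setT (fun z => (g k z)%:E).
  apply/measurable_EFinP; apply: measurable_funM => //.
  apply: measurableT_comp; first exact: measurable_expR.
  by apply: measurable_funM => //; exact: measurable_cst.
have g0 k z : (0 <= (g k z)%:E)%E by rewrite lee_fin mulr_ge0 ?expR_ge0.
have glim z : (g k z)%:E @[k --> \oo] --> (rho z.1 z.2)%:E.
  apply: cvg_EFin; first exact: nearW.
  rewrite -[X in _ --> X]mulr1; apply: cvgM; first exact: cvg_cst.
  rewrite -[X in _ --> X]expR0; apply: continuous_cvg; first exact: continuous_expR.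
  rewrite -[X in _ --> X](mul0r (rho z.1 z.2)); apply: cvgM; last exact: cvg_cst.
  apply/cvgrPdist_le => e e0.
  apply: filterS (near_infty_natSinv_lt (PosNum e0)) => k /= hk.
  by rewrite sub0r opprK ger0_norm ?invr_ge0//; exact: ltW.
have hlim : (\int[P \x Q]_z (g k z)%:E @[k --> \oo] -->
    \int[P \x Q]_z (rho z.1 z.2)%:E)%E.
  have -> : (\int[P \x Q]_z (rho z.1 z.2)%:E =
      \int[P \x Q]_z (limn (fun k => (g k z)%:E)))%E.
    by apply: eq_integral => z _; apply/esym/cvg_lim => //; exact: glim.
  apply: (@cvg_monotone_convergence _ _ _ (P \x Q)%E _ measurableT
    (fun k z => (g k z)%:E)) => //.
  move=> z _ k m km; rewrite lee_fin ler_wpM2l// ler_expR ler_wpM2r//.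
  by rewrite lerN2 lef_pV2 ?posrE// ler_nat.
apply: contrapT => nex.
have : (\int[P \x Q]_z (rho z.1 z.2)%:E <= D%:E)%E.
  apply: (cvge_to_le hlim); apply: nearW => k.
  apply: (@le_trans _ _ (Lambda1 (- k.+1%:R^-1))%:E); last first.
    by rewrite lee_fin leNgt; apply/negP => h; apply: nex; exists (- k.+1%:R^-1).
  rewrite fubini_tonelli1// /Lambda1 /Rintegral fineK; last first.
    by apply: integrable_fin_num => //; exact: integrable_tilted_mean.
  rewrite /fubini_F; apply: ge0_le_integral => //.
  - by move=> x _; apply: integral_ge0.
  - exact: (@measurable_fun_fubini_tonelli_F _ _ _ _ _ Q (fun z => (g k z)%:E)).
  - by apply/measurable_EFinP; exact: measurable_tilted_mean.
  move=> x _.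
  have -> : (\int[Q]_y (g k (x, y))%:E = (mgf1 Q rho (- k.+1%:R^-1) x)%:E)%E.
    rewrite /mgf1 /Rintegral fineK//; apply: integrable_fin_num => //.
    exact: integrable_rho_expR.
  have M0 := mgf_gt0 Q rho0 mrho x (ltW (lk k)).
  have M1 := mgf_le1 Q rho0 mrho x (ltW (lk k)).
  rewrite lee_fin /tilted_mean ler_pdivlMr// ler_piMr//.
  by apply: Rintegral_ge0 => y _; rewrite mulr_ge0 ?expR_ge0.
by rewrite leNgt hD.
Qed.

Lemma Lambda1_onto D : (D_min P Q rho < D%:E)%E -> (D%:E < D_av P Q rho)%E ->
  exists2 l, l < 0 & Lambda1 l = D.
Proof.
move=> /Lambda1_low low /Lambda1_high high.
exact (subgradient_onto Lambda_subgradient Lambda1_continuous low high).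
Qed.

End mean_log_mgf.

(** * Relative entropy and the dual form of [R_1] *)

Section relative_entropy.
Context (R : realType) d (T : measurableType d).
Local Open Scope ereal_scope.

(** Integrability of [g] cannot be required in [gibbs], where [g] is a
    log-density that may have mean [+oo]. *)
Lemma le_integral_one_sided (mu : {measure set T -> \bar R})
    (f g : T -> \bar R) :
  mu.-integrable setT f -> measurable_fun setT g ->
  {ae mu, forall x, f x <= g x} -> \int[mu]_x f x <= \int[mu]_x g x.
Proof.
move=> intf mg fg; have mf := measurable_int _ intf.
rewrite integralE [leRHS]integralE leeB//.
- apply: ae_ge0_le_integral => //.
  + exact: measurable_funepos.
  + exact: measurable_funepos.
  + by apply: filterS fg => x fg _; rewrite !funeposE ge_max !le_max fg lexx/= orbT.
- apply: ae_ge0_le_integral => //.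
  + exact: measurable_funeneg.
  + exact: measurable_funeneg.
  + by apply: filterS fg => x fg _; rewrite !funenegE ge_max !le_max leeN2 fg lexx/= orbT.
Qed.

Context (W V : probability T R).
Hypothesis WV : W `<< V.
Local Notation rn := (Radon_Nikodym (charge_of_finite_measure W) V).
Local Notation rn' := (Radon_Nikodym_SigmaFinite.f W V).

Let WVc : charge_of_finite_measure W `<< V. Proof. exact: WV. Qed.

Lemma dominated_ae (p : T -> Prop) :
  {ae V, forall x, p x} -> {ae W, forall x, p x}.
Proof.
move/null_content_dominatesP : WV => WV' [N [mN N0 hN]].
by exists N; split => //; exact: WV'.
Qed.

Lemma measurable_rn : measurable_fun setT rn.
Proof. by apply: measurable_int; exact: Radon_Nikodym_integrable. Qed.

Lemma measurable_lne_rn : measurable_fun setT (fun z => lne (rn z)).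
Proof.
pose p z := fine (rn z).
have mp : measurable_fun setT p.
  by apply: measurableT_comp measurable_rn; exact: fine_measurable.
apply: (eq_measurable_fun (fun z => if (p z <= 0)%R then -oo else (ln (p z))%:E)).
  by move=> z _; rewrite -(fineK (Radon_Nikodym_fin_num z WVc)).
apply: measurable_fun_ifT => //.
- by apply: measurable_fun_ler => //; exact: measurable_cst.
- by apply/measurable_EFinP; apply: measurableT_comp mp; exact: measurable_ln.
Qed.

Lemma rn_gt0 : {ae W, forall z, 0 < rn z}.
Proof.
exists [set z | rn z <= 0]; split.
- rewrite -[X in measurable X]setTI; apply: emeasurable_fun_infty_c => //.
- apply/eqP; rewrite eq_le measure_ge0 andbT.
  have mS : measurable [set z | rn z <= 0].
    rewrite -[X in measurable X]setTI; apply: emeasurable_fun_infty_c => //.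
  have := @Radon_Nikodym_integral _ _ _ (charge_of_finite_measure W) V _ WVc mS.
  move=> /= hW; rewrite [leLHS]hW -[leRHS](@integral0 _ _ _ V [set z | rn z <= 0]).
  apply: le_integral => //.
  - apply: (integrableS measurableT) => //; exact: Radon_Nikodym_integrable.
  - exact: integrable0.
  - by move=> z; rewrite inE.
- by move=> z /= /negP; rewrite -leNgt.
Qed.

(** The Gibbs (or Donsker-Varadhan) inequality: with [p] the density,
    [ln p >= g + 1 - expR g / p], and [expR g / p] has mean at most one. *)
Lemma gibbs (g : T -> R) : measurable_fun setT g ->
  W.-integrable setT (fun z => (g z)%:E) ->
  \int[V]_z (expR (g z))%:E <= 1 ->
  \int[W]_z (g z)%:E <= \int[W]_z lne (rn z).
Proof.
move=> mg intg hg.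
have rnE : {ae V, forall z, rn' z = rn z}.
  have := ae_eq_Radon_Nikodym_SigmaFinite WV measurableT.
  by apply: filterS => z; apply.
pose p z := fine (rn' z).
have p0 z : (0 <= p z)%R by exact/fine_ge0/Radon_Nikodym_SigmaFinite.f_ge0.
have pE z : (p z)%:E = rn' z.
  by rewrite fineK//; exact: Radon_Nikodym_SigmaFinite.f_fin_num.
have mp : measurable_fun setT p.
  apply: (@measurableT_comp _ _ _ _ _ _ fine _ rn'); first exact: fine_measurable.
  by apply: measurable_int; exact: Radon_Nikodym_SigmaFinite.f_integrable.
pose h z := (expR (g z - ln (p z)))%R.
have h0 z : (0 <= h z)%R by exact: expR_ge0.
have hp z : (h z * p z <= expR (g z))%R.
  have [->|pz] := eqVneq (p z) 0%R; first by rewrite mulr0 expR_ge0.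
  have pz0 : (0 < p z)%R by rewrite lt_neqAle eq_sym pz p0.
  by rewrite /h expRB lnK ?posrE// divfK.
have mh : measurable_fun setT h.
  apply: measurableT_comp; first exact: measurable_expR.
  apply: measurable_funB => //.
  by apply: measurableT_comp mp; exact: measurable_ln.
have hle : \int[W]_z (h z)%:E <= 1.
  rewrite -(@Radon_Nikodym_SigmaFinite.change_of_variables _ _ _ W V WV
    (fun z => (h z)%:E))//; last exact/measurable_EFinP.
  apply: le_trans hg; apply: ge0_le_integral => //.
  - by move=> z _; rewrite -pE -EFinM lee_fin mulr_ge0.
  - apply: emeasurable_funM; first exact/measurable_EFinP.
    by apply: measurable_int; exact: Radon_Nikodym_SigmaFinite.f_integrable.
  - by apply/measurable_EFinP; apply: measurableT_comp mg; exact: measurable_expR.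
  by move=> z _; rewrite -pE -EFinM lee_fin.
have inth : W.-integrable setT (fun z => (h z)%:E).
  apply/integrableP; split; first exact/measurable_EFinP.
  under eq_integral do rewrite gee0_abs ?lee_fin//.
  exact: le_lt_trans hle (ltry 1).
have i1 : W.-integrable setT (cst 1%:E) by exact: finite_measure_integrable_cst.
have ig1 := integrableD measurableT intg i1.
apply: (@le_trans _ _ (\int[W]_z ((g z)%:E + 1 - (h z)%:E))).
  rewrite (integralB measurableT ig1 inth) integralD//.
  rewrite integral_cst// [X in 1 * X]probability_setT mule1.
  have hfin : \int[W]_z (h z)%:E \is a fin_num by exact: integrable_fin_num.
  have gfin : \int[W]_z (g z)%:E \is a fin_num by exact: integrable_fin_num.
  rewrite -(fineK gfin) -(fineK hfin) -!EFinD lee_fin.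
  by move: hle; rewrite -(fineK hfin) lee_fin; lra.
apply: le_integral_one_sided.
- exact: integrableB.
- exact: measurable_lne_rn.
move: rn_gt0 (dominated_ae rnE); apply: filterS2 => z.
move=> + rnz; rewrite -rnz -pE lte_fin => pz.
rewrite lne_EFin// -EFinD lee_fin.
have := expR_ge1Dx (g z - ln (p z)); rewrite -/(h z).
move: (ln (p z)) (g z) (h z) => a b c; lra.
Qed.

End relative_entropy.

Section density.
Context (R : realType) d (T : measurableType d).
Context (V : {sigma_finite_measure set T -> \bar R}).
Local Open Scope ereal_scope.

(** The measurability and sign proofs are arguments so that the measure
    structure can be inferred from the function alone. *)
Definition density (w : T -> R) (mw : measurable_fun setT w)
    (w0 : forall z, (0 <= w z)%R) : set T -> \bar R :=
  fun E => \int[V]_(z in E) (w z)%:E.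

Section density_measure.
Variables (w : T -> R) (mw : measurable_fun setT w)
  (w0 : forall z, (0 <= w z)%R).

Let density0 : density mw w0 set0 = 0.
Proof. exact: integral_set0. Qed.

Let density_ge0 E : 0 <= density mw w0 E.
Proof. by apply: integral_ge0 => z _; rewrite lee_fin. Qed.

Let density_semi_sigma_additive : semi_sigma_additive (density mw w0).
Proof.
move=> F mF tF mUF; rewrite /density ge0_integral_bigcup//.
  by apply: is_cvg_ereal_nneg_natsum_cond => n _ _; exact: density_ge0.
- by apply: measurable_funTS; exact/measurable_EFinP.
- by move=> z _; rewrite lee_fin.
Qed.

HB.instance Definition _ := isMeasure.Build _ _ _ (density mw w0)
  density0 density_ge0 density_semi_sigma_additive.

End density_measure.

Context (W : probability T R) (w : T -> R).
Hypothesis mw : measurable_fun setT w.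
Hypothesis w0 : forall z, (0 <= w z)%R.
Hypothesis WE : forall E, measurable E -> W E = \int[V]_(z in E) (w z)%:E.

Let mwE : measurable_fun setT (fun z => (w z)%:E).
Proof. exact/measurable_EFinP. Qed.

Lemma density_dominated : W `<< V.
Proof.
apply/null_content_dominatesP => E mE E0; rewrite WE//.
by apply: null_set_integral => //; exact: measurable_funTS.
Qed.

Lemma ge0_integral_density (h : T -> \bar R) : measurable_fun setT h ->
  (forall z, 0 <= h z) -> \int[W]_z h z = \int[V]_z (h z * (w z)%:E).
Proof.
move=> mh h0.
rewrite -(@Radon_Nikodym_SigmaFinite.change_of_variables _ _ _ W V
  density_dominated h)//.
have mrn : measurable_fun setT (Radon_Nikodym_SigmaFinite.f W V).
  apply: measurable_int; apply: Radon_Nikodym_SigmaFinite.f_integrable.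
  exact: density_dominated.
apply: ge0_ae_eq_integral => //.
- exact: emeasurable_funM.
- exact: emeasurable_funM.
- move=> z _; rewrite mule_ge0//.
  exact: (Radon_Nikodym_SigmaFinite.f_ge0 density_dominated).
- by move=> z _; rewrite mule_ge0// lee_fin.
apply: ae_eqe_mul2l; apply: integral_ae_eq => //.
- apply: Radon_Nikodym_SigmaFinite.f_integrable; exact: density_dominated.
- move=> E _ mE; rewrite -WE//.
  exact/esym/(Radon_Nikodym_SigmaFinite.f_integral density_dominated).
Qed.

End density.

Lemma density_probability (R : realType) d (T : measurableType d)
    (V : probability T R) (w : T -> R) : measurable_fun setT w ->
  (forall z, 0 <= w z) -> (\int[V]_z (w z)%:E = 1)%E ->
  exists W : probability T R,
    forall E, measurable E -> W E = (\int[V]_(z in E) (w z)%:E)%E.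
Proof.
move=> mw w0 w1.
pose W : probability T R :=
  HB.pack (density V mw w0) (Measure_isProbability.Build _ _ _ (density V mw w0) w1).
by exists W.
Qed.

Lemma rel_entropy_density (R : realType) d (T : measurableType d)
    (W V : probability T R) (g : T -> R) : measurable_fun setT g ->
  (forall E, measurable E -> W E = (\int[V]_(z in E) (expR (g z))%:E)%E) ->
  rel_entropy W V = (\int[W]_z (g z)%:E)%E.
Proof.
move=> mg WE.
have mw : measurable_fun setT (fun z => expR (g z)).
  by apply: measurableT_comp mg; exact: measurable_expR.
have WV : W `<< V by exact: density_dominated mw WE.
have WVc : charge_of_finite_measure W `<< V by exact: WV.
rewrite /rel_entropy; case: pselect => [WV'|nWV]; last by case: nWV.
apply: ae_eq_integral => //.
- exact: measurable_lne_rn.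
- exact/measurable_EFinP.
have : ae_eq V setT (Radon_Nikodym (charge_of_finite_measure W) V)
    (fun z => (expR (g z))%:E).
  apply: integral_ae_eq => //.
  - exact: Radon_Nikodym_integrable.
  - exact/measurable_EFinP.
  - by move=> E _ mE; rewrite -WE// -(Radon_Nikodym_integral WVc mE).
move=> h; have {}h : {ae V, forall z,
    Radon_Nikodym (charge_of_finite_measure W) V z = (expR (g z))%:E}.
  by apply: filterS h => z; apply.
apply: filterS (dominated_ae WV h) => z /= -> _.
by rewrite lne_EFin ?expR_gt0// expRK.
Qed.

Section rate_distortion.
Context (R : realType) d (A : measurableType d) d' (Ahat : measurableType d').
Context (P : probability A R) (Q : probability Ahat R) (rho : A -> Ahat -> R).
Context (D : R).
Hypothesis rho0 : forall x y, 0 <= rho x y.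
Hypothesis mrho : measurable_fun setT (fun z : A * Ahat => rho z.1 z.2).
Local Notation log_mgf := (log_mgf Q rho).

Lemma integral_marginal (W : probability (A * Ahat)%type R) (h : A -> \bar R) :
  (forall B, measurable B -> W (B `*` setT) = P B) ->
  measurable_fun setT h -> (forall x, (0 <= h x)%E) ->
  (\int[W]_z h z.1 = \int[P]_x h x)%E.
Proof.
move=> WP mh h0.
rewrite -[LHS](@ge0_integral_pushforward _ _ _ _ _ _ measurable_fst W setT h)//.
apply: eq_measure_integral => B mB _.
transitivity (W (B `*` setT)); last exact: WP.
by congr (W _); apply/seteqP; split => -[x y] //= [].
Qed.

Let mlog l : l <= 0 ->
  measurable_fun setT (fun z : A * Ahat => log_mgf l z.1).
Proof.
by move=> l0; exact: measurableT_comp (measurable_log_mgf Q rho0 mrho l0) measurable_fst.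
Qed.

Lemma integral_tilted l x : l <= 0 ->
  (\int[Q]_y (expR (l * rho x y - log_mgf l x))%:E = 1)%E.
Proof.
move=> l0; under eq_integral do rewrite expRD EFinM.
rewrite ge0_integralZr ?lee_fin ?expR_ge0//; last first.
  by apply/measurable_EFinP; exact: measurable_expR_rho.
by rewrite -mgfE// -(expR_log_mgf Q rho0 mrho x l0) -EFinM -expRD subrr expR0.
Qed.

Lemma integral_tilted_joint l : l <= 0 ->
  (\int[P \x Q]_z (expR (l * rho z.1 z.2 - log_mgf l z.1))%:E = 1)%E.
Proof.
move=> l0.
pose f (z : A * Ahat) := (expR (l * rho z.1 z.2 - log_mgf l z.1))%:E.
have mf : measurable_fun setT f.
  apply/measurable_EFinP; apply: measurableT_comp; first exact: measurable_expR.
  apply: measurable_funB; last exact: mlog.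
  by apply: measurable_funM => //; exact: measurable_cst.
have f0 z : (0 <= f z)%E by rewrite lee_fin expR_ge0.
rewrite (fubini_tonelli1 f mf f0).
rewrite /fubini_F/=; under eq_integral do rewrite integral_tilted//.
by rewrite integral_cst// mul1e; exact: (@probability_setT _ _ _ P).
Qed.

(** The dual bound tests a joint law [W] against the exponent of the tilted
    density; truncating [- log_mgf] keeps the exponent integrable when the mean
    of [log_mgf] is infinite. *)
Lemma R_1_ge_truncated l (k : nat) : l < 0 ->
  ((l * D)%:E + \int[P]_x (Num.min (- log_mgf l x) k%:R)%:E <=
    R_1 rho P Q D)%E.
Proof.
move=> l0; have l0' := ltW l0.
apply/ereal_infP => _ [W [WP WD] <-].
rewrite /rel_entropy; case: pselect => [WV|nWV]; last exact: leey.
pose tr x := Num.min (- log_mgf l x) k%:R.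
have tr0 x : 0 <= tr x by rewrite le_min ler0n oppr_ge0 log_mgf_le0.
have mtr : measurable_fun setT tr.
  apply: measurable_minr; last exact: measurable_cst.
  by apply: measurableT_comp => //; exact: measurable_log_mgf.
have mtr1 : measurable_fun setT (fun z : A * Ahat => tr z.1).
  exact: measurableT_comp mtr measurable_fst.
have irho : W.-integrable setT (fun z => (rho z.1 z.2)%:E).
  apply/integrableP; split; first exact/measurable_EFinP.
  under eq_integral do rewrite gee0_abs ?lee_fin//.
  exact: le_lt_trans WD (ltry D).
have itr : W.-integrable setT (fun z => (tr z.1)%:E).
  apply: (@le_integrable _ _ _ W _ measurableT _ (fun=> k%:R%:E)).
  - exact/measurable_EFinP.
  - move=> z _ /=; rewrite lee_fin !ger0_norm//.
    by rewrite ge_min lexx orbT.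
  - exact: finite_measure_integrable_cst.
have ilrho := integrableZl measurableT l irho.
have rhofin := integrable_fin_num measurableT irho.
pose g z := l * rho z.1 z.2 + tr z.1.
have mg : measurable_fun setT g.
  by apply: measurable_funD => //; apply: measurable_funM => //; exact: measurable_cst.
have ig : W.-integrable setT (fun z => (g z)%:E).
  by apply: eq_integrable (integrableD measurableT ilrho itr).
apply: (@le_trans _ _ (\int[W]_z (g z)%:E)%E).
  have -> : (\int[W]_z (g z)%:E =
      l%:E * \int[W]_z (rho z.1 z.2)%:E + \int[W]_z (tr z.1)%:E)%E.
    by rewrite -integralZl// -integralD//; apply: eq_integral => z _; rewrite EFinD.
  rewrite (@integral_marginal W (fun x => (tr x)%:E))//; last exact/measurable_EFinP.
  apply: leeD => //; rewrite -(fineK rhofin) -EFinM lee_fin ler_wnM2l//.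
  by rewrite -lee_fin fineK.
apply: gibbs => //.
rewrite -(integral_tilted_joint l0'); apply: ge0_le_integral => //.
- by apply/measurable_EFinP; apply: measurableT_comp mg; exact: measurable_expR.
- apply/measurable_EFinP; apply: measurableT_comp; first exact: measurable_expR.
  apply: measurable_funB; last exact: mlog.
  by apply: measurable_funM => //; exact: measurable_cst.
- move=> z _; rewrite lee_fin ler_expR lerD2l.
  by rewrite ge_min lexx.
Qed.

(** Monotone convergence removes the truncation. *)
Lemma R_1_ge l : l < 0 ->
  ((l * D)%:E + \int[P]_x (- log_mgf l x)%:E <= R_1 rho P Q D)%E.
Proof.
move=> l0; have l0' := ltW l0.
have tr0 (k : nat) x : 0 <= Num.min (- log_mgf l x) k%:R.
  by rewrite le_min ler0n oppr_ge0 log_mgf_le0.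
have mlog1 : measurable_fun setT (fun x => - log_mgf l x).
  by apply: measurableT_comp => //; exact: measurable_log_mgf.
have hlim : (\int[P]_x (Num.min (- log_mgf l x) k%:R)%:E @[k --> \oo] -->
    \int[P]_x (- log_mgf l x)%:E)%E.
  have -> : (\int[P]_x (- log_mgf l x)%:E =
      \int[P]_x (limn (fun k : nat => (Num.min (- log_mgf l x) k%:R)%:E)))%E.
    apply: eq_integral => x _; apply/esym/cvg_lim => //.
    apply: cvg_near_cst; near=> k; congr EFin; apply/min_idPl.
    by near: k; exact: nbhs_infty_ger.
  apply: (@cvg_monotone_convergence _ _ _ P _ measurableT
    (fun k x => (Num.min (- log_mgf l x) k%:R)%:E)) => //.
  - move=> k; apply/measurable_EFinP; apply: measurable_minr; first exact: mlog1.
    exact: measurable_cst.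
  - by move=> k x _; rewrite lee_fin.
  - move=> x _ m n mn; rewrite lee_fin le_min ge_min lexx/= ge_min.
    by rewrite ler_nat mn orbT.
rewrite -leeBrDl//; apply: (cvge_to_le hlim); apply: nearW => k.
by rewrite leeBrDl//; exact: R_1_ge_truncated.
Unshelve. all: by end_near. Qed.

(** The tilted joint law attains the dual bound: its first marginal is [P], its
    mean distortion is [Lambda1 l = D], and its log-density is the exponent
    tested in the dual bound. *)
Lemma R_1_le l : P.-integrable setT (fun x => (log_mgf (-1) x)%:E) ->
  l < 0 -> Lambda1 P Q rho l = D ->
  (R_1 rho P Q D <= (l * D - Lambda P Q rho l)%:E)%E.
Proof.
move=> fin l0 lD; have l0' := ltW l0.
pose g (z : A * Ahat) := l * rho z.1 z.2 - log_mgf l z.1.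
have mg : measurable_fun setT g.
  apply: measurable_funB; last exact: mlog.
  by apply: measurable_funM => //; exact: measurable_cst.
pose w z := expR (g z).
have mw : measurable_fun setT w.
  by apply: measurableT_comp mg; exact: measurable_expR.
have w0 z : 0 <= w z by exact: expR_ge0.
have [W WE] := density_probability (V := (P \x Q)%E) mw w0 (integral_tilted_joint l0').
have mwE : measurable_fun setT (fun z => (w z)%:E) by exact/measurable_EFinP.
have Wint := ge0_integral_density mw w0 WE.
have WP (B : set A) : measurable B -> W (B `*` setT) = P B.
  move=> mB; have mBT : measurable (B `*` [set: Ahat]) by exact: measurableX.
  rewrite -[X in W X]setIT -integral_indic// Wint//; last first.
    by apply/measurable_EFinP; exact: measurable_indic.
  pose f (z : A * Ahat) := ((\1_(B `*` setT) z : R)%:E * (w z)%:E)%E.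
  have mf : measurable_fun setT f.
    by apply: emeasurable_funM => //; apply/measurable_EFinP; exact: measurable_indic.
  have f0 z : (0 <= f z)%E by rewrite mule_ge0 ?lee_fin.
  rewrite (fubini_tonelli1 f mf f0).
  rewrite -[X in P X]setIT -integral_indic//; apply: eq_integral => x _.
  rewrite /fubini_F/=.
  rewrite (eq_integral (fun y => (\1_B x)%:E * (w (x, y))%:E)%E); last first.
    move=> y _; congr (_%:E * _)%E; rewrite !indicE; congr (_%:R); congr nat_of_bool.
    by apply/idP/idP; rewrite !inE/=; [case|].
  have mwx : measurable_fun setT (fun y => (w (x, y))%:E).
    exact: (measurableT_comp mwE (measurable_pair1 x)).
  rewrite (ge0_integralZl _ measurableT mwx) ?lee_fin//; last first.
    by move=> y _; rewrite lee_fin.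
  by rewrite integral_tilted// mule1.
have Wrho : (\int[W]_z (rho z.1 z.2)%:E = D%:E)%E.
  rewrite Wint//; [|exact/measurable_EFinP|by move=> z; rewrite lee_fin].
  pose f (z : A * Ahat) := ((rho z.1 z.2)%:E * (w z)%:E)%E.
  have mf : measurable_fun setT f.
    by apply: emeasurable_funM => //; exact/measurable_EFinP.
  have f0 z : (0 <= f z)%E by rewrite mule_ge0 ?lee_fin.
  rewrite (fubini_tonelli1 f mf f0).
  rewrite -lD /Lambda1 /Rintegral fineK; last first.
    by apply: integrable_fin_num => //; exact: integrable_tilted_mean.
  apply: eq_integral => x _; rewrite /fubini_F/=.
  have i1 := integrable_rho_expR Q rho0 mrho x l0.
  have m1fin := integrable_fin_num measurableT i1.
  transitivity (\int[Q]_y ((rho x y * expR (l * rho x y))%:E *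
      (expR (- log_mgf l x))%:E))%E.
    by apply: eq_integral => y _; rewrite /f -!EFinM /w /g/= expRD mulrA.
  rewrite ge0_integralZr ?lee_fin ?expR_ge0//; last 2 first.
  - by apply/measurable_EFinP; exact: measurable_rho_expR.
  - by move=> y _; rewrite lee_fin mulr_ge0 ?expR_ge0.
  rewrite -(fineK m1fin) -EFinM /tilted_mean expRN expR_log_mgf//.
apply: ge_ereal_inf; exists (rel_entropy W (P \x Q)%E).
  by exists W => //; split => //; rewrite Wrho.
rewrite (rel_entropy_density mg WE)//.
have irho : W.-integrable setT (fun z => (rho z.1 z.2)%:E).
  apply/integrableP; split; first exact/measurable_EFinP.
  under eq_integral do rewrite gee0_abs ?lee_fin//.
  by rewrite Wrho ltry.
have nlog0 x : 0 <= - log_mgf l x by rewrite oppr_ge0 log_mgf_le0.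
have mnlog : measurable_fun setT (fun x => - log_mgf l x).
  by apply: measurableT_comp => //; exact: measurable_log_mgf.
have intnlog : (\int[W]_z (- log_mgf l z.1)%:E = (- Lambda P Q rho l)%:E)%E.
  rewrite (@integral_marginal W (fun x => (- log_mgf l x)%:E))//; last exact/measurable_EFinP.
  have ilog := integrable_log_mgf rho0 mrho fin l0.
  have logfin := integrable_fin_num measurableT ilog.
  rewrite EFinN /Lambda /Rintegral fineK// -integralN//.
  by rewrite integrable_add_def.
have inlog : W.-integrable setT (fun z => (- log_mgf l z.1)%:E).
  apply/integrableP; split.
    by apply/measurable_EFinP; exact: measurableT_comp mnlog measurable_fst.
  under eq_integral do rewrite gee0_abs ?lee_fin//.
  by rewrite intnlog ltry.
have -> : (\int[W]_z (g z)%:E =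
    l%:E * \int[W]_z (rho z.1 z.2)%:E + \int[W]_z (- log_mgf l z.1)%:E)%E.
  have il := integrableZl measurableT l irho.
  rewrite -(integralZl measurableT irho) -(integralD measurableT il inlog).
  by apply: eq_integral => z _; rewrite EFinD.
by rewrite Wrho intnlog.
Qed.

Lemma R_1E l : P.-integrable setT (fun x => (log_mgf (-1) x)%:E) ->
  l < 0 -> Lambda1 P Q rho l = D ->
  R_1 rho P Q D = (l * D - Lambda P Q rho l)%:E.
Proof.
move=> fin l0 lD; apply/eqP; rewrite eq_le R_1_le//=.
apply: le_trans (R_1_ge l0).
have ilog := integrable_log_mgf rho0 mrho fin l0.
have logfin := integrable_fin_num measurableT ilog.
rewrite EFinB /Lambda /Rintegral fineK// leeD2l//.
rewrite -integralN//; last by rewrite integrable_add_def.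
Qed.

End rate_distortion.

(** * Codelengths of a stationary ergodic source *)

Section positive_matching_probability.
Context (R : realType) d (A : measurableType d) d' (Ahat : measurableType d').
Context (Q : probability Ahat R) (rho : A -> Ahat -> R).
Hypothesis rho0 : forall x y, 0 <= rho x y.
Hypothesis mrho : measurable_fun setT (fun z : A * Ahat => rho z.1 z.2).

(** The room left by the minimal distortions below [n D] is shared equally
    among the coordinates; the resulting rectangle is contained in the ball,
    and each of its sides has positive probability. *)
Lemma ball_gt0 n (mu : probability (n.-tuple Ahat) R) (x : n.-tuple A) (D : R) :
  iid_law Q mu -> (0 < n)%N ->
  \sum_(k < n) min_distortion Q rho (tnth x k) < n%:R * D ->
  (0 < mu [set y | (distortion rho x y <= D)%R])%E.
Proof.
move=> lmu n0; set s := \sum_(k < n) _ => sD.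
have nR0 : (0 : R) < n%:R by rewrite ltr0n.
pose delta := D - n%:R^-1 * s.
have delta0 : 0 < delta by rewrite subr_gt0 ltr_pdivrMl.
pose B (k : 'I_n) := [set y | rho (tnth x k) y <=
  min_distortion Q rho (tnth x k) + delta].
have mB k : measurable (B k) by exact: measurable_sublevel.
have B0 k : (0 < Q (B k))%E by apply: sublevel_gt0 => //; rewrite ltrDl.
apply: (@lt_le_trans _ _ (mu (rectangle B))).
  rewrite lmu//; apply: (big_ind (fun u : \bar R => 0 < u)%E) => //.
  by move=> u v u0 v0; rewrite mule_gt0.
apply: le_measure; rewrite ?inE.
- exact: measurable_rectangle.
- exact: measurable_ball.
move=> y /= hy; rewrite /distortion ler_pdivrMl//.
have -> : n%:R * D = \sum_(k < n) (min_distortion Q rho (tnth x k) + delta).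
  rewrite big_split/= sumr_const card_ord -[delta *+ n]mulr_natl -/s /delta.
  by field; rewrite gt_eqF.
by apply: ler_sum => k _; exact: hy.
Qed.

End positive_matching_probability.

Section stationary_source.
Context (R : realType) d0 (Omega : measurableType d0) (Pr : probability Omega R).
Context d (A : measurableType d) d' (Ahat : measurableType d').
Context (X : nat -> {mfun Omega >-> A}).
Context (P : probability A R) (Q : probability Ahat R).
Context (Y : forall n : nat, nat -> {mfun Omega >-> n.-tuple Ahat}).
Context (rho : A -> Ahat -> R) (D : R).
Hypothesis rho0 : forall x y, 0 <= rho x y.
Hypothesis mrho : measurable_fun setT (fun z : A * Ahat => rho z.1 z.2).
Hypothesis stX : stationary Pr X.
Hypothesis ergX : ergodic Pr X.
Hypothesis XP : forall B : set A, measurable B -> distribution Pr (X 0%N) B = P B.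
Hypothesis cb : shannon_codebooks Pr X Q Y.
Local Notation q := (match_prob Pr Y rho D).
Local Notation log_mgf := (log_mgf Q rho).

Lemma birkhoff_marginal (f : A -> R) :
  measurable_fun setT f -> (forall x, 0 <= f x) ->
  {ae Pr, forall w, (fun n => (mean_upto (fun i => f (X i w)) n)%:E) @ \oo -->
    (\int[P]_x (f x)%:E)%E}.
Proof.
move=> mf f0; have := birkhoff_ge0 stX ergX mf f0.
have -> : (\int[Pr]_w (f (X 0%N w))%:E = \int[P]_x (f x)%:E)%E.
  transitivity (\int[distribution Pr (X 0%N)]_x (f x)%:E)%E.
    have mfE : measurable_fun setT (fun x => (f x)%:E) by exact/measurable_EFinP.
    by apply/esym/ge0_integral_distribution => // x; rewrite lee_fin.
  by apply: eq_measure_integral => B mB _; exact: XP.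
by [].
Qed.

Lemma mean_uptoN (u : nat -> R) n :
  mean_upto (fun i => - u i) n = - mean_upto u n.
Proof. by rewrite /mean_upto sumrN mulrN. Qed.

Lemma birkhoff_log_mgf l : l < 0 ->
  {ae Pr, forall w, (fun n => (- mean_upto (fun i => log_mgf l (X i w)) n)%:E)
    @ \oo --> (\int[P]_x (- log_mgf l x)%:E)%E}.
Proof.
move=> l0.
have mf : measurable_fun setT (fun x => - log_mgf l x).
  by apply: measurableT_comp => //; apply: measurable_log_mgf => //; exact: ltW.
have f0 x : 0 <= - log_mgf l x by rewrite oppr_ge0 log_mgf_le0// ltW.
apply: filterS (birkhoff_marginal mf f0) => w.
by under eq_fun do rewrite mean_uptoN.
Qed.

Lemma near_match_prob_gt0 : (D_min P Q rho < D%:E)%E ->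
  {ae Pr, forall w, \forall n \near \oo, (0 < q (block X n w))%E}.
Proof.
rewrite /D_min; under eq_integral do rewrite -min_distortionE//.
set I := (\int[P]_x _)%E => ID.
have mm := measurable_min_distortion Q rho0 mrho.
have m0 := min_distortion_ge0 Q rho0.
have Ifin : I \is a fin_num.
  by rewrite ge0_fin_numE ?(lt_trans ID) ?ltry// integral_ge0// => x _; rewrite lee_fin.
apply: filterS (birkhoff_marginal mm m0) => w; rewrite -/I -(fineK Ifin) => /fine_cvg.
rewrite /comp/= => cw.
have g0 : fine I < D by rewrite -lte_fin fineK.
have hw := cvgr_lt _ cw _ g0; near=> n.
have n0 : (0 < n)%N by near: n; exists 1%N.
apply: (ball_gt0 rho0 mrho (@codeword_iid _ _ _ Pr _ _ _ _ X Q Y cb n 0%N) n0).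
under eq_bigr do rewrite tnth_mktuple.
by rewrite -ltr_pdivrMl ?ltr0n//; near: n; exact: hw.
Unshelve. all: by end_near. Qed.

(** By [log_mgf_scale] the means of [log_mgf l] over [P] are finite for all
    [l < 0] or for none, so the tilt [-1] decides between the two cases. *)
Theorem codelength_rate (dflt : nat -> Omega -> nat) :
  (D_min P Q rho < D%:E)%E -> (D%:E < D_av P Q rho)%E ->
  {ae Pr, forall w,
      (fun n : nat => ((code_length rho D X Y dflt n w)%:R / n%:R : R)%:E)
        @ \oo --> ((log2 (expR 1))%:E * R_1 rho P Q D)%E}.
Proof.
move=> hmin hav.
have N10 : (-1 : R) < 0 by rewrite oppr_lt0.
have mlog : measurable_fun setT (log_mgf (-1)).
  by apply: measurable_log_mgf => //; exact: ltW.
have log0 x : log_mgf (-1) x <= 0 by apply: log_mgf_le0 => //; exact: ltW.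
have [fin|] := ltP (\int[P]_x (- log_mgf (-1) x)%:E)%E +oo%E.
  have {}fin : P.-integrable setT (fun x => (log_mgf (-1) x)%:E).
    apply/integrableP; split; first exact/measurable_EFinP.
    by under eq_integral do rewrite abse_EFin ler0_norm//.
  have [ls ls0 lsD] := Lambda1_onto rho0 mrho fin hmin hav.
  have low := Lambda1_low rho0 mrho fin hmin.
  rewrite (R_1E rho0 mrho fin ls0 lsD).
  have := code_length_legendre rho0 mrho cb ls0 (Lambda_subgradient rho0 mrho fin)
    (Lambda1_continuous rho0 mrho fin) lsD low (Lambda_le0 rho0 mrho fin) dflt.
  move=> h; have {h} : {ae Pr, forall w,
     (fun n => (code_length rho D X Y dflt n w)%:R / n%:R : R) @ \oo -->
     log2 (expR 1) * (ls * D - Lambda P Q rho ls)}.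
    apply: h => l l0; apply: filterS (birkhoff_log_mgf l0) => w.
    have ilog := integrable_log_mgf rho0 mrho fin l0.
    have logfin := integrable_fin_num measurableT ilog.
    have -> : (\int[P]_x (- log_mgf l x)%:E = (- Lambda P Q rho l)%:E)%E.
      rewrite EFinN /Lambda /Rintegral fineK// -integralN//.
      by rewrite integrable_add_def.
    move=> /fine_cvg; rewrite /comp/= => cw.
    rewrite -[X in _ --> X]opprK.
    have -> : mean_upto (fun i => log_mgf l (X i w)) =
        (fun n => - - mean_upto (fun i => log_mgf l (X i w)) n).
      by apply/funext => n; rewrite opprK.
    exact: cvgN.
  by apply: filterS => w cw; rewrite -EFinM; apply: cvg_EFin => //; exact: nearW.
rewrite leye_eq => /eqP logoo.
have -> : R_1 rho P Q D = +oo%E.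
  apply/eqP; rewrite -leye_eq; apply: le_trans (@R_1_ge _ _ _ _ _ P Q rho D rho0 mrho _ N10).
  by rewrite logoo addey// ltNye_eq.
have log2e : 0 < log2 (expR 1 : R) by rewrite /log2 expRK divr_gt0// ln_gt0// ltr1n.
rewrite gt0_muley ?lte_fin//.
apply: (code_length_cvgy dflt mrho cb (near_match_prob_gt0 hmin)) => r.
apply: filterS (birkhoff_log_mgf N10) => w; rewrite logoo => /cvgeyPge /(_ (D + r)).
move=> hw; have {}hw : \forall n \near \oo,
    mean_upto (fun i => log_mgf (-1) (X i w)) n <= - (D + r).
  by apply: filterS hw => n; rewrite lee_fin lerNr.
have rE : -1 * D - (- (D + r)) = r by ring.
have := near_match_prob_le D rho0 mrho cb (ltW N10) hw.
by rewrite rE.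
Qed.

End stationary_source.

(** * The Gaussian codebook *)

Section gaussian_codebook.
Context (R : realType) (tau : R).
Hypothesis tau0 : 0 < tau.
Local Notation Q := (normal_prob 0 tau).
Local Notation se := (@squared_error R).
Implicit Types l x : R.

Lemma measurable_squared_error : measurable_fun setT
  (fun z : measurableTypeR R * measurableTypeR R => se z.1 z.2).
Proof.
apply: measurable_funX; apply: measurable_funB; first exact: measurable_fst.
exact: measurable_snd.
Qed.

Lemma squared_error_ge0 x y : 0 <= se x y.
Proof. exact: sqr_ge0. Qed.

(** Tilting divides the variance of the codebook law by this factor. *)
Definition tilt l : R := 1 - 2 * l * tau ^+ 2.

Let tau2 : 0 < tau ^+ 2.
Proof. exact: exprn_gt0. Qed.

Lemma tilt_gt1 l : l < 0 -> 1 < tilt l.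
Proof.
move=> l0; have : 0 < - l * tau ^+ 2 by rewrite mulr_gt0 ?oppr_gt0.
by rewrite /tilt; lra.
Qed.

(** Completing the square in [y]. *)
Lemma gaussian_tilt l x y : l < 0 ->
  expR (l * (x - y) ^+ 2) * normal_pdf 0 tau y =
  (Num.sqrt (tilt l))^-1 * expR (l * x ^+ 2 / tilt l) *
    normal_pdf (- 2 * l * x * tau ^+ 2 / tilt l) (tau / Num.sqrt (tilt l)) y.
Proof.
move=> l0; have u1 := tilt_gt1 l0; have u0 : 0 < tilt l := lt_trans ltr01 u1.
have su0 : 0 < Num.sqrt (tilt l) by rewrite sqrtr_gt0.
have s0 : 0 < tau / Num.sqrt (tilt l) by rewrite divr_gt0.
rewrite !normal_pdfE ?gt_eqF//.
have s2 : (tau / Num.sqrt (tilt l)) ^+ 2 = tau ^+ 2 / tilt l.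
  by rewrite expr_div_n sqr_sqrtr// ltW.
have peakE : normal_peak tau =
    (Num.sqrt (tilt l))^-1 * normal_peak (tau / Num.sqrt (tilt l)).
  rewrite /normal_peak s2.
  have -> : tau ^+ 2 / tilt l * pi *+ 2 = (tau ^+ 2 * pi *+ 2) / tilt l.
    by rewrite mulrAC mulrnAl.
  rewrite sqrtrM; last by apply/mulrn_wge0/mulr_ge0; [exact: sqr_ge0|exact: pi_ge0].
  rewrite sqrtrV; last exact: ltW.
  by rewrite invfM invrK mulrCA mulVf ?mulr1// gt_eqF.
rewrite peakE /normal_fun s2.
rewrite [RHS]mulrACA [LHS]mulrCA; congr (_ * _).
rewrite -!expRD; congr expR.
have tn0 : tau != 0 by rewrite gt_eqF.
have un0 : tilt l != 0 by rewrite gt_eqF.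
rewrite /tilt in un0 *; field.
by rewrite un0 tn0.
Qed.

Lemma gaussian_log_mgf l x : l < 0 ->
  log_mgf Q se l x = - 2^-1 * ln (tilt l) + l / tilt l * x ^+ 2.
Proof.
move=> l0; have u1 := tilt_gt1 l0; have u0 : 0 < tilt l := lt_trans ltr01 u1.
have su0 : 0 < Num.sqrt (tilt l) by rewrite sqrtr_gt0.
pose c := (Num.sqrt (tilt l))^-1 * expR (l * x ^+ 2 / tilt l).
have c0 : 0 < c by rewrite mulr_gt0 ?invr_gt0 ?expR_gt0.
have -> : log_mgf Q se l x = ln c.
  congr ln; rewrite /mgf.
  rewrite (ge0_integral_density (V := lebesgue_measure)
    (measurable_normal_pdf 0 tau) (normal_pdf_ge0 0 tau)) => [|//||]; last 2 first.
  - apply/measurable_EFinP.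
    exact: (measurable_expR_rho measurable_squared_error).
  - by move=> y; rewrite lee_fin expR_ge0.
  under eq_integral do rewrite -EFinM (gaussian_tilt _ _ l0) EFinM.
  rewrite ge0_integralZl ?integral_normal_pdf ?mule1 ?lee_fin ?(ltW c0)//.
    apply/measurable_EFinP; exact: measurable_normal_pdf.
  by move=> y _; rewrite lee_fin; exact: normal_pdf_ge0.
rewrite lnM ?posrE ?invr_gt0 ?expR_gt0// expRK lnV ?posrE//.
have -> : ln (Num.sqrt (tilt l)) = 2^-1 * ln (tilt l).
  rewrite -[X in _ = _ * ln X](sqr_sqrtr (ltW u0)) lnXn//.
  by rewrite -[ln _ *+ 2]mulr_natl mulrA mulVf ?mul1r.
by rewrite mulNr; congr (_ + _); ring.
Qed.

(** The mean of [log_mgf Q se l] and its derivative in [l], for a centred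
    source of variance [s2]. *)
Definition gaussian_Lambda s2 l : R :=
  - 2^-1 * ln (tilt l) + l / tilt l * s2.

Definition gaussian_Lambda1 s2 l : R :=
  tau ^+ 2 / tilt l + s2 / tilt l ^+ 2.

Section legendre_data.
Variables (s2 D : R).
Hypothesis s20 : 0 <= s2.
Hypothesis D0 : 0 < D.
Hypothesis Dhigh : D < s2 + tau ^+ 2.
Local Notation L := (gaussian_Lambda s2).
Local Notation G := (gaussian_Lambda1 s2).

Lemma tiltK u : tilt ((1 - u) / (2 * tau ^+ 2)) = u.
Proof. by rewrite /tilt; field; rewrite gt_eqF. Qed.

Lemma tiltE l : l = (1 - tilt l) / (2 * tau ^+ 2).
Proof. by rewrite /tilt; field; rewrite gt_eqF. Qed.

Lemma tilt_lt0 u : 1 < u -> (1 - u) / (2 * tau ^+ 2) < 0.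
Proof. by move=> u1; rewrite pmulr_llt0 ?invr_gt0 ?mulr_gt0// subr_lt0. Qed.

(** In the variables [u = tilt l] and [t = tilt m] the difference of the two
    sides is a combination of [t / u - 1 - ln (t / u)] and of a multiple of
    [(u - t) ^+ 2], both nonnegative. *)
Lemma gaussian_subgradient l m : l < 0 -> m < 0 -> L l + (m - l) * G l <= L m.
Proof.
move=> l0 m0; have u1 := tilt_gt1 l0; have t1 := tilt_gt1 m0.
rewrite /gaussian_Lambda /gaussian_Lambda1.
move: (tilt l) (tilt m) (tiltE l) (tiltE m) u1 t1 => u t -> -> u1 t1.
have u0 : 0 < u := lt_trans ltr01 u1; have t0 : 0 < t := lt_trans ltr01 t1.
have ln_tu : ln t - ln u <= t / u - 1.
  rewrite -ln_div ?posrE//.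
  have := @le_ln1Dx R (t / u - 1); rewrite (addrC 1) subrK; apply.
  by rewrite ltrBrDr addNr divr_gt0.
have inv_tu : 0 <= t^-1 - u^-1 - (u - t) / u ^+ 2.
  have -> : t^-1 - u^-1 - (u - t) / u ^+ 2 = (u - t) ^+ 2 / (t * u ^+ 2).
    by field; rewrite !gt_eqF.
  by rewrite divr_ge0 ?sqr_ge0// mulr_ge0 ?sqr_ge0// ltW.
have tau20 : 0 <= 2 * tau ^+ 2 by rewrite mulr_ge0// ltW.
have h := mulr_ge0 (divr_ge0 s20 tau20) inv_tu.
rewrite -subr_ge0.
have -> : - 2^-1 * ln t + (1 - t) / (2 * tau ^+ 2) / t * s2 -
   (- 2^-1 * ln u + (1 - u) / (2 * tau ^+ 2) / u * s2 +
   ((1 - t) / (2 * tau ^+ 2) - (1 - u) / (2 * tau ^+ 2)) *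
     (tau ^+ 2 / u + s2 / u ^+ 2)) =
   2^-1 * (t / u - 1 - (ln t - ln u)) +
   s2 / (2 * tau ^+ 2) * (t^-1 - u^-1 - (u - t) / u ^+ 2).
  by field; rewrite !gt_eqF.
by rewrite addr_ge0// mulr_ge0// subr_ge0.
Qed.

Lemma gaussian_Lambda1_continuous l : l < 0 -> {for l, continuous G}.
Proof.
move=> l0; have u0 : 0 < tilt l := lt_trans ltr01 (tilt_gt1 l0).
have cu : tilt x @[x --> l] --> tilt l.
  rewrite /tilt; apply: cvgB; first exact: cvg_cst.
  by apply: cvgM; [apply: cvgM; [exact: cvg_cst|exact: cvg_id]|exact: cvg_cst].
rewrite /continuous_at /gaussian_Lambda1.
apply: cvgD; apply: cvgM; [exact: cvg_cst| |exact: cvg_cst|].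
  by apply: cvgV => //; rewrite gt_eqF.
apply: cvgV; first by rewrite expf_neq0// gt_eqF.
by rewrite expr2; under eq_fun do rewrite expr2; exact: cvgM.
Qed.

Lemma gaussian_Lambda1_low : exists2 l, l < 0 & G l < D.
Proof.
pose u := 1 + (s2 + tau ^+ 2) / D.
have st : 0 < s2 + tau ^+ 2 by rewrite ltr_wpDl.
have u1 : 1 < u by rewrite ltrDl divr_gt0.
have u0 : 0 < u := lt_trans ltr01 u1.
exists ((1 - u) / (2 * tau ^+ 2)); first exact: tilt_lt0.
rewrite /gaussian_Lambda1 tiltK.
have uD : u * D = D + (s2 + tau ^+ 2) by rewrite /u; field; rewrite gt_eqF.
apply: (@le_lt_trans _ _ ((s2 + tau ^+ 2) / u)); last first.
  by rewrite ltr_pdivrMr// mulrC uD ltrDr.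
rewrite mulrDl addrC lerD2r ler_wpM2l// lef_pV2 ?posrE ?exprn_gt0//.
by rewrite expr2 ler_peMl// ltW.
Qed.

Lemma gaussian_Lambda_le0 l : l < 0 -> L l <= 0.
Proof.
move=> l0; have u1 := tilt_gt1 l0; have u0 : 0 < tilt l := lt_trans ltr01 u1.
rewrite /gaussian_Lambda mulNr.
have h1 : 0 <= 2^-1 * ln (tilt l) by rewrite mulr_ge0// ln_ge0// ltW.
have h2 : l / tilt l * s2 <= 0.
  by apply: mulr_le0_ge0 => //; apply: mulr_le0_ge0; rewrite ?invr_ge0 ltW.
by move: h1 h2; lra.
Qed.

Local Notation v := (2^-1 * (tau ^+ 2 + Num.sqrt (tau ^+ 4 + 4 * D * s2))).

(** The tilt of slope [D] is [u = v / D]: this is the equation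
    [tau ^+ 2 / u + s2 / u ^+ 2 = D] cleared of denominators. *)
Lemma gaussian_vE : v ^+ 2 = tau ^+ 2 * v + s2 * D.
Proof.
have := @sqr_sqrtr _ (tau ^+ 4 + 4 * D * s2).
rewrite addr_ge0 ?mulr_ge0 ?(ltW D0) ?exprn_ge0 ?(ltW tau0)// => /(_ isT).
by move: (Num.sqrt _) => r hr; lra.
Qed.

Lemma gaussian_v_gt0 : 0 < v.
Proof. by rewrite mulr_gt0 ?invr_gt0// ltr_pwDl// sqrtr_ge0. Qed.

Lemma gaussian_v_gtD : D < v.
Proof.
rewrite ltNge; apply/negP; move: gaussian_vE gaussian_v_gt0.
move: (v) => w w2 w0 wD.
have h1 : s2 * w <= s2 * D by rewrite ler_wpM2l.
have h2 : w * D < w * (s2 + tau ^+ 2) by rewrite ltr_pM2l.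
have h3 : w * w <= w * D by rewrite ler_wpM2l// ltW.
by move: w2; rewrite expr2; lra.
Qed.

Local Notation ls := ((1 - v / D) / (2 * tau ^+ 2)).

Lemma gaussian_ls_lt0 : ls < 0.
Proof. by apply: tilt_lt0; rewrite ltr_pdivlMr// mul1r gaussian_v_gtD. Qed.

Lemma gaussian_Lambda1_ls : G ls = D.
Proof.
rewrite /gaussian_Lambda1 tiltK; move: gaussian_vE gaussian_v_gt0.
move: (v) => w w2 w0.
have -> : tau ^+ 2 / (w / D) + s2 / (w / D) ^+ 2 =
  D * (tau ^+ 2 * w + s2 * D) / w ^+ 2 by field; rewrite !gt_eqF.
by rewrite -w2 mulfK// expf_neq0// gt_eqF.
Qed.

Lemma gaussian_legendre : log2 (expR 1) * (ls * D - L ls) =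
  2^-1 * log2 (v / D) -
  log2 (expR 1) * ((v - D) * (v - s2) / (2 * v * tau ^+ 2)).
Proof.
rewrite /gaussian_Lambda tiltK /log2 expRK.
move: gaussian_vE gaussian_v_gt0; move: (v) => w w2 w0.
have ln2 : ln (2 : R) != 0 by rewrite gt_eqF// ln_gt0// ltr1n.
have -> : (1 - w / D) / (2 * tau ^+ 2) * D - (- 2^-1 * ln (w / D) +
    (1 - w / D) / (2 * tau ^+ 2) / (w / D) * s2) =
  2^-1 * ln (w / D) - (w - D) * (w - s2) / (2 * w * tau ^+ 2).
  by move: (ln (w / D)) => lw; field; rewrite !gt_eqF.
by rewrite mulrBr mulrCA mul1r [X in 2^-1 * X]mulrC.
Qed.

End legendre_data.

Context d0 (Omega : measurableType d0) (Pr : probability Omega R).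
Context (X : nat -> {mfun Omega >-> measurableTypeR R}).
Context (Y : forall n : nat, nat -> {mfun Omega >-> n.-tuple (measurableTypeR R)}).
Hypothesis stX : stationary Pr X.
Hypothesis ergX : ergodic Pr X.
Hypothesis X2 : (X 0%N : Omega -> R) \in Lfun Pr 2%:E.
Hypothesis EX : 'E_Pr[X 0%N]%E = 0%E.

(** [log_mgf] is affine in the squared source symbol, whose mean is the variance
    of the centred source. *)
Lemma birkhoff_gaussian_log_mgf s2 l : 'V_Pr[X 0%N]%E = s2%:E -> l < 0 ->
  {ae Pr, forall w,
    mean_upto (fun i => log_mgf Q se l (X i w)) @ \oo --> gaussian_Lambda s2 l}.
Proof.
move=> VX l0.
have msq : measurable_fun setT (fun x : measurableTypeR R => (x : R) ^+ 2).
  exact: measurable_funX.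
have sq0 (x : measurableTypeR R) : 0 <= (x : R) ^+ 2 by exact: sqr_ge0.
have := birkhoff_ge0 stX ergX msq sq0.
have -> : (\int[Pr]_w ((X 0%N w : R) ^+ 2)%:E = s2%:E)%E.
  by rewrite -VX varianceE// EX expeS mul0e sube0 unlock.
apply: filterS => w /fine_cvg; rewrite /comp/= => cw.
apply: cvg_trans; last first.
  apply: (cvgD (cvg_cst _) (cvgM (cvg_cst _) cw)).
apply: near_eq_cvg; near=> n.
have n0 : (n%:R : R) != 0 by rewrite pnatr_eq0 -lt0n; near: n; exists 1%N.
rewrite /mean_upto.
under [in RHS]eq_bigr do rewrite gaussian_log_mgf//.
rewrite big_split/= sumr_const card_ord -mulr_sumr -[(_ * ln _) *+ n]mulr_natl.
rewrite !fctE /=; move: (\sum_(i < n) _) (ln _) (l / _) => a b c; field.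
Unshelve. all: by end_near. Qed.

Theorem gaussian_codelength_rate (dflt : nat -> Omega -> nat) (sigma D : R) :
  'V_Pr[X 0%N]%E = (sigma ^+ 2)%:E ->
  shannon_codebooks Pr X Q Y -> 0 < D -> D < sigma ^+ 2 + tau ^+ 2 ->
  let v := 2^-1 * (tau ^+ 2 + Num.sqrt (tau ^+ 4 + 4 * D * sigma ^+ 2)) in
  {ae Pr, forall w,
    (fun n : nat => (code_length se D X Y dflt n w)%:R / n%:R : R) @ \oo -->
    2^-1 * log2 (v / D) -
      log2 (expR 1) * ((v - D) * (v - sigma ^+ 2) / (2 * v * tau ^+ 2))}.
Proof.
move=> VX cb D0 Dhigh v; have s20 := sqr_ge0 sigma.
rewrite -(gaussian_legendre s20 D0).
apply: (@code_length_legendre _ _ Omega Pr _ (measurableTypeR R) _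
  (measurableTypeR R) X Q Y _ D squared_error_ge0 measurable_squared_error cb _ _ _
  (gaussian_ls_lt0 s20 D0 Dhigh) (gaussian_subgradient s20)
  (gaussian_Lambda1_continuous (s2 := _)) (gaussian_Lambda1_ls s20 D0)
  (gaussian_Lambda1_low s20 D0) (gaussian_Lambda_le0 s20) dflt) => l l0.
exact: birkhoff_gaussian_log_mgf.
Qed.

End gaussian_codebook.

Theorem theorem12 (R : realType) (d0 : measure_display)
    (Omega : measurableType d0) (Pr : probability Omega R) :
  (forall (d d' : measure_display)
      (A : completeMetricMeasurableType d R)
      (Ahat : completeMetricMeasurableType d' R)
      (rho : A -> Ahat -> R) (P : probability A R) (Q : probability Ahat R)
      (X : nat -> {mfun Omega >-> A})
      (Y : forall n : nat, nat -> {mfun Omega >-> n.-tuple Ahat})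
      (dflt : nat -> Omega -> nat) (D : R),
    borel_separable A -> borel_separable Ahat ->
    (forall x y, 0 <= rho x y) ->
    measurable_fun setT (fun z : A * Ahat => rho z.1 z.2) ->
    stationary Pr X -> ergodic Pr X ->
    (forall B : set A, measurable B -> distribution Pr (X 0%N) B = P B) ->
    shannon_codebooks Pr X Q Y ->
    (D_min P Q rho < D%:E)%E -> (D%:E < D_av P Q rho)%E ->
    {ae Pr, forall w,
      (fun n : nat => ((code_length rho D X Y dflt n w)%:R / n%:R : R)%:E)
        @ \oo --> ((log2 (expR 1))%:E * R_1 rho P Q D)%E})
  /\
  (forall (X : nat -> {mfun Omega >-> measurableTypeR R})
      (Y : forall n : nat, nat -> {mfun Omega >-> n.-tuple (measurableTypeR R)})
      (dflt : nat -> Omega -> nat) (sigma tau D : R),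
    stationary Pr X -> ergodic Pr X ->
    (X 0%N : Omega -> R) \in Lfun Pr 2%:E ->
    'E_Pr[X 0%N]%E = 0%E ->
    'V_Pr[X 0%N]%E = (sigma ^+ 2)%:E ->
    0 < tau ->
    shannon_codebooks Pr X (normal_prob 0 tau) Y ->
    0 < D -> D < sigma ^+ 2 + tau ^+ 2 ->
    let v := 2^-1 * (tau ^+ 2 + Num.sqrt (tau ^+ 4 + 4 * D * sigma ^+ 2)) in
    {ae Pr, forall w,
      (fun n : nat =>
         (code_length (@squared_error R) D X Y dflt n w)%:R / n%:R : R)
        @ \oo --> 2^-1 * log2 (v / D) -
          log2 (expR 1) * ((v - D) * (v - sigma ^+ 2) / (2 * v * tau ^+ 2))}).
Proof.
split.
  move=> d d' A Ahat rho P Q X Y dflt D _ _ rho0 mrho stX ergX XP cb hmin hav.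
  exact: codelength_rate.
move=> X Y dflt sigma tau D stX ergX X2 EX VX tau0 cb D0 Dhigh.
exact: gaussian_codelength_rate.
Qed.
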